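(* Let $G$ be a $c$-packed geometric graph with $n$ nodes (with $c$-packedness defined via balls). (1) For every fixed $\varepsilon\in(0,1)$, a $\frac45$-balanced separator of $G$ of size at most $\frac{2\sqrt2}{1-\varepsilon}\,c$ can be computed in $\mathcal{O}(c^2 n)$ time. (2) A $\frac23$-balanced separator of $G$ of size at most $6c$ can be computed in $\mathcal{O}(c^2 n)$ time.
   Context: A geometric graph is a finite simple undirected graph embedded in the plane: each vertex is associated with a point in $\mathbb{R}^2$, each edge is a straight-line segment between its endpoints and has its Euclidean length; edges may cross. A geometric graph $G$ is $c$-packed if for each ball $S$ of radius $r$ (for every $r>0$) the total length of the edges of $G$ clipped to $S$ is at most $cr$. For $\alpha\in(0,1)$, an $\alpha$-balanced separator of $G=(V,E)$ with $|V|=n$ is a set $S\subset V$ such that all connected components of $G[V\setminus S]$ contain at most $\alpha n$ nodes; its size is $|S|$. The constant hidden in the running time in (1) may depend on the fixed $\varepsilon$.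
   Formalization: The formal theorem assumes n ≥ 1 and c ≥ 1; any c-packed graph with an edge has c ≥ 2, so only edgeless graphs with c < 1 are excluded, where the claim fails (one node with c = 1/10 needs a separator of size 1 > 6c, and c²n can be below one step). *)

(* Defs.v *)
From HB Require Import structures.
From mathcomp Require Import all_boot all_order all_algebra.
From mathcomp Require Import all_classical all_reals all_analysis.

Set Implicit Arguments.
Unset Strict Implicit.
Unset Printing Implicit Defensive.

Import Order.TTheory GRing.Theory Num.Theory.
Local Open Scope ring_scope.

(** * Geometric graphs *)

Section Plane.
Context {R : realType}.

(* The canonical norm on [R * R] is the sup norm, hence an explicit distance. *)
Definition edist (p q : R * R) : R :=
  Num.sqrt ((p.1 - q.1) ^+ 2 + (p.2 - q.2) ^+ 2).

Definition segpt (p q : R * R) (t : R) : R * R :=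
  (p.1 + t * (q.1 - p.1), p.2 + t * (q.2 - p.2)).

(* Length of the part of the segment [pq] inside the closed ball of center [x]
   and radius [r]: [segpt p q] parametrizes the segment with constant speed
   [edist p q].  Closed and open balls give the same length. *)
Definition clipped_length (p q x : R * R) (r : R) : R :=
  edist p q *
  fine (lebesgue_measure
    [set t : R | 0 <= t <= 1 /\ edist x (segpt p q t) <= r]%classic).

End Plane.

Record geomGraph (R : realType) (n : nat) := GeomGraph {
  pos : 'I_n -> R * R;
  adj : rel 'I_n;
  pos_inj : injective pos;
  adj_sym : symmetric adj;
  adj_irr : irreflexive adj }.

Section GraphNotions.
Context {R : realType} {n : nat}.
Implicit Types (G : geomGraph R n) (S : {set 'I_n}).

Definition packed (c : R) G : Prop :=
  forall (x : R * R) (r : R), 0 < r ->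
    \sum_(i < n) \sum_(j < n | (i < j)%N && adj G i j)
      clipped_length (pos G i) (pos G j) x r <= c * r.

Definition adj_avoiding G S : rel 'I_n :=
  [rel u v | [&& u \notin S, v \notin S & adj G u v]].

Definition component_avoiding G S (v : 'I_n) : {set 'I_n} :=
  [set w | connect (adj_avoiding G S) v w].

Definition balanced_separator (alpha : R) G S : Prop :=
  forall v : 'I_n, v \notin S ->
    #|component_avoiding G S v|%:R <= alpha * n%:R.

(* Every edge occurs exactly once in [s], in one of its two orientations; the
   order of the edges and their orientations are arbitrary. *)
Definition edge_listing G (s : seq ('I_n * 'I_n)) : Prop :=
  [/\ uniq s,
      forall u v, (u, v) \in s -> (v, u) \notin s
    & forall u v, adj G u v = ((u, v) \in s) || ((v, u) \in s)].

End GraphNotions.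

(** * Real RAM *)

(* Programs are while-programs in three-address form over integer and real
   variables and arrays; variables and arrays are named by natural numbers.
   Integers are natural numbers with addition and truncated subtraction only
   (a unit-cost product would be too powerful on unbounded integers).
   The only constants are natural numbers, so that a program is a finite object
   that carries no real data, and there is no conversion from reals to integers
   (no floor); reals influence control only through comparisons. *)

Inductive instr : Type :=
| Skip
| IConst (x k : nat)           (* x := k *)
| IAdd (x y z : nat)           (* x := y + z *)
| ISub (x y z : nat)           (* x := y - z, truncated at 0 *)
| ILoad (x a i : nat)          (* x := a[i], i an integer variable *)
| IStore (a i x : nat)         (* a[i] := x *)
| ROfInt (x y : nat)           (* real x := integer y *)
| RAdd (x y z : nat)
| RSub (x y z : nat)
| RMul (x y z : nat)
| RDiv (x y z : nat)           (* x := y / z, and 0 if z = 0 *)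
| RLoad (x a i : nat)
| RStore (a i x : nat).

Inductive test : Type :=
| ILe (x y : nat)
| RLe (x y : nat).

Inductive prog : Type :=
| Do of instr
| Seq of prog & prog
| If of test & prog & prog
| While of test & prog.

Record state (R : realType) := State {
  ivar : nat -> nat;
  rvar : nat -> R;
  iarr : nat -> nat -> nat;
  rarr : nat -> nat -> R }.

Section Semantics.
Context {R : realType}.
Implicit Types (st : state R).

Definition upd {T : Type} (f : nat -> T) (x : nat) (v : T) : nat -> T :=
  fun y => if y == x then v else f y.

Definition upd2 {T : Type} (f : nat -> nat -> T) (a i : nat) (v : T) :=
  upd f a (upd (f a) i v).

Definition set_ivar st x k := State (upd (ivar st) x k) (rvar st) (iarr st) (rarr st).
Definition set_rvar st x v := State (ivar st) (upd (rvar st) x v) (iarr st) (rarr st).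
Definition set_iarr st a i k := State (ivar st) (rvar st) (upd2 (iarr st) a i k) (rarr st).
Definition set_rarr st a i v := State (ivar st) (rvar st) (iarr st) (upd2 (rarr st) a i v).

Definition run_instr (c : instr) st : state R :=
  match c with
  | Skip => st
  | IConst x k => set_ivar st x k
  | IAdd x y z => set_ivar st x (ivar st y + ivar st z)%N
  | ISub x y z => set_ivar st x (ivar st y - ivar st z)%N
  | ILoad x a i => set_ivar st x (iarr st a (ivar st i))
  | IStore a i x => set_iarr st a (ivar st i) (ivar st x)
  | ROfInt x y => set_rvar st x (ivar st y)%:R
  | RAdd x y z => set_rvar st x (rvar st y + rvar st z)
  | RSub x y z => set_rvar st x (rvar st y - rvar st z)
  | RMul x y z => set_rvar st x (rvar st y * rvar st z)
  | RDiv x y z => set_rvar st x (rvar st y / rvar st z)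
  | RLoad x a i => set_rvar st x (rarr st a (ivar st i))
  | RStore a i x => set_rarr st a (ivar st i) (rvar st x)
  end.

Definition eval_test (b : test) st : bool :=
  match b with
  | ILe x y => (ivar st x <= ivar st y)%N
  | RLe x y => rvar st x <= rvar st y
  end.

(* [exec p st t st']: started in [st], [p] halts in [st'] after [t] steps; each
   instruction and each evaluation of a test is one step. *)
Inductive exec : prog -> state R -> nat -> state R -> Prop :=
| exec_do c st : exec (Do c) st 1 (run_instr c st)
| exec_seq p q st1 st2 st3 t u :
    exec p st1 t st2 -> exec q st2 u st3 -> exec (Seq p q) st1 (t + u) st3
| exec_if b p q st st' t :
    exec (if eval_test b st then p else q) st t st' ->
    exec (If b p q) st t.+1 st'
| exec_while_end b p st :
    ~~ eval_test b st -> exec (While b p) st 1 st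
| exec_while_step b p st1 st2 st3 t u :
    eval_test b st1 -> exec p st1 t st2 -> exec (While b p) st2 u st3 ->
    exec (While b p) st1 (t + u).+1 st3.

(* Input: integer variables 0 and 1 hold the numbers of nodes and of edges,
   real arrays 0 and 1 the coordinates of the nodes, and integer arrays 0 and 1
   the endpoints of the edges; everything else is 0. *)
Definition input_state n (G : geomGraph R n) (s : seq ('I_n * 'I_n)) : state R :=
  let coord (f : R * R -> R) i :=
    if (insub i : option 'I_n) is Some v then f (pos G v) else 0 in
  let ends (f : 'I_n * 'I_n -> 'I_n) i := nth 0%N [seq val (f e) | e <- s] i in
  State
    (fun x => match x with 0 => n | 1 => size s | _ => 0 end)%N
    (fun _ => 0)
    (fun a i => match a with 0 => ends fst i | 1 => ends snd i | _ => 0 end)%N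
    (fun a i => match a with 0%N => coord fst i | 1%N => coord snd i | _ => 0 end).

(* Output: a set of nodes, given by its characteristic vector in integer
   array 2. *)
Definition output_set n st : {set 'I_n} := [set v : 'I_n | iarr st 2 v != 0%N].

(* One program, which is not given [c], and one constant [K] for all graphs.
   The bounds presuppose [0 < n] and [1 <= c].  As soon as there is an edge,
   [c]-packedness forces [2 <= c], so [1 <= c] only excludes edgeless graphs
   with a degenerate [c]: these are [c]-packed for every [c >= 0], although for
   [n = 1] the only balanced separator has size 1 and [c ^+ 2 * n] may be
   arbitrarily small. *)
Definition separator_computable (alpha : R) (size_bound : R -> R)
    (time : R -> nat -> R) : Prop :=
  exists (p : prog) (K : R),
    forall (n : nat) (G : geomGraph R n) (s : seq ('I_n * 'I_n)) (c : R),
      (0 < n)%N -> 1 <= c -> packed c G -> edge_listing G s ->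
      exists (t : nat) (st : state R),
        [/\ exec p (input_state G s) t st,
            t%:R <= K * time c n,
            balanced_separator alpha G (output_set n st)
          & #|output_set n st|%:R <= size_bound c].

End Semantics.

(* Main.v *)
(** Take a square of (almost) least side [r] with at least [n / 5] nodes.  The
    concentric square of side [2 r] is covered by four squares of side [r], so
    it has at most [4 n / 5] nodes, and every square in between is a balanced
    cut.  It lies in a disc of radius [sqrt 2 * r], hence the average number of
    edges that cross the boundary of an intermediate square is at most
    [2 * sqrt 2 * c].  Replacing squares by rectangles of side ratio about
    [sqrt 2], doubled along the short side and halved again, needs only two
    rectangles for the cover, and gives [2 / 3] and [6 c].

    Three points make this an O(c ^ 2 n) algorithm.
    - An approximate least square need not be searched everywhere: let [p] be
      the point of the approximate medians of the coordinates and [del] the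
      approximate median distance to [p].  An outer square with too many nodes
      contains [p], and has a side comparable to [del] or larger; hence a
      descent through smaller and smaller squares stays in a grid of constant
      size around [p], and one of its squares passes the test.
    - A deterministic approximate median costs O(n).
    - A level crossed by few edges is found by bisection, by the method of
      conditional expectations, with a penalty for the edges that still end
      inside the current interval; since sizes are measured against [c >= 1],
      the penalty can be so small that the total work is O(c) per edge, and
      there are O(c n) edges because every degree is O(c). *)

Require Import Defs.
From HB Require Import structures.
From mathcomp Require Import all_boot all_order all_algebra.
From mathcomp Require Import all_classical all_reals all_analysis.
From mathcomp Require Import measurable_realfun zify ring lra.
(* Mathcomp-analysis also has an [edist]. *)
Import Defs.

Set Implicit Arguments.
Unset Strict Implicit.
Unset Printing Implicit Defensive.

Import Order.TTheory GRing.Theory Num.Theory.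
Local Open Scope ring_scope.

(** The concentric rectangles are the sublevel sets of a scaled sup norm, [gauge]: a node becomes a
    level, an edge an interval of levels, and [packed] serves only to bound the total length of
    these intervals within a range of levels. A uniform level between [t0] and [t1] cuts at most [c
    * t1 * sqrt (A ^ 2 + B ^ 2) / (mu * (t1 - t0))] edges on average, [mu] being the smaller of [A]
    and [B]. A doubled square gives [2 * sqrt 2 * c] with nothing to spare; this is what the [eps]
    of (1) pays for. Side ratio and scale factor [sqrt 2] give [(2 + sqrt 2) * sqrt 3 < 5.92], so
    the 6 of (2) leaves room for rational sides. The machine has no floor and no product of
    integers, so positions cannot be rounded to a grid at run time. The grid is a constant of the
    program, with the search unrolled over it; only its origin [p] and its unit [del / steps] are
    data. Sizes are integers [u], and the outer rectangle is scaled by [u - 1], the size of the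
    inner rectangles that cover it. The ratio of scales thus misses the ideal one by O(1 / u),
    whence the lower bound [u0] on sizes. *)

Arguments upd {T} f x v y /.
Arguments upd2 {T} f a i v /.

(** * Total correctness with running time *)

Section Runs.
Context {R : realType}.
Implicit Types (st : state R) (p q : prog) (Q : state R -> Prop).

(** The number of steps is only bounded, so that branches of unequal cost share one bound and bounds
    can be rounded up to convenient forms. *)
Definition runs p st (T : nat) Q : Prop :=
  exists t st', [/\ exec p st t st', (t <= T)%N & Q st'].

Lemma runs_weaken p st T T' Q Q' :
  runs p st T Q -> (T <= T')%N -> (forall st', Q st' -> Q' st') ->
  runs p st T' Q'.
Proof.
move=> [t [st' [e tT q]]] TT QQ; exists t, st'; split => //.
- exact: leq_trans TT.
- exact: QQ.
Qed.

Lemma runs_seq p q st T T' Q Q' :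
  runs p st T Q -> (forall st', Q st' -> runs q st' T' Q') ->
  runs (Seq p q) st (T + T') Q'.
Proof.
move=> [t [st' [e tT q1]]] /(_ _ q1) [u [st'' [e' uT q2]]].
exists (t + u)%N, st''; split => //; last exact: leq_add.
exact: exec_seq e e'.
Qed.

Lemma runs_do c st Q : Q (run_instr c st) -> runs (Do c) st 1 Q.
Proof. by exists 1%N, (run_instr c st); split => //; constructor. Qed.

Lemma runs_if b p q st T Q :
  (eval_test b st -> runs p st T Q) -> (~~ eval_test b st -> runs q st T Q) ->
  runs (If b p q) st T.+1 Q.
Proof.
move=> h1 h2; case E : (eval_test b st).
  case: (h1 E) => t [st' [e tT q1]]; exists t.+1, st'; split => //.
  by apply: exec_if; rewrite E.
case: (h2 (negbT E)) => t [st' [e tT q1]]; exists t.+1, st'; split => //.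
by apply: exec_if; rewrite E.
Qed.

Lemma runs_while_end b p st Q : ~~ eval_test b st -> Q st ->
  runs (While b p) st 1 Q.
Proof. by move=> h q; exists 1%N, st; split => //; constructor. Qed.

Lemma runs_while_step b p st T T' Q Q' : eval_test b st -> runs p st T Q ->
  (forall st', Q st' -> runs (While b p) st' T' Q') ->
  runs (While b p) st (T + T').+1 Q'.
Proof.
move=> hb [t [st' [e tT q1]]] /(_ _ q1) [u [st'' [e' uT q2]]].
exists (t + u).+1, st''; split => //; last by rewrite ltnS leq_add.
exact: exec_while_step e e'.
Qed.

Definition block (l : seq instr) : prog :=
  foldr (fun c p => Seq (Do c) p) (Do Skip) l.

Arguments block : simpl never.

(** Straight-line code is run by simplification: the fold computes the final state as a term. The
    extra step is the [Skip] that ends every block. *)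
Lemma runs_block l st Q :
  Q (foldl (fun s c => run_instr c s) st l) -> runs (block l) st (size l).+1 Q.
Proof.
elim: l st => [|c l IH] st; rewrite /block /= => h; first exact: runs_do.
rewrite -[(size l).+2]add1n; apply: (@runs_seq _ _ _ _ _ (eq (run_instr c st))).
  exact: runs_do.
by move=> _ <-; apply: IH.
Qed.

Lemma runs_block_seq l p st T Q :
  runs p (foldl (fun s c => run_instr c s) st l) T Q ->
  runs (Seq (block l) p) st ((size l).+1 + T) Q.
Proof.
move=> h; apply: (@runs_seq _ _ _ _ _ (eq (foldl (fun s c => run_instr c s) st l))).
  exact: runs_block.
by move=> _ <-.
Qed.

Lemma runs_while_block b l st T Q : eval_test b st ->
  runs (While b (block l)) (foldl (fun s c => run_instr c s) st l) T Q ->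
  runs (While b (block l)) st ((size l).+1 + T).+1 Q.
Proof.
move=> hb h; apply: (@runs_while_step _ _ _ _ _
  (eq (foldl (fun s c => run_instr c s) st l))) => //; last by move=> _ <-.
exact: runs_block.
Qed.

(* Registers are tagged with their kind: 0 and 1 for integer and real
   variables, 2 and 3 for integer and real arrays. *)
Definition writes_instr (c : instr) : seq (nat * nat) :=
  match c with
  | Skip => [::]
  | IConst x _ | IAdd x _ _ | ISub x _ _ | ILoad x _ _ => [:: (0, x)]
  | IStore a _ _ => [:: (2, a)]
  | ROfInt x _ | RAdd x _ _ | RSub x _ _ | RMul x _ _ | RDiv x _ _
  | RLoad x _ _ => [:: (1, x)]
  | RStore a _ _ => [:: (3, a)]
  end%N.

Fixpoint writes (p : prog) : seq (nat * nat) :=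
  match p with
  | Do c => writes_instr c
  | Seq p q | If _ p q => writes p ++ writes q
  | While _ p => writes p
  end.

Record agree_off (w : seq (nat * nat)) st st' : Prop := AgreeOff {
  agree_ivar x : (0%N, x) \notin w -> ivar st' x = ivar st x;
  agree_rvar x : (1%N, x) \notin w -> rvar st' x = rvar st x;
  agree_iarr a : (2%N, a) \notin w -> iarr st' a = iarr st a;
  agree_rarr a : (3%N, a) \notin w -> rarr st' a = rarr st a }.

Lemma agree_off_trans w st1 st2 st3 :
  agree_off w st1 st2 -> agree_off w st2 st3 -> agree_off w st1 st3.
Proof.
move=> h1 h2; split=> x xw.
- by rewrite (agree_ivar h2) // (agree_ivar h1).
- by rewrite (agree_rvar h2) // (agree_rvar h1).
- by rewrite (agree_iarr h2) // (agree_iarr h1).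
- by rewrite (agree_rarr h2) // (agree_rarr h1).
Qed.

Lemma agree_off_sub (w w' : seq (nat * nat)) st st' : {subset w <= w'} ->
  agree_off w st st' -> agree_off w' st st'.
Proof.
move=> s h; split=> x xw.
- by rewrite (agree_ivar h) //; apply: contra xw => /s.
- by rewrite (agree_rvar h) //; apply: contra xw => /s.
- by rewrite (agree_iarr h) //; apply: contra xw => /s.
- by rewrite (agree_rarr h) //; apply: contra xw => /s.
Qed.

Lemma exec_agree p st t st' : exec p st t st' -> agree_off (writes p) st st'.
Proof.
elim=> {p st t st'} /=.
- move=> c st.
  by case: c => *; split=> //= z; rewrite inE xpair_eqE /= /upd2 /upd;
    move=> /negbTE ->.
- move=> p q st1 st2 st3 t u _ h1 _ h2; apply: (@agree_off_trans _ _ st2).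
    by apply: agree_off_sub h1 => z zw; rewrite mem_cat zw.
  by apply: agree_off_sub h2 => z zw; rewrite mem_cat zw orbT.
- move=> b p q st st' t _; case: ifP => _ h.
    by apply: agree_off_sub h => z zw; rewrite mem_cat zw.
  by apply: agree_off_sub h => z zw; rewrite mem_cat zw orbT.
- by [].
- by move=> b p st1 st2 st3 t u _ _ h1 _ h2; apply: (@agree_off_trans _ _ st2).
Qed.

(** A frame rule. The proof of a fragment treats only the registers of interest; that the others
    keep their values is decided by computation on [writes p], hence the arguments [isT] below. *)
Lemma runs_agree p st T Q : runs p st T Q ->
  runs p st T (fun st' => Q st' /\ agree_off (writes p) st st').
Proof.
move=> [t [st' [e tT q]]]; exists t, st'; split => //; split => //.
exact: exec_agree e.
Qed.

End Runs.

Notation iN := 0%N (only parsing).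
Notation iM := 1%N (only parsing).
Notation i1 := 2%N (only parsing).
Notation i2 := 3%N (only parsing).
Notation i4 := 4%N (only parsing).

(* The body finds in [c] the number of iterations that remain after it; the
   register [i1] must hold 1. *)
Definition loop (c : nat) (p : prog) : prog :=
  While (ILe i1 c) (Seq (Do (ISub c c i1)) p).

Arguments loop : simpl never.
Arguments block : simpl never.

Section Loop.
Context {R : realType}.
Implicit Types (st : state R) (p q : prog) (Q : state R -> Prop).

(** The index of the invariant is the number of rounds left. A round costs its body, the test and
    the decrement; the last step is the failing test. *)
Lemma runs_loop c p (Inv : nat -> state R -> Prop) T k st :
  (forall k st, Inv k st -> ivar st c = k /\ ivar st i1 = 1%N) ->
  (forall k st, Inv k.+1 st -> runs p (set_ivar st c k) T (Inv k)) ->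
  Inv k st -> runs (loop c p) st (k * T.+2).+1 (Inv 0%N).
Proof.
move=> hc hp; elim: k st => [|k IH] st hk.
  apply: runs_while_end => //=; have [-> ->] := hc _ _ hk; by [].
have [h1 h2] := hc _ _ hk.
have -> : (k.+1 * T.+2).+1 = (1 + T + (k * T.+2).+1).+1 by rewrite mulSn; lia.
apply: runs_while_step (IH).
  by rewrite /= h1 h2.
apply: runs_seq; first by apply: runs_do; apply: erefl.
move=> _ <-.
have <- : set_ivar st c k = run_instr (ISub c c i1) st by rewrite /= h1 h2 subn1.
exact: hp.
Qed.

End Loop.

(* Locked, lest simplification unfold it. *)
Definition arr {T : Type} (f : nat -> T) (k : nat) : seq T := locked (mkseq f k).

Section Arr.
Context {T : Type}.
Implicit Types (f : nat -> T) (k i : nat).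

Lemma arrE f k : arr f k = mkseq f k. Proof. by rewrite /arr -lock. Qed.

Lemma arr0 f : arr f 0 = [::]. Proof. by rewrite arrE. Qed.

Lemma arrS f k : arr f k.+1 = rcons (arr f k) (f k).
Proof. by rewrite !arrE mkseqS. Qed.

Lemma size_arr f k : size (arr f k) = k.
Proof. by rewrite arrE size_mkseq. Qed.

Lemma eq_arr f g k : (forall i, (i < k)%N -> f i = g i) -> arr f k = arr g k.
Proof.
by move=> h; rewrite !arrE; apply/eq_in_map => i; rewrite mem_iota /=; exact: h.
Qed.

Lemma arr_upd_ge f k i v : (k <= i)%N -> arr (upd f i v) k = arr f k.
Proof. by move=> ki; apply: eq_arr => j jk; rewrite /upd; case: eqP => // jI; lia. Qed.

End Arr.

(** * Approximate median in linear time *)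

Section Lists.
Context {R : realType}.
Implicit Types (x y : R) (s : seq R) (D : pred R).

(** Past the insertion point the displaced element is carried on, which is how one left-to-right
    sweep over an array inserts in place. *)
Fixpoint insl x s : seq R :=
  if s is y :: s' then
    if y <= x then y :: insl x s' else x :: insl y s'
  else [:: x].

Lemma perm_insl x s : perm_eq (insl x s) (x :: s).
Proof.
elim: s x => [|y s IH] x //=; case: ifP => _.
  apply: (@perm_trans _ (y :: x :: s)); first by rewrite perm_cons.
  exact: (permEl (perm_catCA [:: y] [:: x] s)).
by rewrite perm_cons.
Qed.

Lemma path_insl z x s : z <= x -> path <=%R z s -> path <=%R z (insl x s).
Proof.
elim: s x z => [|y s IH] x z zx /=; first by rewrite zx.
move=> /andP[zy ys]; case: leP => [yx|xy] /=; first by rewrite zy IH.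
rewrite zx IH //; first exact: ltW.
exact: (path_le (@le_trans _ R) (ltW xy) ys).
Qed.

Lemma sorted_insl x s : sorted <=%R s -> sorted <=%R (insl x s).
Proof.
case: s => [|y s] //= ys; case: leP => [yx|xy] /=; first exact: path_insl.
apply: path_insl; first exact: ltW.
exact: (path_le (@le_trans _ R) (ltW xy) ys).
Qed.

(** Thinning is analysed for all down-closed sets at once: the value [v] is known only at the end,
    and both [x <= v] and [x < v] have to be counted then. *)
Definition downclosed D := forall x y, x <= y -> D y -> D x.

Fixpoint thin4 s : seq R :=
  if s is _ :: _ :: _ :: d :: s' then d :: thin4 s' else [::].

Lemma size_thin4 s : (4 * size (thin4 s) <= size s)%N.
Proof.
have [n] := ubnP (size s); elim: n s => // n IH [|a [|b [|c [|d s]]]] //= h.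
by have := IH s; lia.
Qed.

(** A down-closed set meets a sorted list in a prefix, and contains the kept last element of a group
    exactly if it contains the whole group. So at most 3 elements are missed: those in the group
    where the prefix ends, or in the dropped remainder. *)
Lemma thin4_count D s : downclosed D -> sorted <=%R s ->
  (4 * count D (thin4 s) <= count D s <= 4 * count D (thin4 s) + 3)%N.
Proof.
move=> dD; have [n] := ubnP (size s).
elim: n s => // n IH [|a [|b [|c [|d s]]]] h.
- by [].
- by move=> _ /=; case: (D a).
- by move=> _ /=; case: (D a); case: (D b).
- by move=> _ /=; case: (D a); case: (D b); case: (D c).
move=> ss; have := ss => /= /and4P[ab bc cd ds].
have {}IH : (4 * count D (thin4 s) <= count D s <= 4 * count D (thin4 s) + 3)%N.
  by apply: IH; [move: h => /=; lia | exact: path_sorted ds].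
rewrite [thin4 _]/=.
case Dd : (D d).
  have Dc := dD _ _ cd Dd; have Db := dD _ _ bc Dc; have Da := dD _ _ ab Db.
  rewrite /= Dc Db Da; lia.
have s0 : count D s = 0%N.
  apply/eqP; rewrite eqn0Ngt -has_count; apply/hasPn => z zs.
  apply/negP => Dz; have := order_path_min le_trans ds.
  by move=> /allP /(_ _ zs) dz; rewrite (dD _ _ dz Dz) in Dd.
have t0 : count D (thin4 s) = 0%N by lia.
by rewrite /= s0 t0; case: (D a); case: (D b); case: (D c).
Qed.

End Lists.

Notation iL := 5%N (only parsing).
Notation iB := 6%N (only parsing).
Notation iB1 := 7%N (only parsing).
Notation iS := 8%N (only parsing).
Notation iD := 9%N (only parsing).
Notation iK := 10%N (only parsing).
Notation iC := 11%N (only parsing).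
Notation iJ := 12%N (only parsing).
Notation iC2 := 13%N (only parsing).
Notation rZ := 0%N (only parsing).
Notation rX := 1%N (only parsing).
Notation rY := 2%N (only parsing).
Notation rV := 3%N (only parsing).

(** There is no copy instruction: [rZ] always holds 0, and adding it copies a real; a freshly
    cleared integer variable does the same for integers. *)
Definition insert_prog : prog :=
  Seq (block [:: IConst iJ 0; IAdd iC2 iK iJ])
 (Seq (loop iC2
   (Seq (block [:: RLoad rY 3 iJ])
   (Seq (If (RLe rY rX) (block [::])
            (block [:: RStore 3 iJ rX; RAdd rX rY rZ]))
        (block [:: IAdd iJ iJ i1]))))
   (block [:: RStore 3 iK rX; IAdd iK iK i1])).

(** The last element of each full group of four is kept, hence the start at index 3. It is written
    into array 2 itself, over input that has already been read. *)
Definition flush_prog : prog :=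
  Seq (block [:: IConst iC2 0; IAdd iC2 iC2 iK; IConst iJ 3; IConst iK 0])
   (While (ILe i4 iC2)
     (block [:: RLoad rY 3 iJ; RStore 2 iD rY; IAdd iD iD i1; IAdd iJ iJ i4;
                ISub iC2 iC2 i4])).

Definition round_prog : prog :=
  Seq (block [:: IConst iS 0; IConst iD 0; IConst iK 0; IAdd iC iL iS])
 (Seq (loop iC (Seq (block [:: RLoad rX 2 iS; IAdd iS iS i1])
               (Seq insert_prog (If (ILe iB iK) flush_prog (block [::])))))
 (Seq flush_prog (block [:: IAdd iL iD iK; IAdd iB iB iB; IAdd iB1 iB i1]))).

Definition sort_prog : prog :=
  Seq (block [:: IConst iS 0; IConst iK 0; IAdd iC iL iS])
      (loop iC (Seq (block [:: RLoad rX 2 iS; IAdd iS iS i1]) insert_prog)).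

(** The machine cannot halve an integer; [iJ] counts how often 2 can be subtracted from the
    length. *)
Definition middle_prog : prog :=
  Seq (block [:: IConst iJ 0; IAdd iC2 iK iJ])
 (Seq (While (ILe i2 iC2) (block [:: ISub iC2 iC2 i2; IAdd iJ iJ i1]))
      (block [:: RLoad rV 3 iJ])).

(* A deterministic linear-time median: sort blocks of size [B], keep every
   fourth element of each sorted block, double [B] and start again, until one
   block is left.  A round multiplies the number of elements by 1/4 and the
   cost per element by 2; it loses less than 4 elements per block, and the
   losses form a geometric series of sum O(n / 128). *)
Definition median_prog : prog :=
  Seq (block [:: IConst iB 128; IAdd iB1 iB i1])
 (Seq (While (ILe iB1 iL) round_prog) (Seq sort_prog middle_prog)).

(** * Correctness and cost of the approximate median *)

Section Median.
Context {R : realType}.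
Implicit Types (st : state R) (p q : prog) (Q : state R -> Prop).

Definition consts st := [/\ ivar st i1 = 1%N, ivar st i2 = 2%N,
  ivar st i4 = 4%N & rvar st rZ = 0].

Definition buffer st : seq R := arr (rarr st 3) (ivar st iK).

Lemma runs_insert st : consts st ->
  runs insert_prog st (20 * (ivar st iK).+1) (fun st' =>
    [/\ ivar st' iK = (ivar st iK).+1, 
        buffer st' = insl (rvar st rX) (buffer st)
      & agree_off (writes insert_prog) st st']).
Proof.
move=> [c1 c2 c4 cz].
pose k := ivar st iK; pose s1 := insl (rvar st rX) (buffer st).
(* What has been rewritten, followed by the insertion of the carried element into the rest, always
   spells the final list. *)
pose Inv r st1 := [/\ ivar st1 iC2 = r, ivar st1 i1 = 1%N,
   (ivar st1 iK = k /\ rvar st1 rZ = 0), (ivar st1 iJ + r)%N = k &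
   arr (rarr st1 3) (ivar st1 iJ) ++
     insl (rvar st1 rX) [seq rarr st1 3 i | i <- iota (ivar st1 iJ) r] = s1].
suff : runs insert_prog st (20 * k.+1) (fun st' =>
    ivar st' iK = k.+1 /\ buffer st' = s1).
  move=> /runs_agree h; apply: (runs_weaken h) => // st'.
  by move=> [] [-> ->].
have -> : (20 * k.+1 = 3 + (k * 10 + 1 + (20 * k.+1 - k * 10 - 4)))%N by lia.
apply: runs_block_seq => /=.
apply: (@runs_seq _ _ _ _ _ _ (Inv 0%N)).
  rewrite addn1; apply: (@runs_loop _ _ _ Inv 8).
  - by move=> ? ? [].
  - move=> r st1 [h1 h2 [h3 h4] h5 h6].
    apply: (@runs_block_seq _ [:: _] _ _ 6) => /=.
    apply: (@runs_seq _ _ _ _ 4 2 (fun st2 =>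
      [/\ ivar st2 iC2 = r, ivar st2 i1 = 1%N,
       (ivar st2 iK = k /\ rvar st2 rZ = 0), (ivar st2 iJ + r.+1)%N = k &
       arr (rarr st2 3) (ivar st2 iJ).+1 ++
         insl (rvar st2 rX) [seq rarr st2 3 i | i <- iota (ivar st2 iJ).+1 r]
       = s1])).
    move: h6; rewrite /= => h6.
      apply: runs_if => /= hc.
        apply: (@runs_weaken _ _ _ 1%N) => //; last by move=> ?; apply.
        apply: runs_block => /=; split => //.
        by rewrite -h6 hc arrS cat_rcons.
      apply: (runs_block (l := [:: _; _])) => /=; split => //=.
      rewrite -h6 (negbTE hc) arrS /= eqxx cat_rcons arr_upd_ge // h4 addr0.
      congr (_ ++ _ :: insl _ _).
      apply/eq_in_map => i; rewrite mem_iota; case: eqP => //; lia.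
    move=> st2 [g1 g2 [g3 g4] g5 g6]; apply: (runs_block (l := [:: _])) => /=.
    by rewrite g2 addn1; split => //=; lia.
  by rewrite /Inv /= arr0 addn0 /s1 /buffer arrE; split.
move=> st1 [h1 h2 [h3 h4] h5 h6].
apply: (@runs_weaken _ _ _ 3); [apply: (runs_block (l := [:: _; _])) => /=| lia| by move=> ?; apply].
rewrite /buffer /= h3 h2 addn1; split => //.
rewrite arrS /= eqxx arr_upd_ge // -h6.
have -> : ivar st1 iJ = k by lia.
by rewrite -cats1.
Qed.

Lemma runs_flush st : consts st -> (ivar st iD + ivar st iK <= ivar st iS)%N ->
  runs flush_prog st (20 * (ivar st iK).+1) (fun st' =>
    [/\ ivar st' iK = 0%N,
        arr (rarr st' 2) (ivar st' iD) =
          arr (rarr st 2) (ivar st iD) ++ thin4 (buffer st),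
        forall i, (ivar st iS <= i)%N -> rarr st' 2 i = rarr st 2 i,
        ivar st' iD = (ivar st iD + size (thin4 (buffer st)))%N
      & agree_off (writes flush_prog) st st']).
Proof.
move=> [c1 c2 c4 cz] hD.
set s := buffer st; set k := ivar st iK in hD *; set d := ivar st iD in hD *.
set S := ivar st iS in hD *.
set X := rarr st 2; set Y := rarr st 3.
have sE : [seq Y i | i <- iota 0 k] = s by rewrite /s /buffer arrE.
suff : runs flush_prog st (20 * k.+1) (fun st' =>
    [/\ ivar st' iK = 0%N,
        arr (rarr st' 2) (ivar st' iD) = arr X d ++ thin4 s,
        forall i, (S <= i)%N -> rarr st' 2 i = X i
      & ivar st' iD = (d + size (thin4 s))%N]).
  move=> /runs_agree h; apply: (runs_weaken h) => // st'.
  by move=> [] [].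
have loopP r st1 : (exists j d1, [/\ ivar st1 iC2 = r, ivar st1 i4 = 4%N,
     ivar st1 i1 = 1%N, ivar st1 iK = 0%N & 
    [/\ ivar st1 iJ = (j + 3)%N, rarr st1 3 = Y, (j + r = k)%N &
      [/\ ivar st1 iD = d1, (d <= d1 <= d + j)%N,
      arr (rarr st1 2) d1 ++ thin4 [seq Y i | i <- iota j r] = arr X d ++ thin4 s,
      forall i, (S <= i)%N -> rarr st1 2 i = X i &
      (d1 + size (thin4 [seq Y i | i <- iota j r]) = d + size (thin4 s))%N ]]]) ->
   runs (While (ILe i4 iC2)
     (block [:: RLoad rY 3 iJ; RStore 2 iD rY; IAdd iD iD i1; IAdd iJ iJ i4;
                ISub iC2 iC2 i4])) st1 (8 * r).+1 
      (fun st' => [/\ ivar st' iK = 0%N,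
        arr (rarr st' 2) (ivar st' iD) = arr X d ++ thin4 s,
        forall i, (S <= i)%N -> rarr st' 2 i = X i
      & ivar st' iD = (d + size (thin4 s))%N]).
  have [m] := ubnP r; elim: m r st1 => // m IH r st1 rm.
  move=> [j [d1 [h1 h2 h3 h4 [h5 h6 h7 [h8 h9 h10 h11 h12]]]]].
  have [r4|r4] := leqP 4 r; last first.
    apply: (@runs_weaken _ _ _ 1%N) => //; last by move=> ?; apply.
    apply: runs_while_end => /=; first by rewrite h1 h2; lia.
    move: r4 h10 h12; case: (r) => [|[|[|[|]]]] //= _;
      by rewrite h8 cats0 addn0 => -> ->.
  have -> : ((8 * r).+1 = (6 + (8 * r - 6)).+1)%N by lia.
  apply: (runs_while_block (l := [:: _; _; _; _; _])); first by rewrite /= h1 h2.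
  rewrite /=.
  apply: (@runs_weaken _ _ _ (8 * (r - 4)).+1); [apply: IH|lia|by move=> ?; apply].
    by lia.
  exists (j + 4)%N, d1.+1; rewrite /= h1 h2 h3 h4 h5 h6 h8 addn1.
  have rE : r = (r - 4).+4 by lia.
  have iE : iota j r = [:: j, j.+1, j.+2, j.+3 & iota (j + 4) (r - 4)].
    by rewrite {1}rE /= !addnS addn0.
  split => //; split => //; [lia|lia|split => //].
  - by lia.
  - by rewrite -h10 iE arrS /= eqxx cat_rcons !addnS addn0 arr_upd_ge.
  - by move=> i Si; case: eqP => [|_]; [lia | exact: h11].
  - by rewrite -h12 iE /=; lia.
have -> : (20 * k.+1 = 5 + (20 * k.+1 - 5))%N by lia.
apply: (runs_block_seq (l := [:: _; _; _; _])) => /=.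
apply: (@runs_weaken _ _ _ (8 * k).+1); [apply: loopP|lia|by move=> ?; apply].
exists 0%N, d; split => //; split => //; split => //.
- by rewrite leqnn leq_addr.
- by rewrite sE.
- by rewrite sE.
Qed.

Definition keeps_consts (w : seq (nat * nat)) :=
  [&& (0, i1) \notin w, (0, i2) \notin w, (0, i4) \notin w & (1, rZ) \notin w]%N.

Lemma agree_consts w st st' : keeps_consts w -> agree_off w st st' ->
  consts st -> consts st'.
Proof.
move=> /and4P[k1 k2 k4 kz] ag [c1 c2 c4 cz].
by split; rewrite ?(agree_ivar ag) ?(agree_rvar ag).
Qed.

(** [f] is the number of full blocks. With the last, incomplete one there are [f.+1] flushes, each
    of which misjudges a down-closed set by at most 3. *)
Lemma runs_round (M B : nat) (X0 : nat -> R) st : consts st ->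
  ivar st iL = M -> ivar st iB = B -> (0 < B)%N -> rarr st 2 = X0 ->
  runs round_prog st (M * (40 * B + 40) + 20 * B + 20) (fun st' =>
    exists f M', [/\ ivar st' iL = M', ivar st' iB = (2 * B)%N,
       ivar st' iB1 = (2 * B).+1, (f * B <= M)%N &
       forall D, downclosed D ->
        (4 * count D (arr (rarr st' 2) M') <= count D (arr X0 M) <=
         4 * count D (arr (rarr st' 2) M') + 3 * f.+1)%N]).
Proof.
move=> cc hL hB B0 hX.
pose Inv r st1 := [/\ ivar st1 iC = r, consts st1,
   ivar st1 iB = B, (ivar st1 iS + r)%N = M &
   [/\ (forall i, (ivar st1 iS <= i)%N -> rarr st1 2 i = X0 i),
       (4 * ivar st1 iD + ivar st1 iK <= ivar st1 iS)%N,
       sorted <=%R (buffer st1), (ivar st1 iK < B)%N &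
   exists f, (f * B + ivar st1 iK)%N = ivar st1 iS /\
    forall D, downclosed D ->
    (4 * count D (arr (rarr st1 2) (ivar st1 iD)) + count D (buffer st1)
      <= count D (arr X0 (ivar st1 iS)) <=
     4 * count D (arr (rarr st1 2) (ivar st1 iD)) + count D (buffer st1) + 3 * f)%N]].
have -> : (M * (40 * B + 40) + 20 * B + 20 =
  5 + ((M * (40 * B + 38).+2).+1 + ((20 * B + 10) + 4)))%N by lia.
apply: (runs_block_seq (l := [:: _; _; _; _])) => /=.
apply: (@runs_seq _ _ _ _ _ _ (Inv 0%N)).
  apply: (@runs_loop _ _ _ Inv).
  - by move=> ? ? [? []].
  - move=> r st1 [h1 h2 h3 h4 [h5 h6 h7 h8 [f [h9 h10]]]].
    have -> : (40 * B + 38 = 3 + (20 * B + (20 * B + 34).+1))%N by lia.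
    apply: (runs_block_seq (l := [:: _; _])) => /=.
    set st2 := set_ivar _ _ _.
    have c2 : consts st2 by move: h2 => [? ? ? ?]; split.
    have e1 : ivar st1 i1 = 1%N by case: h2.
    set x := rarr st1 2 (ivar st1 iS).
    apply: (@runs_seq _ _ _ _ _ _ (fun st' =>
      [/\ ivar st' iK = (ivar st2 iK).+1,
        buffer st' = insl (rvar st2 rX) (buffer st2)
      & agree_off (writes insert_prog) st2 st'])).
      by apply: (runs_weaken (runs_insert c2)) => //=; lia.
    move=> st3 [k3 b3 ag].
    have c3 := agree_consts (w := writes insert_prog) isT ag c2.
    have eB : ivar st3 iB = B by rewrite (agree_ivar ag (x := iB) isT).
    have eS : ivar st3 iS = (ivar st1 iS).+1.
      by rewrite (agree_ivar ag (x := iS) isT) /= e1 addn1.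
    have eD : ivar st3 iD = ivar st1 iD by rewrite (agree_ivar ag (x := iD) isT).
    have eC : ivar st3 iC = r by rewrite (agree_ivar ag (x := iC) isT).
    have eX : rarr st3 2 = rarr st1 2 by rewrite (agree_rarr ag (a := 2) isT).
    have eK : ivar st3 iK = (ivar st1 iK).+1 by rewrite k3.
    have e_buf : buffer st3 = insl x (buffer st1) by rewrite b3.
    have sb : sorted <=%R (buffer st3) by rewrite e_buf sorted_insl.
    have cnt D : downclosed D ->
      (4 * count D (arr (rarr st3 2) (ivar st3 iD)) + count D (buffer st3)
        <= count D (arr X0 (ivar st3 iS)) <=
       4 * count D (arr (rarr st3 2) (ivar st3 iD)) + count D (buffer st3) + 3 * f)%N.
      move=> dD; have := h10 D dD.
      rewrite eX eD eS arrS -cats1 count_cat -(h5 _ (leqnn _)) -/x.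
      have -> : count D (buffer st3) = (D x + count D (buffer st1))%N.
        by rewrite e_buf (permP (perm_insl _ _)).
      rewrite /= addn0; lia.
    apply: runs_if => /= hif.
      have hD3 : (ivar st3 iD + ivar st3 iK <= ivar st3 iS)%N by lia.
      apply: (runs_weaken (runs_flush c3 hD3)); first by lia.
      move=> st4 [k4 x4 a4 d4 ag4].
      split.
      + by rewrite (agree_ivar ag4 (x := iC) isT).
      + exact: agree_consts ag4 c3.
      + by rewrite (agree_ivar ag4 (x := iB) isT).
      + by rewrite (agree_ivar ag4 (x := iS) isT); lia.
      have eS4 : ivar st4 iS = ivar st3 iS by rewrite (agree_ivar ag4 (x := iS) isT).
      have b4 : buffer st4 = [::] by rewrite /buffer k4 arr0.
      have sz : size (buffer st3) = ivar st3 iK by rewrite /buffer size_arr.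
      have := size_thin4 (buffer st3).
      rewrite sz => sz4.
      split => //.
      + by move=> i; rewrite eS4 => iS'; rewrite a4 // eX h5 //; lia.
      + by rewrite k4 d4 eS4; lia.
      + by rewrite b4.
      + by rewrite k4.
      exists f.+1; rewrite k4 eS4; split; first by lia.
      move=> D dD; have := cnt D dD; have := thin4_count dD sb.
      rewrite x4 b4 count_cat /=; lia.
    apply: (@runs_weaken _ _ _ 1%N); [|lia|by move=> ?; apply].
    apply: (runs_block (l := [::])) => /=.
    split => //; first by lia.
    split => //.
    + by move=> i; rewrite eS eX => iS'; apply: h5; lia.
    + by lia.
    + by lia.
    + by exists f; split; [lia|].
  - move: cc => [? ? ? ?]. rewrite /Inv /buffer /= hL hX arr0 addn0.
    split => //; split => //; exists 0%N; split => // D dD.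
    by rewrite !arr0.
move=> st1 [h1 h2 h3 h4 [h5 h6 h7 h8 [f [h9 h10]]]].
have hD1 : (ivar st1 iD + ivar st1 iK <= ivar st1 iS)%N by lia.
apply: (@runs_seq _ _ _ _ _ _ _ _ (runs_weaken (runs_flush h2 hD1) _ (fun _ => id))).
  by lia.
move=> st4 [k4 x4 a4 d4 ag4].
have c4 := agree_consts (w := writes flush_prog) isT ag4 h2.
apply: (runs_block (l := [:: _; _; _])) => /=.
have e1 : ivar st4 i1 = 1%N by case: c4.
have eB : ivar st4 iB = B by rewrite (agree_ivar ag4 (x := iB) isT).
exists f, (ivar st4 iD); rewrite k4 eB e1; split => //; rewrite ?addn0 ?mul2n ?addnn ?addn1 //.
  by lia.
move=> D dD; have := h10 D dD; have := thin4_count dD h7.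
have -> : ivar st1 iS = M by lia.
rewrite x4 count_cat; lia.
Qed.

Lemma runs_sort (M : nat) (X0 : nat -> R) st : consts st ->
  ivar st iL = M -> rarr st 2 = X0 ->
  runs sort_prog st (M * (20 * M + 10) + 10) (fun st' =>
    [/\ consts st', ivar st' iK = M, sorted <=%R (buffer st') &
        perm_eq (buffer st') (arr X0 M)]).
Proof.
move=> cc hL hX.
pose Inv r st1 := [/\ ivar st1 iC = r, consts st1, (ivar st1 iS + r)%N = M,
   rarr st1 2 = X0 & [/\ ivar st1 iK = ivar st1 iS,
     sorted <=%R (buffer st1) & perm_eq (buffer st1) (arr X0 (ivar st1 iS))]].
apply: (@runs_weaken _ _ _ (4 + (M * (20 * M + 3).+2).+1) _ (Inv 0%N));
  [|lia|move=> st' [_ h2 h3 _ [h5 h6 h7]]]; last first.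
  by move: h3; rewrite addn0 => <-.
apply: (runs_block_seq (l := [:: _; _; _])) => /=.
apply: (@runs_loop _ _ _ Inv).
- by move=> ? ? [? []].
- move=> r st1 [h1 h2 h3 h4 [h5 h6 h7]].
  rewrite addnC; apply: (runs_block_seq (l := [:: _; _])) => /=.
  set st2 := set_ivar _ _ _.
  have c2 : consts st2 by move: h2 => [? ? ? ?]; split.
  have e1 : ivar st1 i1 = 1%N by case: h2.
  apply: (runs_weaken (runs_insert c2)) => /=; first by lia.
  move=> st3 [k3 b3 ag].
  have c3 := agree_consts (w := writes insert_prog) isT ag c2.
  have eS : ivar st3 iS = (ivar st1 iS).+1.
    by rewrite (agree_ivar ag (x := iS) isT) /= e1 addn1.
  split => //.
  + by rewrite (agree_ivar ag (x := iC) isT).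
  + by rewrite eS; lia.
  + by rewrite (agree_rarr ag (a := 2) isT).
  split; first by rewrite k3 eS h5.
    by rewrite b3 sorted_insl.
  rewrite b3 eS arrS (permPl (perm_insl _ _)) perm_sym perm_rcons /= h4.
  by rewrite perm_cons perm_sym; exact: h7.
- by move: cc => [? ? ? ?]; rewrite /Inv /buffer /= hL hX !arr0 addn0.
Qed.

Lemma runs_middle (K : nat) st : consts st -> ivar st iK = K -> (0 < K)%N ->
  runs middle_prog st (5 * K + 20) (fun st' =>
    rvar st' rV = nth 0 (buffer st) K./2).
Proof.
move=> [c1 c2 c4 cz] hK K0.
have ltK : (K./2 < K)%N by rewrite -divn2 ltn_Pdiv.
have loopP r st1 : [/\ ivar st1 iC2 = r, ivar st1 i2 = 2%N, ivar st1 i1 = 1%N,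
      rarr st1 3 = rarr st 3 & (ivar st1 iJ + r./2)%N = K./2] ->
   runs (While (ILe i2 iC2) (block [:: ISub iC2 iC2 i2; IAdd iJ iJ i1])) st1
     (5 * r).+1 (fun st' => rarr st' 3 = rarr st 3 /\ ivar st' iJ = K./2).
  have [m] := ubnP r; elim: m r st1 => // m IH r st1 rm [h1 h2 h3 h4 h5].
  have [r2|r2] := leqP 2 r; last first.
    apply: (@runs_weaken _ _ _ 1%N); [|lia|by move=> ?; apply].
    apply: runs_while_end => /=; first by rewrite h1 h2; lia.
    by split=> //; lia.
  have -> : ((5 * r).+1 = (3 + (5 * r - 3)).+1)%N by lia.
  apply: (runs_while_block (l := [:: _; _])); first by rewrite /= h1 h2.
  apply: (@runs_weaken _ _ _ (5 * (r - 2)).+1); [apply: IH|lia|by move=> ?; apply].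
    by lia.
  by rewrite /= h1 h2 h3; split => //; lia.
have -> : (5 * K + 20 = 3 + ((5 * K).+1 + 16))%N by lia.
apply: (runs_block_seq (l := [:: _; _])) => /=.
apply: (runs_seq (loopP _ _ _)); first by split=> //=; rewrite ?hK ?addn0.
move=> st1 [h1 h2]; apply: (@runs_weaken _ _ _ 2%N); [|lia|by move=> ?; apply].
apply: (runs_block (l := [:: _])) => /=.
by rewrite h1 h2 /buffer hK arrE nth_mkseq //; lia.
Qed.

(** Both fractions leave room for the error [12 / 128] of the thinning. Two fifths exceed [1 / kap]
    for [kap >= 3], so a square of approximate median radius is a first inner rectangle; the
    complementary [3 / 5] and the [2 / 3] stay below [1 - 1 / kap], so a rectangle with more nodes
    than that cannot lie on one side of the value. *)
Definition approx_median (s : seq R) (v : R) : Prop :=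
  (2 * size s <= 5 * count (fun x => (x <= v)%R) s)%N /\
  (3 * count (fun x => (x < v)%R) s <= 2 * size s)%N.

Lemma count_le_nth (s : seq R) h : sorted <=%R s -> (h < size s)%N ->
  (h < count (fun x => (x <= nth 0 s h)%R) s)%N.
Proof.
move=> ss hs; rewrite -{2}(cat_take_drop h.+1 s) count_cat.
apply: leq_trans (leq_addr _ _).
suff /eqP -> : count (fun x => (x <= nth 0 s h)%R) (take h.+1 s) == size (take h.+1 s).
  by rewrite size_takel.
rewrite -all_count; apply/(all_nthP 0) => i; rewrite size_takel // => ih.
rewrite nth_take //; apply: le_sorted_leq_nth => //; rewrite ?inE; first exact: leq_trans hs.

Qed.

Lemma count_lt_nth (s : seq R) h : sorted <=%R s -> (h < size s)%N ->
  (count (fun x => (x < nth 0 s h)%R) s <= h)%N.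
Proof.
move=> ss hs; rewrite -{2}(cat_take_drop h s) count_cat.
have -> : count (fun x => (x < nth 0 s h)%R) (drop h s) = 0%N.
  apply/eqP; rewrite eqn0Ngt -has_count; apply/hasPn => x /(nthP 0)[i].
  rewrite size_drop nth_drop => ih <-; rewrite -leNgt.
  apply: le_sorted_leq_nth; rewrite ?inE //; last exact: leq_addr.
  by rewrite -ltn_subRL.
by rewrite addn0 (leq_trans (count_size _ _)) // size_take hs.
Qed.

(** Each survivor stands for [W] elements. The inequality on [Err] is
    [Err <= 12 * n / 128 * (1 - 128 / B)] cleared of denominators: a round adds at most [6 * n / B]
    and [B] doubles, and this is the partial sum of the geometric series. *)
Definition thinned (A : seq R) (n M B : nat) st : Prop :=
  [/\ consts st, ivar st iL = M, ivar st iB = B, ivar st iB1 = B.+1 &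
   exists W Err,
   [/\ (0 < M)%N, (W * M <= n)%N, (128 <= B)%N, (M * B <= 128 * n)%N &
     (B * 128 * Err + 1536 * n <= 12 * n * B)%N /\
     forall D, downclosed D ->
       (W * count D (arr (rarr st 2) M) <= count D A <=
        W * count D (arr (rarr st 2) M) + Err)%N]].

Lemma thinned_round A n M B st : thinned A n M B st -> (B < M)%N ->
  runs round_prog st (42 * (M * B)) (fun st' =>
    exists M', (4 * M' <= M)%N /\ thinned A n M' (2 * B) st').
Proof.
move=> [cc hL hB hB1 [W [Err [M0 WM B0 MB [hErr hD]]]]] BM.
have B1 : (0 < B)%N by lia.
have := runs_agree (runs_round cc hL hB B1 erefl).
move/runs_weaken; apply; first by nia.
move=> st' [[f [M' [l1 l2 l3 l4 l5]]] ag].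
have dT : downclosed (predT : pred R) by [].
have := l5 _ dT; rewrite !count_predT !size_arr => lT.
have f128 : (f * 128 <= f * B)%N by rewrite leq_mul2l B0 orbT.
exists M'; split; first by lia.
split => //; first exact: (agree_consts (w := writes round_prog)) ag cc.
exists (4 * W)%N, (Err + W * (3 * f.+1))%N; split.
- by lia.
- by nia.
- by lia.
- by nia.
split.
  (* Since [f * B <= M] and [B < M], the number of flushes is at most [2 * M / B]; and
     [W * M <= n]. *)
  have WB : (W * B * f.+1 <= 2 * n)%N by nia.
  nia.
move=> D dD; have := hD D dD; have := l5 D dD; nia.
Qed.

(** A round costs O(M * B); [M] falls to a quarter and [B] doubles, so this product at least halves
    and the costs form a geometric series. *)
Lemma runs_rounds A n M B st : thinned A n M B st ->
  runs (While (ILe iB1 iL) round_prog) st (90 * (M * B) + 1) (fun st' =>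
    exists M' B', [/\ thinned A n M' B' st' & (M' <= B')%N]).
Proof.
have [m] := ubnP M; elim: m M B st => // m IH M B st Mm th.
have [cc hL hB hB1 [W [Err [M0 _ B0 _ _]]]] := th.
have [MB|BM] := leqP M B.
  apply: (@runs_weaken _ _ _ 1%N); [|lia|by move=> ?; apply].
  apply: runs_while_end; first by rewrite /= hL hB1; lia.
  by exists M, B.
apply: (@runs_weaken _ _ _ (42 * (M * B) + (45 * (M * B) + 1)).+1);
  [|nia|by move=> ?; apply].
apply: (runs_while_step _ (thinned_round th BM)); first by rewrite /= hL hB1; lia.
move=> st' [M' [M'M th']].
apply: (@runs_weaken _ _ _ (90 * (M' * (2 * B)) + 1)); [|nia|by move=> ?; apply].
by apply: IH th'; lia.
Qed.

(** At the end [M <= B] and [M * B <= 128 * n], so even a quadratic sort of the [M] survivors is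
    linear in [n]. *)
Lemma runs_median (n : nat) st : consts st -> ivar st iL = n -> (0 < n)%N ->
  runs median_prog st (125 * (128 * n)) (fun st' =>
    approx_median (arr (rarr st 2) n) (rvar st' rV)).
Proof.
move=> cc hL n0; set A := arr (rarr st 2) n.
have th : thinned A n n 128
    (set_ivar (set_ivar st iB 128) iB1 (128 + ivar st i1)%N).
  move: cc => [c1 c2 c4 cz]; split => //=; first by rewrite c1.
  exists 1%N, 0%N; split => //; rewrite ?mul1n //; first by lia.
  split; first by lia.
  by move=> D dD; rewrite mul1n addn0 /= leqnn.
apply: (@runs_weaken _ _ _ (3 + (90 * (n * 128) + 1 + (30 * (128 * n) + 30))));
  [|lia|by move=> ?; apply].
apply: (runs_block_seq (l := [:: _; _])).
apply: (runs_seq (runs_rounds th)).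
move=> st1 [M [B [[c1 hM _ _ [W [Err [M0 WM B0 MB [hErr hD]]]]] leMB]]].
apply: (@runs_weaken _ _ _ (M * (20 * M + 10) + 10 + (5 * M + 20)));
  [|nia|by move=> ?; apply].
apply: (runs_seq (runs_sort c1 hM erefl)) => st2 [c2 hK hs hp].
apply: (runs_weaken (runs_middle c2 hK M0)) => // st3 ->.
have szb : size (buffer st2) = M by rewrite (perm_size hp) size_arr.
have hM2 : (M./2 < size (buffer st2))%N by lia.
set v := nth 0 _ _.
have := count_le_nth hs hM2; have := count_lt_nth hs hM2.
rewrite -/v !(permP hp).
have d1 : downclosed (fun x => x <= v) by move=> x y xy; exact: le_trans.
have d2 : downclosed (fun x => x < v) by move=> x y xy; exact: le_lt_trans.
have dT : downclosed (predT : pred R) by [].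
have := hD _ dT; rewrite !count_predT !size_arr => lT l1 l2.
have := hD _ d1; have := hD _ d2.
rewrite /approx_median /A size_arr -/A.
have hE : (128 * Err <= 12 * n)%N.
  have BB : (0 < B)%N by lia.
  rewrite -(leq_pmul2l BB); lia.
move: l1 l2; set a := count _ _; set b := count _ _; set a' := count _ A; set b' := count _ A.
nia.
Qed.

End Median.

(** * Rectangles and clipped lengths *)

Section Clipping.
Context {R : realType}.
Implicit Types (p q u v : R * R) (a b r t mu A B : R).

(** Together with nonnegativity, this is all that is used of Lebesgue measure: one interval of
    parameters inside the ball bounds the clipped length from below. *)
Lemma clipped_length_ge p q x r a b : 0 <= a -> a <= b -> b <= 1 ->
  (forall t, a <= t <= b -> edist x (segpt p q t) <= r) ->
  edist p q * (b - a) <= clipped_length p q x r.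
Proof.
move=> a0 ab b1 h; rewrite /clipped_length ler_wpM2l ?sqrtr_ge0 //.
set S := (X in lebesgue_measure X).
have mS : measurable S.
  have -> : S = (`[0%R, 1%R] `&` [set t | edist x (segpt p q t) <= r])%classic.
    by apply/seteqP; split => t /=; rewrite in_itv.
  apply: measurable_fun_le => //.
  apply: (@measurableT_comp _ _ _ _ _ _ (@Num.sqrt R)).
    by apply: continuous_measurable_fun; exact: sqrt_continuous.
  rewrite /segpt /=; apply: measurable_funD; apply: measurable_funX;
    apply: measurable_funB => //; apply: measurable_funD => //;
    exact: measurable_funM.
have lS : (lebesgue_measure S <= 1%:E)%E.
  apply: (@le_trans _ _ (lebesgue_measure `[0%R, 1%R]%classic)).
    by apply: le_measure; rewrite ?inE // => t [/= /andP[t0 t1] _];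
      rewrite in_itv /= t0 t1.
  by rewrite lebesgue_measure_itv /= lte_fin ltr01 sube0.
(* [fine] sends infinity to 0, so finiteness must come before the comparison. *)
have fS : lebesgue_measure S \is a fin_num.
  by rewrite ge0_fin_numE // (le_lt_trans lS) ?ltry.
rewrite -lee_fin fineK //.
apply: (@le_trans _ _ (lebesgue_measure `[a, b]%classic)).
  rewrite lebesgue_measure_itv /= lte_fin; case: ltP => // ba.
  by rewrite lee_fin subr_le0.
apply: le_measure; rewrite ?inE // => t /=; rewrite in_itv /= => /andP[at1 tb].
split; last by apply: h; rewrite at1 tb.
by rewrite (le_trans a0 at1) (le_trans tb b1).
Qed.

Lemma clipped_length_ge0 p q x r : 0 <= clipped_length p q x r.
Proof. by rewrite mulr_ge0 ?sqrtr_ge0 // fine_ge0. Qed.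

(** The scale of the rectangle around [q], of half-sides proportional to [A] and [B], that has [v]
    on its boundary. *)
Definition gauge A B q v : R :=
  Num.max (`|v.1 - q.1| / A) (`|v.2 - q.2| / B).

Lemma gauge_le A B q v t : 0 < A -> 0 < B ->
  (gauge A B q v <= t) = (`|v.1 - q.1| <= t * A) && (`|v.2 - q.2| <= t * B).
Proof. by move=> A0 B0; rewrite /gauge ge_max !ler_pdivrMr. Qed.

Lemma gauge_ge0 A B q v : 0 < A -> 0 < B -> 0 <= gauge A B q v.
Proof. by move=> A0 B0; rewrite le_max divr_ge0 // ltW. Qed.

Lemma dist1_le_edist u v : `|u.1 - v.1| <= edist u v.
Proof. by rewrite -sqrtr_sqr ler_sqrt ?addr_ge0 ?sqr_ge0 // lerDl sqr_ge0. Qed.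

Lemma dist2_le_edist u v : `|u.2 - v.2| <= edist u v.
Proof. by rewrite -sqrtr_sqr ler_sqrt ?addr_ge0 ?sqr_ge0 // lerDr sqr_ge0. Qed.

Lemma gauge_lip A B mu q u v : 0 < mu -> mu <= A -> mu <= B ->
  gauge A B q v <= gauge A B q u + edist u v / mu.
Proof.
move=> mu0 muA muB.
have A0 : 0 < A by lra.
have B0 : 0 < B by lra.
have e0 : 0 <= edist u v / mu by rewrite divr_ge0 ?sqrtr_ge0 // ltW.
have hh (C d1 d2 : R) : mu <= C -> `|d1| / C <= gauge A B q u -> `|d2 - d1| <= edist u v ->
    `|d2| / C <= gauge A B q u + edist u v / mu.
  move=> muC h1 h2; have C0 : 0 < C by lra.
  have : `|d2| / C <= `|d1| / C + `|d2 - d1| / C.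
    rewrite -mulrDl ler_pM2r ?invr_gt0 //.
    by have := ler_normD d1 (d2 - d1); rewrite addrC subrK addrC.
  move/le_trans; apply; apply: lerD => //.
  apply: (@le_trans _ _ (edist u v / C)); first by rewrite ler_pM2r ?invr_gt0.
  by rewrite ler_wpM2l ?sqrtr_ge0 // lef_pV2.
rewrite {1}/gauge ge_max; apply/andP; split.
  apply: (hh A (u.1 - q.1)(v.1 - q.1)) => //; first by rewrite /gauge le_max lexx.
  have -> : v.1 - q.1 - (u.1 - q.1) = - (u.1 - v.1) by ring.
  by rewrite normrN dist1_le_edist.
apply: (hh B (u.2 - q.2) (v.2 - q.2)) => //; first by rewrite /gauge le_max lexx orbT.
have -> : v.2 - q.2 - (u.2 - q.2) = - (u.2 - v.2) by ring.
by rewrite normrN dist2_le_edist.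
Qed.

Lemma gauge_edist A B q v t : 0 < A -> 0 < B ->
  gauge A B q v <= t -> edist q v <= t * Num.sqrt (A ^+ 2 + B ^+ 2).
Proof.
move=> A0 B0 h.
have t0 : 0 <= t by apply: le_trans h; exact: gauge_ge0.
move: h; rewrite gauge_le // => /andP[h1 h2].
rewrite -[t]ger0_norm // -sqrtr_sqr -sqrtrM ?sqr_ge0 //.
rewrite ler_sqrt ?mulr_ge0 ?addr_ge0 ?sqr_ge0 //.
rewrite mulrDr -!exprMn.
have hs (d e : R) : `|d| <= e -> (- d) ^+ 2 <= e ^+ 2.
  move=> de; rewrite sqrrN -[d ^+ 2]real_normK ?num_real //.
  by apply: lerXn2r => //; rewrite nnegrE // (le_trans _ de).
by apply: lerD; rewrite -opprB hs.
Qed.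

Lemma edist_segpt_l u v t : 0 <= t -> edist u (segpt u v t) = t * edist u v.
Proof.
move=> t0; have tE : t = Num.sqrt (t ^+ 2) by rewrite sqrtr_sqr ger0_norm.
by rewrite [in RHS]tE -sqrtrM ?sqr_ge0 // /edist /segpt /=; congr Num.sqrt; ring.
Qed.

Lemma edist_segpt_r u v t : t <= 1 -> edist v (segpt u v t) = (1 - t) * edist u v.
Proof.
move=> t1; have tE : 1 - t = Num.sqrt ((1 - t) ^+ 2).
  by rewrite sqrtr_sqr ger0_norm // subr_ge0.
by rewrite tE -sqrtrM ?sqr_ge0 // /edist /segpt /=; congr Num.sqrt; ring.
Qed.

(** The length of the part of [[t0, t1]] that lies between [a] and [b]; divided by [t1 - t0], it is
    the probability that a uniform level separates [a] from [b]. *)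
Definition overlap t0 t1 a b : R :=
  Num.max 0 (Num.min (Num.max a b) t1 - Num.max (Num.min a b) t0).

Lemma overlapC t0 t1 a b : overlap t0 t1 a b = overlap t0 t1 b a.
Proof. by rewrite /overlap [Num.max b a]maxC [Num.min b a]minC. Qed.

Lemma overlap_ge0 t0 t1 a b : 0 <= overlap t0 t1 a b.
Proof. by rewrite /overlap le_max lexx. Qed.

(* Along a segment the gauge is Lipschitz with constant [1 / mu]; the part of
   the segment on which it climbs from its smaller end value up to [t1] lies in
   the ball. *)
Lemma overlap_clipped A B mu q u v t0 t1 : 0 < mu -> mu <= A -> mu <= B ->
  mu * overlap t0 t1 (gauge A B q u) (gauge A B q v) <=
  clipped_length u v q (t1 * Num.sqrt (A ^+ 2 + B ^+ 2)).
Proof.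
move=> mu0 muA muB.
have A0 : 0 < A by lra.
have B0 : 0 < B by lra.
set a := gauge A B q u; set b := gauge A B q v.
have lip1 := gauge_lip q u v mu0 muA muB; rewrite -/a -/b in lip1.
have lip2 := gauge_lip q v u mu0 muA muB; rewrite -/a -/b in lip2.
have eC : edist v u = edist u v.
  by rewrite /edist; congr Num.sqrt; ring.
rewrite eC in lip2.
set L := edist u v / mu in lip1 lip2.
have LE : edist u v = mu * L by rewrite /L mulrC divfK ?gt_eqF.
pose h := Num.min (Num.max a b) t1 - Num.min a b.
have [h0|h0] := leP h 0.
  rewrite /overlap max_l ?mulr0 ?clipped_length_ge0 //.
  apply: le_trans h0; rewrite lerB // le_max lexx //.
have ovh : overlap t0 t1 a b <= h.
  by rewrite /overlap ge_max ltW //= lerB // le_max lexx.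
have hab : h <= Num.max a b - Num.min a b by rewrite lerB // ge_min lexx.
have ht1 : Num.min a b + h <= t1.
  by rewrite /h addrC subrK ge_min lexx orbT.
apply: (@le_trans _ _ (mu * h)); first by rewrite ler_pM2l.
have hL : h <= L.
  apply: le_trans hab _; case: (leP a b) => ab; lra.
have L0 : 0 < L by lra.
have th : 0 < h / L by rewrite divr_gt0.
have th1 : h / L <= 1 by rewrite ler_pdivrMr // mul1r.
have -> : mu * h = edist u v * (h / L).
  by rewrite LE -mulrA; congr (_ * _); rewrite mulrC divfK ?gt_eqF.
have [ab|ba] := leP a b.
  have mE : Num.min a b = a by rewrite min_l.
  rewrite -[h / L]subr0; apply: clipped_length_ge => //; first exact: ltW.
  move=> t /andP[t0' tth]; apply: gauge_edist => //.
  apply: le_trans (gauge_lip q u _ mu0 muA muB) _.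
  rewrite edist_segpt_l // -/a -mulrA -/L.
  have : t * L <= h by rewrite -ler_pdivlMr.
  by rewrite mE in ht1; lra.
have mE : Num.min a b = b by rewrite min_r // ltW.
have -> : h / L = 1 - (1 - h / L) by ring.
apply: clipped_length_ge => //; try lra.
move=> t /andP[tth t1']; apply: gauge_edist => //.
apply: le_trans (gauge_lip q v _ mu0 muA muB) _.
rewrite edist_segpt_r // -/b -mulrA -/L.
have : (1 - t) * L <= h by rewrite -ler_pdivlMr //; lra.
by rewrite mE in ht1; lra.
Qed.

End Clipping.

(** * Packed graphs and separators *)

Section Edges.
Context {R : realType} {n : nat}.
Implicit Types (G : geomGraph R n) (s : seq ('I_n * 'I_n)).

(** Listed edges have arbitrary orientations, whereas the sum in [packed] runs over [i < j]; [ori]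
    is a bijection between the two index sets. *)
Lemma edge_listing_sum G s (f : 'I_n -> 'I_n -> R) : edge_listing G s ->
  (forall u v, f u v = f v u) ->
  \sum_(e <- s) f e.1 e.2 = \sum_(i < n) \sum_(j < n | (i < j)%N && adj G i j) f i j.
Proof.
move=> [us sym ad] fC.
pose ori (e : 'I_n * 'I_n) := if (e.1 < e.2)%N then e else (e.2, e.1).
have -> : \sum_(e <- s) f e.1 e.2 = \sum_(e <- map ori s) f e.1 e.2.
  by rewrite big_map; apply: eq_bigr => e _; rewrite /ori; case: ifP => //= _.
have irr e : e \in s -> e.1 != e.2.
  case: e => u v /= es; apply/eqP => uv; subst v.
  by have := ad u u; rewrite adj_irr es.
have uo : uniq (map ori s).
  rewrite map_inj_in_uniq // => -[u v] [u' v'] es es'; rewrite /ori /=.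
  case: ifP => h; case: ifP => h' // [? ?]; subst => //.
    by have := sym _ _ es; rewrite es'.
  by have := sym _ _ es; rewrite es'.
rewrite big_uniq //= pair_big_dep /=; apply: eq_bigl => -[i j] /=.
apply/mapP/andP => [[[u v] es]|[ij]].
  have := irr _ es; rewrite /ori /= => uv; case: ifP => h [-> ->]; rewrite ?h.
    by rewrite ad es.
  split; last by rewrite ad es orbT.
  by rewrite ltn_neqAle eq_sym; move: uv; rewrite -(inj_eq val_inj) /= => ->; lia.
rewrite ad => /orP[es|es]; [exists (i, j)|exists (j, i)] => //; rewrite /ori /= ?ij //.
by case: ifP => //; lia.
Qed.

(** The rectangle of scale [t1] lies in a disc of radius [t1 * sqrt (A ^ 2 + B ^ 2)], and inside it
    an edge spends at least [mu] of its length per unit of level. *)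
Lemma packed_overlap c G s A B mu q t0 t1 : packed c G -> edge_listing G s ->
  0 < mu -> mu <= A -> mu <= B -> 0 < t1 ->
  mu * (\sum_(e <- s) overlap t0 t1 (gauge A B q (pos G e.1)) (gauge A B q (pos G e.2)))
  <= c * (t1 * Num.sqrt (A ^+ 2 + B ^+ 2)).
Proof.
move=> pk el mu0 muA muB t10.
pose f u v := overlap t0 t1 (gauge A B q (pos G u)) (gauge A B q (pos G v)).
rewrite (edge_listing_sum (f := f) el) => [|u v]; last exact: overlapC.
have r0 : 0 < t1 * Num.sqrt (A ^+ 2 + B ^+ 2).
  by rewrite mulr_gt0 // sqrtr_gt0 ltr_pwDl ?sqr_ge0 // exprn_gt0 //; lra.
apply: le_trans (pk q _ r0); rewrite mulr_sumr; apply: ler_sum => i _.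
by rewrite mulr_sumr; apply: ler_sum => j _; exact: overlap_clipped.
Qed.

(** In a square of half-side [t] around [v] that has no other node in its interior, every edge at
    [v] has length at least [t], while packedness allows [c * t * sqrt 2] in total. *)
Lemma packed_degree c G s v : packed c G -> edge_listing G s ->
  (\sum_(e <- s) ((v == e.1) + (v == e.2)))%:R <= c * Num.sqrt 2.
Proof.
move=> pk el; have [_ _ ad] := el.
pose g := gauge 1 1 (pos G v).
have gv : g (pos G v) = 0 by rewrite /g /gauge !subrr normr0 mul0r maxxx.
have gpos w : w != v -> 0 < g (pos G w).
  move=> wv; rewrite lt_neqAle gauge_ge0 // andbT; apply/eqP => g0.
  have : g (pos G w) <= 0 by rewrite -g0.
  rewrite /g gauge_le // !mul0r !normr_le0 !subr_eq0 => /andP[/eqP e1 /eqP e2].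
  move/eqP: wv; apply; apply: (@pos_inj _ _ G).
  by rewrite [LHS]surjective_pairing [RHS]surjective_pairing e1 e2.
(* The default 1 keeps [t] positive when [v] is the only node. *)
pose t := \big[Num.min/1]_(w | w != v) g (pos G w).
have t0 : 0 < t by apply/bigmin_gtP; split => // w wv; exact: gpos.
have tle w : w != v -> t <= g (pos G w) by move=> wv; exact: bigmin_le_cond.
have := packed_overlap (pos G v) 0 pk el ltr01 (lexx 1) (lexx 1) t0.
rewrite mul1r expr1n (_ : 1 + 1 = 2) // => h.
have : t * (\sum_(e <- s) ((v == e.1) + (v == e.2)))%:R <= t * (c * Num.sqrt 2).
  rewrite mulrCA; apply: le_trans h; rewrite natr_sum mulr_sumr big_seq [leRHS]big_seq.
  apply: ler_sum => -[u w] /= es.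
  have uw : u != w.
    by apply/eqP => E; subst w; have := ad u u; rewrite adj_irr es.
  have ov w' : w' != v -> t <= overlap 0 t 0 (g (pos G w')).
    move=> wv; have := tle _ wv; have := gpos _ wv => g0 tg.
    rewrite /overlap [Num.max 0 (g _)]max_r ?(ltW g0) // [Num.min 0 (g _)]min_l ?(ltW g0) //.
    by rewrite maxxx subr0 min_r // le_max lexx orbT.
  rewrite -/g; have [vu|vu] := eqVneq v u; have [vw|vw] := eqVneq v w.
  - by move: uw; rewrite -vu -vw eqxx.
  - by rewrite -vu gv mulr1; apply: ov; rewrite eq_sym.
  - by rewrite -vw gv mulr1 overlapC; apply: ov; rewrite eq_sym.
  - by rewrite mulr0 overlap_ge0.
by rewrite ler_pM2l.
Qed.

Lemma packed_size c G s : packed c G -> edge_listing G s -> 0 <= c ->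
  (size s)%:R <= c * n%:R.
Proof.
move=> pk el c0.
have : (\sum_(v : 'I_n) \sum_(e <- s) ((v == e.1) + (v == e.2)))%:R <= \sum_(v : 'I_n) c * Num.sqrt 2.
  by rewrite natr_sum; apply: ler_sum => v _; exact: (packed_degree v pk el).
rewrite exchange_big /=.
have -> : (\sum_(e <- s) \sum_(v : 'I_n) ((v == e.1) + (v == e.2)) = size s * 2)%N.
  under eq_bigr => e _.
    rewrite (_ : \sum_(v : 'I_n) _ = 2)%N; first over.
    rewrite big_split /= (bigD1 e.1) //= eqxx big1 => [|i /negbTE -> //].
    by rewrite (bigD1 e.2) //= eqxx big1 // => i /negbTE ->.
  by rewrite big_const_seq count_predT iter_addn addn0 mulnC.
rewrite sumr_const card_ord -mulr_natr natrM => h.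
have s2 : Num.sqrt 2 <= 2 :> R.
  rewrite -[leRHS]ger0_norm // -sqrtr_sqr ler_sqrt ?sqr_ge0 //.
  by rewrite expr2 ler_peMl // ler1n.
have : c * Num.sqrt 2 * n%:R <= c * n%:R * 2.
  by rewrite mulrAC ler_wpM2l // mulr_ge0.
lra.
Qed.

Definition crossing (I : pred 'I_n) (e : 'I_n * 'I_n) := I e.1 != I e.2.

Definition inner_ends (I : pred 'I_n) s : {set 'I_n} :=
  [set v | v \in [seq (if I e.1 then e.1 else e.2) | e <- s & crossing I e]].

Lemma card_inner_ends I s : (#|inner_ends I s| <= count (crossing I) s)%N.
Proof. by rewrite cardsE (leq_trans (card_size _)) // size_map size_filter. Qed.

(** An edge on which [I] changes has its inner end in the separator; so [I] is constant along paths
    that avoid the separator, and each component lies on one side. *)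
Lemma inner_ends_balanced (alpha : R) G s I : edge_listing G s ->
  #|[set v | I v]|%:R <= alpha * n%:R -> #|[set v | ~~ I v]|%:R <= alpha * n%:R ->
  balanced_separator alpha G (inner_ends I s).
Proof.
move=> [_ _ ad] h1 h2 v vS.
have conn w : connect (adj_avoiding G (inner_ends I s)) v w -> I w = I v.
  case/connectP => p; elim: p v vS => [|x p IH] y yS /=; first by move=> _ ->.
  move=> /andP[/and3P[_ xS yx] pp] wE; rewrite (IH x) //.
  apply/eqP/negPn/negP => Ixy.
  move: yx; rewrite ad => /orP[] es.
  - have : (if I y then y else x) \in inner_ends I s.
      rewrite inE; apply/mapP; exists (y, x) => //.
      by rewrite mem_filter es /crossing /= eq_sym Ixy.
    by case: ifP => _; apply/negP.
  - have : (if I x then x else y) \in inner_ends I s.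
      rewrite inE; apply/mapP; exists (x, y) => //.
      by rewrite mem_filter es /crossing /= Ixy.
    by case: ifP => _; apply/negP.
case Iv : (I v); [apply: le_trans h1|apply: le_trans h2];
  rewrite ler_nat; apply: subset_leq_card; apply/fintype.subsetP => w;
  by rewrite !inE => /conn ->; rewrite Iv.
Qed.

End Edges.

(** * Choosing a level crossed by few edges *)

Section Potential.
Context {R : realType}.
Implicit Types (lam lo hi : R) (e : R * R) (s : seq (R * R)).

Definition strictly_inside lo hi (x : R) := lo < x < hi.

Definition ends_inside lo hi e : nat :=
  strictly_inside lo hi e.1 + strictly_inside lo hi e.2.

Definition active lo hi e :=
  strictly_inside lo hi e.1 || strictly_inside lo hi e.2.

(* The conditional expectation, at a uniform level of [[lo, hi]], of the number
   of crossing edges, plus [lam] for every end value that is still inside.  The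
   second term pays for the bisection: the average of its values over the two
   halves is smaller by [lam / 2] times the number of these end values. *)
Definition potential lam lo hi e : R :=
  overlap lo hi e.1 e.2 / (hi - lo) + lam * (ends_inside lo hi e)%:R.

Lemma potential_ge0 lam lo hi e : 0 <= lam -> lo < hi -> 0 <= potential lam lo hi e.
Proof.
move=> l0 lh; rewrite addr_ge0 ?mulr_ge0 // ?invr_ge0 ?subr_ge0 ?(ltW lh) //.
exact: overlap_ge0.
Qed.

Lemma overlap_out lo hi (a b : R) :
  Num.max a b <= lo \/ hi <= Num.min a b -> overlap lo hi a b = 0.
Proof.
move=> h; rewrite /overlap max_l // subr_le0.
case: h => h.
  by rewrite (@le_trans _ _ (Num.max a b)) ?ge_min ?lexx // le_max h orbT.
by rewrite (@le_trans _ _ hi) ?ge_min ?lexx ?orbT // le_max h.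
Qed.

Lemma overlap_full lo hi (a b : R) : lo <= hi ->
  Num.min a b <= lo -> hi <= Num.max a b -> overlap lo hi a b = hi - lo.
Proof.
by move=> lh h1 h2; rewrite /overlap (min_r h2) (max_r h1) max_r // subr_ge0.
Qed.

Lemma overlap_halves lo hi mid (a b : R) : lo <= mid -> mid <= hi ->
  overlap lo mid a b + overlap mid hi a b = overlap lo hi a b.
Proof.
move=> h1 h2.
have [y1|y1] := leP (Num.max a b) mid.
  rewrite (@overlap_out mid) ?addr0; last by left.
  by rewrite /overlap (min_l y1) (min_l (le_trans y1 h2)).
have [x1|x1] := leP mid (Num.min a b).
  rewrite (@overlap_out lo mid) ?add0r; last by right.
  by rewrite /overlap (max_l x1) (max_l (le_trans h1 x1)).
rewrite /overlap (min_r (ltW y1)) (max_r (ltW x1)).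
rewrite [Num.max 0 (mid - _)]max_r; last by rewrite subr_ge0 ge_max (ltW x1).
rewrite [Num.max 0 (_ - mid)]max_r; last by rewrite subr_ge0 le_min (ltW y1).
rewrite [RHS]max_r; first by ring.
by rewrite subr_ge0 (@le_trans _ _ mid) // ?ge_max ?le_min ?(ltW x1) ?(ltW y1).
Qed.

Lemma ends_inside_halves lo hi mid e : lo <= mid -> mid <= hi ->
  (ends_inside lo mid e + ends_inside mid hi e <= ends_inside lo hi e)%N.
Proof.
move=> h1 h2; rewrite /ends_inside.
have h (x : R) : (strictly_inside lo mid x + strictly_inside mid hi x <=
    strictly_inside lo hi x)%N.
  rewrite /strictly_inside.
  case: (ltP lo x) => l; case: (ltP x mid) => l'; case: (ltP mid x) => l'';
    case: (ltP x hi) => l''' //=; lra.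
have := h e.1; have := h e.2; lia.
Qed.

(** The first terms average exactly, the halves having equal length. An end value strictly inside
    the interval is strictly inside at most one half, and inside neither if it equals [mid]. *)
Lemma potential_halves lam lo hi mid e : 0 <= lam -> lo < hi ->
  mid = (lo + hi) / 2 ->
  potential lam lo mid e + potential lam mid hi e <=
  2 * potential lam lo hi e - lam * (ends_inside lo hi e)%:R.
Proof.
move=> l0 lh midE; rewrite /potential.
have m1 : lo <= mid by rewrite midE; lra.
have m2 : mid <= hi by rewrite midE; lra.
have := ends_inside_halves e m1 m2; rewrite -(ler_nat R) natrD => hE.
rewrite -(overlap_halves e.1 e.2 m1 m2).
have -> : mid - lo = (hi - lo) / 2 by rewrite midE; field.
have -> : hi - mid = (hi - lo) / 2 by rewrite midE; field.
have w0 : hi - lo != 0 by lra.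
set o1 := overlap lo mid _ _; set o2 := overlap mid hi _ _.
have -> : o1 / ((hi - lo) / 2) = 2 * (o1 / (hi - lo)) by field.
have -> : o2 / ((hi - lo) / 2) = 2 * (o2 / (hi - lo)) by field.
have : lam * ((ends_inside lo mid e)%:R + (ends_inside mid hi e)%:R) <=
  lam * (ends_inside lo hi e)%:R by rewrite ler_wpM2l.
rewrite mulrDr mulrDl; lra.
Qed.

(** An edge without end values inside either spans the interval or misses it, and so it does with
    both halves. Hence it never influences the choice of a half and may be forgotten. *)
Lemma potential_inactive lam lo hi mid e : lo < hi -> ~~ active lo hi e ->
  mid = (lo + hi) / 2 ->
  potential lam lo mid e = potential lam mid hi e.
Proof.
move=> lh na midE.
have m1 : lo < mid by rewrite midE; lra.
have m2 : mid < hi by rewrite midE; lra.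
have wE : mid - lo = hi - mid by rewrite midE; field.
move: na; rewrite /active /strictly_inside negb_or => /andP[n1 n2].
have nx (x : R) : ~~ (lo < x < hi) -> ~~ (lo < x < mid) /\ ~~ (mid < x < hi).
  case: (ltP lo x) => l; case: (ltP x mid) => l'; case: (ltP mid x) => l'';
    case: (ltP x hi) => l''' //=; lra.
have [a1 a2] := nx _ n1; have [b1 b2] := nx _ n2.
rewrite /potential /ends_inside /strictly_inside.
rewrite (negbTE a1) (negbTE a2) (negbTE b1) (negbTE b2) wE; congr (_ / _ + _).
have out (x : R) : ~~ (lo < x < hi) -> x <= lo \/ hi <= x.
  by case: (ltP lo x) => l; case: (ltP x hi) => l' //= _; [right|left|left].
have xo : Num.min e.1 e.2 <= lo \/ hi <= Num.min e.1 e.2.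
  by case: (leP e.1 e.2) => _; exact: out.
have yo : Num.max e.1 e.2 <= lo \/ hi <= Num.max e.1 e.2.
  by case: (leP e.1 e.2) => _; exact: out.
have xy : Num.min e.1 e.2 <= Num.max e.1 e.2 by rewrite ge_min !le_max lexx.
case: xo => xo; case: yo => yo; try by rewrite !overlap_out //; lra.
by rewrite !overlap_full //; lra.
Qed.

Lemma active_ends_inside lo hi s :
  (count (active lo hi) s <= \sum_(e <- s) ends_inside lo hi e)%N.
Proof.
elim: s => [|e s IH]; first by rewrite big_nil.
by rewrite big_cons /= leq_add // /active /ends_inside; do 2 case: strictly_inside.
Qed.

Lemma active_sub lo hi lo' hi' e : lo <= lo' -> hi' <= hi ->
  active lo' hi' e -> active lo hi e.
Proof.
move=> h1 h2; rewrite /active /strictly_inside.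
by move=> /orP[] /andP[l1 l2]; apply/orP; [left|right]; lra.
Qed.

(** With no end value inside, an edge that crosses [lo] spans [[lo, hi]], and its probability has
    become 1. *)
Lemma crossing_potential lam lo hi e : 0 <= lam -> lo < hi -> ~~ active lo hi e ->
  ((e.1 <= lo) != (e.2 <= lo))%:R <= potential lam lo hi e.
Proof.
move=> l0 lh na; have p0 := potential_ge0 e l0 lh.
case: eqP => // /eqP cr.
move: na; rewrite /active /strictly_inside negb_or => /andP[n1 n2].
rewrite /potential /ends_inside /strictly_inside (negbTE n1) (negbTE n2) mulr0 addr0.
rewrite overlap_full ?divff; first by [].
- by rewrite subr_eq0 gt_eqF.
- exact: ltW.
all: move: n1 n2 cr; case: (leP e.1 lo) => l1; case: (leP e.2 lo) => l2 //=.
- by move=> _ _ _; rewrite ge_min l1.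
- by move=> _ _ _; rewrite ge_min l2 orbT.
- by move=> _ n2 _; rewrite le_max (leNgt hi e.2) n2 orbT.
- by move=> n1 _ _; rewrite le_max (leNgt hi e.1) n1.
Qed.

End Potential.

(** * Existence of a separating pair of rectangles *)

(* An inner rectangle has half-sides [scm * u * sideA] and [scm * u * sideB], in
   units of [unit_length] below, or the same exchanged, and must contain a
   fraction [1 / kap] of the nodes; the concentric outer rectangle has
   half-sides [sck * (u - 1) * sideA] and [sck * (u - 1) * sideB] and must
   contain at most a fraction [1 - 1 / kap].  Only sizes [u >= u0] are tried. *)
Record params := Params {
  sideA : nat; sideB : nat; scm : nat; sck : nat; kap : nat; u0 : nat }.

Definition halfA (P : params) (o : bool) : nat := if o then sideB P else sideA P.
Definition halfB (P : params) (o : bool) : nat := if o then sideA P else sideB P.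

(** The number of units in [del]. The factors make the longer side of an outer rectangle of size
    [u0] shorter than [del], on account of its scale [u0 - 1]. *)
Definition steps (P : params) : nat := (2 * sck P * sideA P * u0 P)%N.
(** Bounds how far centers can be from [p], in units per coordinate: an outer rectangle that
    contains [p] has its center within [sck * sideA * u], the next center is within
    [scm * sideA * u] of that, and [u <= steps]. *)
Definition reach (P : params) : nat := ((sck P + scm P) * sideA P * steps P)%N.

Definition candidates (P : params) : seq (bool * ((nat * nat) * nat)) :=
  [seq (o, x) | o <- [:: false; true],
    x <- [seq (ij, u) |
       ij <- [seq (i, j) | i <- iota 0 (2 * reach P).+1, j <- iota 0 (2 * reach P).+1],
       u <- iota (u0 P) (steps P - u0 P).+1]].

(** Normalised to inner size 1. With [kap - 1] inner rectangles, more than [(1 - 1 / kap) * n] nodes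
    in the outer one force [n / kap] into one of them. The offsets are integers, so that multiplied
    by the size they lead from grid points to grid points. *)
Definition coverable (R : realType) (P : params) : Prop := forall o : bool,
  exists zs : seq (bool * (int * int)),
  [/\ size zs = (kap P).-1,
   forall z, z \in zs -> `|z.2.1%:~R| <= (scm P * sideA P)%:R :> R /\
                         `|z.2.2%:~R| <= (scm P * sideA P)%:R :> R &
   forall x y : R, `|x| <= (sck P * halfA P o)%:R -> `|y| <= (sck P * halfB P o)%:R ->
     exists2 z, z \in zs & `|x - z.2.1%:~R| <= (scm P * halfA P z.1)%:R /\
                           `|y - z.2.2%:~R| <= (scm P * halfB P z.1)%:R].

Definition wf_params (P : params) : Prop :=
  [/\ (0 < sideB P)%N, (sideB P <= sideA P)%N, (0 < scm P)%N, (0 < sck P)%N &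
      (2 < kap P)%N /\ (0 < u0 P)%N].

Lemma two_thirds_bound kp c n : (2 < kp)%N -> (3 * c <= 2 * n)%N ->
  (kp * c <= kp.-1 * n)%N.
Proof.
case: kp => // kp k3 h; rewrite /= -(leq_pmul2l (isT : 0 < 3)%N).
have h1 : (kp.+1 * (3 * c) <= kp.+1 * (2 * n))%N by rewrite leq_mul2l h orbT.
have h2 : (kp.+1 * 2 * n <= 3 * kp * n)%N by rewrite leq_mul2r; apply/orP; right; lia.
lia.
Qed.

Section Search.
Context {R : realType} {n : nat}.
Variables (pos : 'I_n -> R * R) (p : R * R) (del : R) (P : params).

Definition nodes_within (o : bool) (q : R * R) (t : R) : {set 'I_n} :=
  [set v | gauge (halfA P o)%:R (halfB P o)%:R q (pos v) <= t].

Definition unit_length : R := del / (steps P)%:R.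

Definition grid_center (i j : nat) : R * R :=
  (p.1 + unit_length * i%:R - unit_length * (reach P)%:R,
   p.2 + unit_length * j%:R - unit_length * (reach P)%:R).

Definition passes (c : bool * ((nat * nat) * nat)) : bool :=
  let: (o, ((i, j), u)) := c in
  (n <= kap P * #|nodes_within o (grid_center i j) (unit_length * (scm P * u)%:R)|)%N &&
  (kap P * #|nodes_within o (grid_center i j) (unit_length * (sck P * u.-1)%:R)| <=
   (kap P).-1 * n)%N.

Hypothesis Pwf : wf_params P.
Hypothesis Pcov : coverable R P.
Hypothesis del0 : 0 < del.
Hypothesis medx1 : (2 * n <= 5 * #|[set v | ((pos v).1 <= p.1)%R]|)%N.
Hypothesis medx2 : (3 * #|[set v | ((pos v).1 < p.1)%R]| <= 2 * n)%N.
Hypothesis medy1 : (2 * n <= 5 * #|[set v | ((pos v).2 <= p.2)%R]|)%N.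
Hypothesis medy2 : (3 * #|[set v | ((pos v).2 < p.2)%R]| <= 2 * n)%N.
Hypothesis medd1 : (2 * n <= 5 * #|[set v | (gauge 1 1 p (pos v) <= del)%R]|)%N.
Hypothesis medd2 : (3 * #|[set v | (gauge 1 1 p (pos v) < del)%R]| <= 2 * n)%N.

Let s := unit_length.

Let A1 : (0 < sideA P)%N. Proof. by case: Pwf => h1 h2 _ _ _; exact: leq_trans h2. Qed.
Let B1 : (0 < sideB P)%N. Proof. by case: Pwf. Qed.

Lemma steps_gt0 : (0 < steps P)%N.
Proof. by case: Pwf => _ _ _ k0 [_ h]; rewrite /steps !muln_gt0 A1 k0 h. Qed.

Lemma unit_length_gt0 : 0 < unit_length.
Proof. by rewrite divr_gt0 // ltr0n steps_gt0. Qed.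

Let half_gt0 o : (0 < (halfA P o)%:R :> R) /\ (0 < (halfB P o)%:R :> R).
Proof. by rewrite /halfA /halfB; case: o; rewrite !ltr0n. Qed.

Let half_le o : (halfA P o <= sideA P)%N /\ (halfB P o <= sideA P)%N.
Proof. by case: Pwf => _ h _ _ _; rewrite /halfA /halfB; case: o. Qed.

Let card_le (O : {set 'I_n}) (D : pred 'I_n) : (forall v, v \in O -> D v) ->
  (#|O| <= #|[set v | D v]|)%N.
Proof. by move=> h; apply: subset_leq_card; apply/fintype.subsetP => v; rewrite inE; exact: h. Qed.

Let card_gt (f : 'I_n -> R) x (O : {set 'I_n}) :
  (2 * n <= 5 * #|[set v | (f v <= x)%R]|)%N ->
  (forall v, v \in O -> x < f v) -> (3 * #|O| <= 2 * n)%N.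
Proof.
move=> h hO; have : (#|O| <= #|~: [set v | (f v <= x)%R]|)%N.
  apply: subset_leq_card; apply/fintype.subsetP => v vO.
  by rewrite !inE -ltNge hO.
have := cardsC [set v | (f v <= x)%R]; rewrite card_ord; lia.
Qed.

(** If [p] were beyond a side of the rectangle, all its nodes would lie strictly on one side of an
    approximate median, and there are at most [2 * n / 3] of these. *)
Lemma many_contains_center o q t : 0 <= t -> 
  ((kap P).-1 * n < kap P * #|nodes_within o q t|)%N ->
  `|q.1 - p.1| <= t * (halfA P o)%:R /\ `|q.2 - p.2| <= t * (halfB P o)%:R.
Proof.
move=> t0 h; have [a0 b0] := half_gt0 o.
have big : ~ (3 * #|nodes_within o q t| <= 2 * n)%N.
  move=> h3; case: Pwf => _ _ _ _ [k3 _].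
  by move: h; rewrite ltnNge (two_thirds_bound k3 h3).
have inside v : v \in nodes_within o q t ->
    `|(pos v).1 - q.1| <= t * (halfA P o)%:R /\ `|(pos v).2 - q.2| <= t * (halfB P o)%:R.
  by rewrite inE gauge_le // => /andP.
split; rewrite ler_norml; apply/andP; split; rewrite leNgt; apply/negP => hlt; apply: big.
- have sub : forall v, v \in nodes_within o q t -> ((pos v).1 < p.1)%R.
    by move=> v /inside [+ _]; rewrite ler_norml => /andP[_ h2]; lra.
  by have := card_le sub; lia.
- apply: (card_gt medx1) => v /inside [+ _].
  by rewrite ler_norml => /andP[h1 _]; lra.
- have sub : forall v, v \in nodes_within o q t -> ((pos v).2 < p.2)%R.
    by move=> v /inside [_]; rewrite ler_norml => /andP[_ h2]; lra.
  by have := card_le sub; lia.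
- apply: (card_gt medy1) => v /inside [_].
  by rewrite ler_norml => /andP[h1 _]; lra.
Qed.

Let sum_bound (T : eqType) (zs : seq T) (F : T -> {set 'I_n}) (O : {set 'I_n}) kp :
  (forall v, v \in O -> exists2 z, z \in zs & v \in F z) ->
  (forall z, z \in zs -> (kp * #|F z| <= n)%N) -> (kp * #|O| <= size zs * n)%N.
Proof.
elim: zs O => [|z zs IH] O hO hF.
  have -> : O = finset.set0.
    by apply/setP => v; rewrite inE; apply/negP => /hO [].
  by rewrite cards0 muln0.
have hz : (kp * #|F z| <= n)%N by apply: hF; rewrite mem_head.
have : (kp * #|O :\: F z| <= size zs * n)%N.
  apply: IH => [v|z' zs'].
    rewrite inE => /andP[vF /hO [z']].
    rewrite inE => /orP[/eqP ->|]; first by rewrite (negbTE vF).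
    by exists z'.
  by apply: hF; rewrite inE zs' orbT.
have := cardsID (F z) O; have := subset_leq_card (subsetIr O (F z)).
move=> hI <- hD; rewrite /= mulnDr mulSn; apply: leq_add hD.
by apply: leq_trans hz; rewrite leq_mul2l hI orbT.
Qed.

(** Signed grid coordinates, for the descent; [grid_center] shifts them by [reach], because programs
    have only natural constants. *)
Let ctr (z : int * int) : R * R := (p.1 + s * z.1%:~R, p.2 + s * z.2%:~R).

Let inner o z u := nodes_within o (ctr z) (s * (scm P * u)%:R).
Let outer o z u := nodes_within o (ctr z) (s * (sck P * u.-1)%:R).

(** With more nodes the rectangle would contain [p]; its sides being shorter than [del], all its
    nodes would then be closer to [p] than [del], which holds for at most [2 * n / 3] nodes. *)
Lemma outer_small o z : (kap P * #|outer o z (u0 P)| <= (kap P).-1 * n)%N.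
Proof.
have s0 := unit_length_gt0.
rewrite leqNgt; apply/negP => h.
have t0 : 0 <= s * (sck P * (u0 P).-1)%:R by rewrite mulr_ge0 // ltW.
have [h1 h2] := many_contains_center t0 h.
have [a0 b0] := half_gt0 o; have [la lb] := half_le o.
set t := s * _ in t0 h1 h2.
have tA : 2 * (t * (sideA P)%:R) < del.
  have -> : del = s * (steps P)%:R.
    by rewrite /s /unit_length divfK // pnatr_eq0 -lt0n steps_gt0.
  have -> : 2 * (t * (sideA P)%:R) = s * (2 * sck P * sideA P * (u0 P).-1)%:R.
    by rewrite /t !natrM; ring.
  rewrite ltr_pM2l // ltr_nat /steps; case: Pwf => _ _ _ k0 [_ u00].
  by rewrite ltn_pmul2l ?muln_gt0 ?k0 ?A1 // ltn_predL.
have lA : t * (halfA P o)%:R <= t * (sideA P)%:R by rewrite ler_wpM2l // ler_nat.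
have lB : t * (halfB P o)%:R <= t * (sideA P)%:R by rewrite ler_wpM2l // ler_nat.
have sub : forall v, v \in outer o z (u0 P) -> (gauge 1 1 p (pos v) < del)%R.
  move=> v; rewrite inE gauge_le // -/t => /andP[g1 g2].
  rewrite /gauge gt_max !divr1; apply/andP; split.
    have := ler_normD ((pos v).1 - (ctr z).1) ((ctr z).1 - p.1).
    by rewrite addrA subrK; lra.
  have := ler_normD ((pos v).2 - (ctr z).2) ((ctr z).2 - p.2).
  by rewrite addrA subrK; lra.
have hc := card_le sub; case: Pwf => _ _ _ _ [k3 _].
move: h; rewrite ltnNge (two_thirds_bound k3) //.
by apply: leq_trans medd2; rewrite leq_mul2l hc.
Qed.

(* If the outer rectangle has too many nodes, then it contains [p], and one of
   the [kap - 1] inner rectangles of the next smaller size that cover it has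
   enough nodes; the centers cannot drift away from [p]. *)
Lemma descent u o z : (u0 P <= u <= steps P)%N ->
  `|z.1%:~R| <= (reach P)%:R :> R -> `|z.2%:~R| <= (reach P)%:R :> R ->
  (n <= kap P * #|inner o z u|)%N ->
  exists o' z' u', [/\ (u0 P <= u' <= steps P)%N,
    `|z'.1%:~R| <= (reach P)%:R :> R /\ `|z'.2%:~R| <= (reach P)%:R :> R,
    (n <= kap P * #|inner o' z' u'|)%N &
    (kap P * #|outer o' z' u'| <= (kap P).-1 * n)%N].
Proof.
have s0 := unit_length_gt0.
elim: u o z => [|u IH] o z /andP[u0u uN] z1 z2 hin.
  by case: Pwf => _ _ _ _ [_]; lia.
have [hout|hout] := leqP (kap P * #|outer o z u.+1|) ((kap P).-1 * n).
  by exists o, z, u.+1; rewrite u0u uN.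
have u0u' : (u0 P <= u)%N.
  move: u0u; rewrite leq_eqVlt => /orP[/eqP E|]; last by rewrite ltnS.
  by have := outer_small o z; rewrite E leqNgt hout.
have t0 : 0 <= s * (sck P * u)%:R by rewrite mulr_ge0 // ltW.
have [h1 h2] := many_contains_center t0 hout.
have [zs [szz bz cov]] := Pcov o.
have u1 : (0 < u)%N by case: Pwf => _ _ _ _ [_ h]; exact: leq_trans h u0u'.
have ur : 0 < u%:R :> R by rewrite ltr0n.
pose sub (c : bool * (int * int)) : int * int := (z.1 + c.2.1 * u%:Z, z.2 + c.2.2 * u%:Z).
case: (pselect (exists2 c, c \in zs & (n <= kap P * #|inner c.1 (sub c) u|)%N)); last first.
  move=> none; exfalso.
  have : (kap P * #|outer o z u.+1| <= size zs * n)%N.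
    apply: (sum_bound (F := fun c => inner c.1 (sub c) u)) => [v|c czs]; last first.
      by rewrite leqNgt; apply/negP => hc; apply: none; exists c => //; exact: ltnW.
    have [a0 b0] := half_gt0 o.
    rewrite inE gauge_le // => /andP[g1 g2].
    have su : 0 < s * u%:R by rewrite mulr_gt0.
    have c1 : `|((pos v).1 - (ctr z).1) / (s * u%:R)| <= (sck P * halfA P o)%:R.
      rewrite normrM normfV (gtr0_norm su) ler_pdivrMr //.
      by apply: le_trans g1 _; rewrite /= !natrM le_eqVlt; apply/orP; left; apply/eqP; ring.
    have c2 : `|((pos v).2 - (ctr z).2) / (s * u%:R)| <= (sck P * halfB P o)%:R.
      rewrite normrM normfV (gtr0_norm su) ler_pdivrMr //.
      by apply: le_trans g2 _; rewrite /= !natrM le_eqVlt; apply/orP; left; apply/eqP; ring.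
    have [c czs [d1 d2]] := cov _ _ c1 c2.
    exists c => //; have [ca cb] := half_gt0 c.1.
    have scale (x y w t : R) : `|x / (s * u%:R) - y| <= t -> w = y * (s * u%:R) ->
        `|x - w| <= t * (s * u%:R).
      move=> ht ->; have -> : x - y * (s * u%:R) = (x / (s * u%:R) - y) * (s * u%:R).
        by rewrite mulrBl divfK // gt_eqF.
      by rewrite normrM (gtr0_norm su) ler_pM2r.
    rewrite inE gauge_le //; apply/andP; split.
      have -> : (pos v).1 - (ctr (sub c)).1 =
          ((pos v).1 - (ctr z).1) - c.2.1%:~R * (s * u%:R).
        by rewrite /ctr /sub /= rmorphD rmorphM /= -pmulrn; ring.
      apply: le_trans (scale _ _ _ _ d1 erefl) _.
      by rewrite !natrM le_eqVlt; apply/orP; left; apply/eqP; ring.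
    have -> : (pos v).2 - (ctr (sub c)).2 =
        ((pos v).2 - (ctr z).2) - c.2.2%:~R * (s * u%:R).
      by rewrite /ctr /sub /= rmorphD rmorphM /= -pmulrn; ring.
    apply: le_trans (scale _ _ _ _ d2 erefl) _.
    by rewrite !natrM le_eqVlt; apply/orP; left; apply/eqP; ring.
  by rewrite szz leqNgt hout.
case=> c czs hc; have [b1 b2] := bz _ czs.
have [la lb] := half_le o.
(* The new center is bounded by way of the outer rectangle, which contains [p], and not by the bound
   on the old center; hence offsets do not accumulate. *)
have drift (x y d : R) (H : nat) : `|s * x| <= s * (sck P * u)%:R * H%:R ->
    (H <= sideA P)%N -> d = x + y * u%:R -> `|y| <= (scm P * sideA P)%:R ->
    `|d| <= (reach P)%:R.
  move=> hx HA -> hy.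
  have hx' : `|x| <= (sck P * sideA P * u)%:R.
    move: hx; rewrite normrM (gtr0_norm s0) -mulrA ler_pM2l // => /le_trans; apply.
    by rewrite -natrM ler_nat mulnAC leq_mul2r leq_mul2l HA !orbT.
  have hy' : `|y * u%:R| <= (scm P * sideA P * u)%:R.
    by rewrite normrM normr_nat natrM ler_pM2r.
  apply: le_trans (ler_normD _ _) _; apply: le_trans (lerD hx' hy') _.
  rewrite -natrD ler_nat /reach -!mulnDl leq_mul2l; apply/orP; right.
  exact: ltnW.
apply: (IH c.1 (sub c)) => //.
- by rewrite u0u' ltnW.
- apply: (drift z.1%:~R c.2.1%:~R _ _ _ la _ b1).
    by move: h1; rewrite /ctr /= addrC addKr.
  by rewrite /sub /= rmorphD rmorphM /= -pmulrn.
- apply: (drift z.2%:~R c.2.2%:~R _ _ _ lb _ b2).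
    by move: h2; rewrite /ctr /= addrC addKr.
  by rewrite /sub /= rmorphD rmorphM /= -pmulrn.
Qed.

(** The descent starts at size [steps], where unit times size is [del]: the inner rectangle around
    [p] has half-sides at least [del], hence at least two fifths of the nodes. *)
Lemma exists_passing : exists2 c, c \in candidates P & passes c.
Proof.
have s0 := unit_length_gt0.
have [a0 b0] := half_gt0 false.
have hin : (n <= kap P * #|inner false (0%R, 0%R) (steps P)|)%N.
  have sub : forall v, v \in [set v | (gauge 1 1 p (pos v) <= del)%R] ->
      v \in inner false (0%R, 0%R) (steps P).
    move=> v; rewrite !inE !gauge_le // !mulr1 /ctr /= !mulr0 !addr0.
    have -> : s * (scm P * steps P)%:R = del * (scm P)%:R.
      rewrite natrM mulrCA mulrC; congr (_ * _).
      by rewrite /s /unit_length divfK // pnatr_eq0 -lt0n steps_gt0.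
    move=> /andP[g1 g2]; case: Pwf => _ _ m0 _ _.
    by apply/andP; split; [apply: le_trans g1 _|apply: le_trans g2 _];
      rewrite -mulrA -natrM ler_peMr ?(ltW del0) // ler1n muln_gt0 m0 ?A1 ?B1.
  have := card_le sub; case: Pwf => _ _ _ _ [k3 _].
  have -> : [set v | v \in inner false (0%R, 0%R) (steps P)] = inner false (0%R, 0%R) (steps P).
    by apply/setP => v; rewrite inE.
  move=> hc; apply: (@leq_trans (3 * #|inner false (0%R, 0%R) (steps P)|)%N).
    have := leq_trans medd1 (leq_mul (leqnn 5) hc).
    by move: #|inner _ _ _| => b; clear; lia.
  by rewrite leq_mul2r k3 orbT.
have u0N : (u0 P <= steps P <= steps P)%N.
  rewrite leqnn andbT /steps leq_pmull //.
  by case: Pwf => _ _ _ k0 _; rewrite !muln_gt0 k0 A1.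
have r0 : `|(0 : int)%:~R| <= (reach P)%:R :> R by rewrite normr0 ler0n.
have [ o [z [u [hu [hz1 hz2] h1 h2]]]] := descent (z := (0%R, 0%R)) u0N r0 r0 hin.
have toN (w : int) : `|w%:~R| <= (reach P)%:R :> R ->
   exists2 i : nat, (i <= 2 * reach P)%N & w%:~R = i%:R - (reach P)%:R :> R.
  rewrite -intr_norm [(reach P)%:R]pmulrn ler_int => hw.
  have wE : w = (absz (w + (reach P)%:Z))%:Z - (reach P)%:Z by move: hw; clear; lia.
  exists (absz (w + (reach P)%:Z)); first by move: hw; clear; lia.
  by rewrite [in LHS]wE rmorphB /= -!pmulrn.
have [i hi ei] := toN _ hz1; have [j hj ej] := toN _ hz2.
exists (o, ((i, j), u)).
  apply/allpairsP; exists (o, ((i, j), u)); split => //; first by case: (o).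
  apply/allpairsP; exists ((i, j), u); split => //; last by rewrite mem_iota /=; move: hu; clear; lia.
  by apply/allpairsP; exists (i, j); split => //; rewrite mem_iota /= ltnS.
have cE : grid_center i j = ctr z by rewrite /grid_center /ctr ei ej !mulrBr !addrA.
by rewrite /passes cE; apply/andP; split.
Qed.

End Search.

(** * Searching the separating pair *)

Notation iX := 14%N (only parsing).
Notation iY := 15%N (only parsing).
Notation iW := 16%N (only parsing).
Notation iF := 17%N (only parsing).
Notation iU := 18%N (only parsing).
Notation iV := 19%N (only parsing).
Notation iA := 20%N (only parsing).
Notation iI := 21%N (only parsing).
Notation iO := 22%N (only parsing).
Notation rQX := 4%N (only parsing).
Notation rQY := 5%N (only parsing).
Notation rGA := 6%N (only parsing).
Notation rGB := 7%N (only parsing).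
Notation rT0 := 8%N (only parsing).
Notation rT1 := 9%N (only parsing).
Notation ra := 10%N (only parsing).
Notation rb := 11%N (only parsing).
Notation rc := 12%N (only parsing).
Notation rd := 13%N (only parsing).
Notation rPX := 14%N (only parsing).
Notation rPY := 15%N (only parsing).
Notation rDel := 16%N (only parsing).
Notation rSig := 17%N (only parsing).

(** Counting down makes [iC], the number of rounds left, also the index of the node to be
    treated. *)
Definition fill_prog (p : prog) : prog :=
  Seq (block [:: IConst iJ 0; IAdd iC iN iJ]) (loop iC p).

Definition copy_prog (a : nat) : prog :=
  fill_prog (block [:: RLoad ra a iC; RStore 2 iC ra]).

Definition scaled_dist_prog (r a q g : nat) : prog :=
  Seq (block [:: RLoad r a iC; RSub r r q])
 (Seq (If (RLe r rZ) (block [:: RSub r rZ r]) (block [::]))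
      (block [:: RDiv r r g])).

Definition gauge_prog : prog :=
  fill_prog
   (Seq (scaled_dist_prog ra 0 rQX rGA)
   (Seq (scaled_dist_prog rb 1 rQY rGB)
        (If (RLe ra rb) (block [:: RStore 2 iC rb]) (block [:: RStore 2 iC ra])))).

Definition count_prog : prog :=
  Seq (block [:: IConst iI 0; IConst iO 0])
      (fill_prog (Seq (block [:: RLoad ra 2 iC])
         (Seq (If (RLe ra rT0) (block [:: IAdd iI iI i1]) (block [::]))
              (If (RLe ra rT1) (block [:: IAdd iO iO i1]) (block [::]))))).

(** * Correctness of the loops over the nodes *)

Section FillProofs.
Context {R : realType}.
Implicit Types (st : state R) (p : prog).

Lemma agree_set_ivar w st st1 x k : (0%N, x) \in w ->
  agree_off w st st1 -> agree_off w st (set_ivar st1 x k).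
Proof.
move=> xw ag; apply: agree_off_trans ag _; split=> y yw //=.
by case: eqP yw => // ->; rewrite xw.
Qed.

Lemma agree_set_rvar w st st1 x v : (1%N, x) \in w ->
  agree_off w st st1 -> agree_off w st (set_rvar st1 x v).
Proof.
move=> xw ag; apply: agree_off_trans ag _; split=> y yw //=.
by case: eqP yw => // ->; rewrite xw.
Qed.

Lemma agree_set_rarr w st st1 a i v : (3%N, a) \in w ->
  agree_off w st st1 -> agree_off w st (set_rarr st1 a i v).
Proof.
move=> xw ag; apply: agree_off_trans ag _; split=> y yw //=.
by case: eqP yw => // ->; rewrite xw.
Qed.

Lemma runs_fill p T (n : nat) (Inv : nat -> state R -> Prop) st :
  ivar st iN = n ->
  (forall k st1, Inv k st1 -> ivar st1 iC = k /\ ivar st1 i1 = 1%N) ->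
  (forall k st1, (k < n)%N -> Inv k.+1 st1 -> runs p (set_ivar st1 iC k) T (Inv k)) ->
  Inv n (set_ivar (set_ivar st iJ 0) iC n) ->
  runs (fill_prog p) st (n * T.+2 + 4) (Inv 0%N).
Proof.
move=> hN hc hp hI; have -> : (n * T.+2 + 4 = 3 + (n * T.+2).+1)%N by lia.
apply: (runs_block_seq (l := [:: _; _])) => /=; rewrite hN addn0.
pose Inv' k st1 := Inv k st1 /\ (k <= n)%N.
apply: (@runs_weaken _ _ _ (n * T.+2).+1 _ (Inv' 0%N)) => //; last by move=> ? [].
apply: (@runs_loop _ _ _ Inv').
- by move=> k st1 [h _]; exact: hc h.
- move=> k st1 [h kn]; apply: (runs_weaken (hp _ _ kn h)) => // st2 h2.
  by split=> //; exact: ltnW.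
- by split.
Qed.

Lemma runs_copy a n st : consts st -> ivar st iN = n -> a != 2%N ->
  runs (copy_prog a) st (n * 5 + 4) (fun st' =>
    [/\ arr (rarr st' 2) n = arr (rarr st a) n & agree_off (writes (copy_prog a)) st st']).
Proof.
move=> [c1 c2 c4 cz] hN a2.
pose Inv k st1 := [/\ ivar st1 iC = k, ivar st1 i1 = 1%N, rarr st1 a = rarr st a &
  forall i, (k <= i < n)%N -> rarr st1 2 i = rarr st a i].
suff h : runs (copy_prog a) st (n * 5 + 4) (Inv 0%N).
  apply: (runs_weaken (runs_agree h)) => // st' [[_ _ _ h'] ag]; split => //.
  exact: eq_arr.
apply: (@runs_fill _ 3 n Inv) => //.
- by move=> k st1 [].
- move=> k st1 kn [h1 h2 h3 h4]; apply: (runs_block (l := [:: _; _])) => /=.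
  split => //=; first by rewrite (negbTE a2).
  move=> i /andP[ki iN']; case: eqP => [->|ik]; first by rewrite h3.
  by apply: h4; lia.
- by split => //= i; lia.
Qed.

Lemma runs_scaled_dist (r a q g : nat) st : rvar st rZ = 0 ->
  r != rZ -> q != r -> g != r -> 0 <= rvar st g ->
  runs (scaled_dist_prog r a q g) st 8 (fun st' =>
    rvar st' r = `|rarr st a (ivar st iC) - rvar st q| / rvar st g /\
    agree_off [:: (1%N, r)] st st').
Proof.
move=> hz rz qr gr g0.
have zr : (rZ == r) = false by rewrite eq_sym (negbTE rz).
have wE : writes (scaled_dist_prog r a q g) =i [:: (1%N, r)].
  by move=> z; rewrite !inE; case: (z == _).
suff h : runs (scaled_dist_prog r a q g) st 8 (fun st' =>
    rvar st' r = `|rarr st a (ivar st iC) - rvar st q| / rvar st g).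
  apply: (runs_weaken (runs_agree h)) => // st' [h' ag]; split => //.
  by apply: agree_off_sub ag => z; rewrite wE.
apply: (@runs_block_seq _ [:: _; _] _ _ 5) => /=.
rewrite (negbTE qr) eqxx; set d := rarr st a (ivar st iC) - rvar st q.
set st1 := set_rvar _ _ _.
apply: (@runs_seq _ _ _ _ 3 2 (fun st2 => rvar st2 r = `|d| /\ rvar st2 g = rvar st g)).
  apply: runs_if => /=; rewrite zr eqxx hz => hd.
    apply: (runs_block (l := [:: _])) => /=.
    by rewrite !eqxx (negbTE gr) zr hz sub0r ler0_norm.
  apply: (@runs_weaken _ _ _ 1%N) => //; last by move=> ?; apply.
  apply: (runs_block (l := [::])) => /=; rewrite !eqxx (negbTE gr).
  by rewrite gtr0_norm // ltNge.
move=> st2 [h1 h2]; apply: (runs_block (l := [:: _])) => /=.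
by rewrite eqxx h1 h2.
Qed.

Lemma runs_gauge n st : consts st -> ivar st iN = n ->
  0 < rvar st rGA -> 0 < rvar st rGB ->
  runs gauge_prog st (n * 25 + 4) (fun st' =>
    (forall i, (i < n)%N -> rarr st' 2 i =
       gauge (rvar st rGA) (rvar st rGB) (rvar st rQX, rvar st rQY)
             (rarr st 0 i, rarr st 1 i)) /\
    agree_off (writes gauge_prog) st st').
Proof.
move=> [c1 c2 c4 cz] hN a0 b0.
pose F i := gauge (rvar st rGA) (rvar st rGB) (rvar st rQX, rvar st rQY)
             (rarr st 0 i, rarr st 1 i).
pose w := [:: (1, ra); (1, rb); (0, iC); (0, iJ); (3, 2)]%N.
pose Inv k st1 := [/\ ivar st1 iC = k, agree_off w st st1 &
  forall i, (k <= i < n)%N -> rarr st1 2 i = F i].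
suff h : runs gauge_prog st (n * 25 + 4) (Inv 0%N).
  by apply: (runs_weaken (runs_agree h)) => // st' [[_ _ h'] ag]; split.
apply: (@runs_fill _ 23 n Inv) => //.
- by move=> k st1 [h1 ag _]; rewrite (agree_ivar ag (x := i1) isT).
- move=> k st1 kn [h1 ag h4].
  set st2 := set_ivar _ _ _.
  have ag2 : agree_off w st st2.
    exact: agree_set_ivar.
  have h4' i : (k < i < n)%N -> rarr st2 2 i = F i by exact: h4.
  have hC : ivar st2 iC = k by [].
  move: (st2) ag2 h4' hC => {h1 ag h4 st1} {}st2 ag2 h4 hC.
  have z2 : rvar st2 rZ = 0 by rewrite (agree_rvar ag2 (x := rZ) isT).
  have ga : rvar st2 rGA = rvar st rGA by rewrite (agree_rvar ag2 (x := rGA) isT).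
  have gb : rvar st2 rGB = rvar st rGB by rewrite (agree_rvar ag2 (x := rGB) isT).
  have qx : rvar st2 rQX = rvar st rQX by rewrite (agree_rvar ag2 (x := rQX) isT).
  have qy : rvar st2 rQY = rvar st rQY by rewrite (agree_rvar ag2 (x := rQY) isT).
  have r0 : rarr st2 0 = rarr st 0 by rewrite (agree_rarr ag2 (a := 0%N) isT).
  have r1 : rarr st2 1 = rarr st 1 by rewrite (agree_rarr ag2 (a := 1%N) isT).
  have ga0 : 0 <= rvar st2 rGA by rewrite ga ltW.
  apply: (runs_seq (T := 8) (T' := 15)
    (@runs_scaled_dist ra 0 rQX rGA st2 z2 isT isT isT ga0)).
  move=> st3 [d3 ag3].
  have z3 : rvar st3 rZ = 0 by rewrite (agree_rvar ag3 (x := rZ) isT).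
  have gb3 : rvar st3 rGB = rvar st rGB by rewrite (agree_rvar ag3 (x := rGB) isT).
  have qy3 : rvar st3 rQY = rvar st rQY by rewrite (agree_rvar ag3 (x := rQY) isT).
  have r13 : rarr st3 1 = rarr st 1 by rewrite (agree_rarr ag3 (a := 1%N) isT).
  have C3 : ivar st3 iC = k by rewrite (agree_ivar ag3 (x := iC) isT).
  have gb0 : 0 <= rvar st3 rGB by rewrite gb3 ltW.
  apply: (runs_seq (T := 8) (T' := 7)
    (@runs_scaled_dist rb 1 rQY rGB st3 z3 isT isT isT gb0)).
  move=> st4 [d4 ag4].
  have C4 : ivar st4 iC = k by rewrite (agree_ivar ag4 (x := iC) isT).
  have d3' : rvar st4 ra = rvar st3 ra by rewrite (agree_rvar ag4 (x := ra) isT).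
  have X4 : rarr st4 2 = rarr st2 2.
    by rewrite (agree_rarr ag4 (a := 2%N) isT) (agree_rarr ag3 (a := 2%N) isT).
  have ag24 : agree_off w st st4.
    apply: agree_off_trans ag2 _; apply: (@agree_off_trans _ _ _ st3).
      by apply: agree_off_sub ag3 => z; rewrite !inE => /eqP ->.
    by apply: agree_off_sub ag4 => z; rewrite !inE => /eqP ->.
  have fin x : x = F k -> Inv k (set_rarr st4 2 (ivar st4 iC) x).
    move=> ->; split => //=.
      exact: agree_set_rarr.
    move=> i /andP[ki iN']; rewrite C4; case: eqP => [->//|ik].
    by rewrite X4 h4 //; lia.
  have Fk : F k = Num.max (rvar st4 ra) (rvar st4 rb).
    by rewrite /F /gauge /= d4 d3' d3 gb3 qy3 r13 C3 ga qx r0 hC.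
  apply: (@runs_weaken _ _ _ 3) => //; last by move=> ?; apply.
  apply: runs_if => hle; apply: (runs_block (l := [:: _])); apply: fin; rewrite Fk.
    by rewrite max_r.
  by rewrite max_l // ltW // ltNge.
- split => //=; last by move=> i; lia.
  by do 2 apply: agree_set_ivar => //.
Qed.

Lemma runs_count n st : consts st -> ivar st iN = n ->
  runs count_prog st (n * 10 + 7) (fun st' =>
    [/\ ivar st' iI = count (fun x => (x <= rvar st rT0)%R) (arr (rarr st 2) n),
        ivar st' iO = count (fun x => (x <= rvar st rT1)%R) (arr (rarr st 2) n) &
    agree_off (writes count_prog) st st']).
Proof.
move=> [c1 c2 c4 cz] hN.
pose D0 x := (x <= rvar st rT0)%R; pose D1 x := (x <= rvar st rT1)%R.
pose Y k := [seq rarr st 2 i | i <- iota k (n - k)].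
pose Inv k st1 := [/\ ivar st1 iC = k /\ ivar st1 i1 = 1%N,
   ivar st1 iI = count D0 (Y k), ivar st1 iO = count D1 (Y k),
   rarr st1 2 = rarr st 2 & rvar st1 rT0 = rvar st rT0 /\ rvar st1 rT1 = rvar st rT1].
suff h : runs count_prog st (n * 10 + 7) (Inv 0%N).
  apply: (runs_weaken (runs_agree h)) => // st' [[_ hI hO _ _] ag].
  by rewrite hI hO !arrE /mkseq /Y subn0.
have -> : (n * 10 + 7 = 3 + (n * 10 + 4))%N by lia.
apply: (runs_block_seq (l := [:: _; _])) => /=.
apply: (@runs_fill _ 8 n Inv) => //.
- by move=> k st1 [].
- move=> k st1 kn [[h1 h2] h3 h4 h5 [h6 h7]].
  have YE : Y k = rarr st 2 k :: Y k.+1.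
    by rewrite /Y -(subnSK kn).
  apply: (@runs_block_seq _ [:: _] _ _ 6) => /=.
  set x := rarr st1 2 k; have xE : x = rarr st 2 k by rewrite /x h5.
  apply: (@runs_seq _ _ _ _ 3 3 (fun st2 =>
    [/\ ivar st2 iC = k /\ ivar st2 i1 = 1%N,
     ivar st2 iI = count D0 (Y k), ivar st2 iO = count D1 (Y k.+1),
     rarr st2 2 = rarr st 2 & [/\ rvar st2 rT0 = rvar st rT0, rvar st2 rT1 = rvar st rT1
      & rvar st2 ra = x]])).
    apply: runs_if => /= hd.
      apply: (runs_block (l := [:: _])); split => //=.
      by rewrite h2 h3 YE /= /D0 -xE -h6 hd addnC.
    apply: (@runs_weaken _ _ _ 1%N) => //; last by move=> ?; apply.
    apply: (runs_block (l := [::])); split => //=.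
    by rewrite h3 YE /= {2}/D0 -xE -h6 (negbTE hd).
  move=> st2 [[g1 g2] g3 g4 g5 [g6 g7 g8]].
  apply: runs_if => /= hd.
    apply: (runs_block (l := [:: _])); split => //=.
    by rewrite g2 g4 YE /= /D1 -xE -g7 -g8 hd addnC.
  apply: (@runs_weaken _ _ _ 1%N) => //; last by move=> ?; apply.
  apply: (runs_block (l := [::])); split => //=.
  by rewrite g4 YE /= {2}/D1 -xE -g7 -g8 (negbTE hd).
- by split => //=; rewrite /Y subnn.
Qed.

End FillProofs.

Definition multiple_prog (x k y : nat) : prog :=
  Seq (block [:: IConst x 0]) (block (nseq k (IAdd x x y))).

(** The integer products are evaluated when the program is formed; at run time they are numerals. *)
Definition place (P : params) (c : bool * ((nat * nat) * nat)) : seq instr :=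
  let: (o, ((i, j), u)) := c in
  [:: IConst iX (halfA P o); ROfInt rGA iX; IConst iX (halfB P o); ROfInt rGB iX;
      IConst iX (reach P); ROfInt rb iX; RMul rb rSig rb;
      IConst iX i; ROfInt ra iX; RMul ra rSig ra; RAdd rQX rPX ra; RSub rQX rQX rb;
      IConst iX j; ROfInt ra iX; RMul ra rSig ra; RAdd rQY rPY ra; RSub rQY rQY rb;
      IConst iX (scm P * u); ROfInt ra iX; RMul rT0 rSig ra;
      IConst iX (sck P * u.-1); ROfInt ra iX; RMul rT1 rSig ra].

(** Once a candidate has passed, the flag [iF] disables all later trials, so that its levels in
    [rT0] and [rT1] and its gauge values in real array 2 survive for the cut. *)
Definition try_prog (P : params) (c : bool * ((nat * nat) * nat)) : prog :=
  If (ILe i1 iF) (block [::])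
   (Seq (block (place P c))
   (Seq gauge_prog
   (Seq count_prog
   (Seq (multiple_prog iX (kap P) iI)
   (Seq (multiple_prog iY (kap P).-1 iN)
   (Seq (multiple_prog iW (kap P) iO)
        (If (ILe iN iX) (If (ILe iW iY) (block [:: IConst iF 1]) (block [::]))
            (block [::])))))))).

Definition search_prog (P : params) (l : seq (bool * ((nat * nat) * nat))) : prog :=
  foldr (fun c q => Seq (try_prog P c) q) (block [::]) l.

Arguments search_prog : simpl never.
Arguments passes : simpl never.

Section SearchProofs.
Context {R : realType} {n : nat}.
Variables (pos : 'I_n -> R * R) (p : R * R) (del : R) (P : params).
Implicit Types (st : state R).

Lemma count_arr_card (F : 'I_n -> R) (f : nat -> R) (D : pred R) :
  (forall v : 'I_n, f v = F v) -> count D (arr f n) = #|[set v | D (F v)]|.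
Proof.
move=> fF; rewrite arrE /mkseq -val_enum_ord -map_comp count_map.
rewrite -sum1_count -sum1dep_card big_enum_cond /=.
by apply: eq_bigl => v /=; rewrite fF.
Qed.

Lemma runs_multiple x k y st : x != y ->
  runs (multiple_prog x k y) st (k + 3) (fun st' =>
    ivar st' x = (k * ivar st y)%N /\ agree_off [:: (0%N, x)] st st').
Proof.
move=> xy; have yx : (y == x) = false by rewrite eq_sym (negbTE xy).
have add st1 : runs (block (nseq k (IAdd x x y))) st1 k.+1 (fun st' =>
    ivar st' x = (ivar st1 x + k * ivar st1 y)%N /\ agree_off [:: (0%N, x)] st1 st').
  have wE : {subset writes (block (nseq k (IAdd x x y))) <= [:: (0%N, x)]}.
    by elim: k => [|k IH] // z; rewrite inE => /orP[|/IH //]; rewrite inE.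
  have h : runs (block (nseq k (IAdd x x y))) st1 k.+1 (fun st' =>
     ivar st' x = (ivar st1 x + k * ivar st1 y)%N).
    rewrite -[X in X.+1](size_nseq k (IAdd x x y)); apply: runs_block.
    elim: k st1 {wE} => [|k IH] st1 /=; first by rewrite addn0.
    by rewrite IH /= eqxx yx mulSn addnA.
  apply: (runs_weaken (runs_agree h)) => // st' [h1 ag]; split => //.
  exact: agree_off_sub ag.
have -> : (k + 3 = 2 + k.+1)%N by lia.
apply: (runs_block_seq (l := [:: _])) => /=.
apply: (runs_weaken (add _)) => // st' [h1 ag]; split.
  by rewrite h1 /= eqxx yx.
split=> z zw; [|exact: (agree_rvar ag)|exact: (agree_iarr ag)|exact: (agree_rarr ag)].
rewrite (agree_ivar ag) //=; case: eqP zw => // ->; by rewrite inE eqxx.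
Qed.

Definition ready st : Prop :=
  [/\ consts st, ivar st iN = n, rvar st rPX = p.1 /\ rvar st rPY = p.2,
      rvar st rSig = unit_length del P &
      forall v : 'I_n, (rarr st 0 v, rarr st 1 v) = pos v].

Definition placed st (c : bool * ((nat * nat) * nat)) : Prop :=
  let: (o, ((i, j), u)) := c in
  [/\ rvar st rGA = (halfA P o)%:R, rvar st rGB = (halfB P o)%:R,
      (rvar st rQX, rvar st rQY) = grid_center p del P i j,
      rvar st rT0 = unit_length del P * (scm P * u)%:R &
      rvar st rT1 = unit_length del P * (sck P * u.-1)%:R].

Definition measured st (c : bool * ((nat * nat) * nat)) : Prop :=
  let: (o, ((i, j), u)) := c in
  forall v : 'I_n, rarr st 2 v =
    gauge (halfA P o)%:R (halfB P o)%:R (grid_center p del P i j) (pos v).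

Definition found st (l : seq (bool * ((nat * nat) * nat))) : Prop :=
  ivar st iF = 1%N /\
  exists2 c, c \in l & [/\ passes pos p del P c, placed st c & measured st c].

Lemma runs_try c st : wf_params P -> ready st -> ivar st iF = 0%N ->
  runs (try_prog P c) st (40 * n + 3 * kap P + 60) (fun st' => ready st' /\
    (passes pos p del P c -> found st' [:: c]) /\
    (~~ passes pos p del P c -> ivar st' iF = 0%N)).
Proof.
move=> wfP rd hF.
case: c => o [[i j] u]; set c := (o, _).
have -> : (40 * n + 3 * kap P + 60 = (40 * n + 3 * kap P + 59).+1)%N by lia.
have [cc hN [hx hy] hs hpos] := rd; have [c1 c2 c4 cz] := cc.
apply: runs_if; rewrite /= ?hF ?c1 // => _.
have -> : (40 * n + 3 * kap P + 59 = 24 + (40 * n + 3 * kap P + 35))%N by lia.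
apply: (@runs_block_seq _ (place P c)).
set st1 := foldl _ _ _.
have rd1 : ready st1 by [].
have pl1 : placed st1 c.
  by rewrite /placed /c /st1 /= hx hy hs.
have F1 : ivar st1 iF = 0%N by [].
move: (st1) rd1 pl1 F1 => {hF rd cc hN hx hy hs hpos c1 c2 c4 cz st} {}st1 rd1 pl1 F1.
have [cc hN [hx hy] hs hpos] := rd1.
have [ga gb q t0 t1] := pl1.
have gpos : 0 < rvar st1 rGA /\ 0 < rvar st1 rGB.
  rewrite ga gb; case: wfP => B0 AB _ _ _.
  by rewrite /halfA /halfB; case: (o); rewrite !ltr0n; split => //; lia.
have [ga0 gb0] := gpos.
have -> : (40 * n + 3 * kap P + 35 = (n * 25 + 4) + (15 * n + 3 * kap P + 31))%N by lia.
apply: (runs_seq (runs_gauge cc hN ga0 gb0)) => st2 [g2 ag2].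
have cc2 : consts st2 := agree_consts (w := writes gauge_prog) isT ag2 cc.
have N2 : ivar st2 iN = n by rewrite (agree_ivar ag2 (x := iN) isT).
have -> : (15 * n + 3 * kap P + 31 = (n * 10 + 7) + (5 * n + 3 * kap P + 24))%N by lia.
apply: (runs_seq (runs_count cc2 N2)) => st3 [hI hO ag3].
have M2 : measured st2 c.
  move=> v; rewrite g2 // ga gb q hpos //.
have hI' : ivar st3 iI = #|nodes_within pos P o (grid_center p del P i j)
    (unit_length del P * (scm P * u)%:R)|.
  by rewrite hI (count_arr_card _ M2) (agree_rvar ag2 (x := rT0) isT) t0.
have hO' : ivar st3 iO = #|nodes_within pos P o (grid_center p del P i j)
    (unit_length del P * (sck P * u.-1)%:R)|.
  by rewrite hO (count_arr_card _ M2) (agree_rvar ag2 (x := rT1) isT) t1.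
have -> : (5 * n + 3 * kap P + 24 =
  (kap P + 3) + (((kap P).-1 + 3) + ((kap P + 3) + (kap P - (kap P).-1 + 5 * n + 15))))%N by lia.
apply: (runs_seq (runs_multiple (x := iX) (kap P) (y := iI) st3 isT)) => st4 [h4 ag4].
apply: (runs_seq (runs_multiple (x := iY) (kap P).-1 (y := iN) st4 isT)) => st5 [h5 ag5].
apply: (runs_seq (runs_multiple (x := iW) (kap P) (y := iO) st5 isT)) => st6 [h6 ag6].
pose w := writes gauge_prog ++ writes count_prog ++ [:: (0, iX); (0, iY); (0, iW)]%N.
have ag : agree_off w st1 st6.
  apply: (@agree_off_trans _ _ _ st2); first by apply: agree_off_sub ag2; apply/allP.
  apply: (@agree_off_trans _ _ _ st3); first by apply: agree_off_sub ag3; apply/allP.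
  apply: (@agree_off_trans _ _ _ st4); first by apply: agree_off_sub ag4; apply/allP.
  apply: (@agree_off_trans _ _ _ st5); first by apply: agree_off_sub ag5; apply/allP.
  by apply: agree_off_sub ag6; apply/allP.
have X6 : ivar st6 iX = (kap P * ivar st3 iI)%N.
  by rewrite (agree_ivar ag6 (x := iX) isT) (agree_ivar ag5 (x := iX) isT).
have Y6 : ivar st6 iY = ((kap P).-1 * n)%N.
  rewrite (agree_ivar ag6 (x := iY) isT) h5 (agree_ivar ag4 (x := iN) isT).
  by rewrite (agree_ivar ag3 (x := iN) isT) N2.
have W6 : ivar st6 iW = (kap P * ivar st3 iO)%N.
  by rewrite h6 (agree_ivar ag5 (x := iO) isT) (agree_ivar ag4 (x := iO) isT).
have rd6 : ready st6.
  split.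
  - exact: (agree_consts (w := w)) ag cc.
  - by rewrite (agree_ivar ag (x := iN) isT).
  - by rewrite (agree_rvar ag (x := rPX) isT) (agree_rvar ag (x := rPY) isT).
  - by rewrite (agree_rvar ag (x := rSig) isT).
  - by move=> v; rewrite (agree_rarr ag (a := 0%N) isT) (agree_rarr ag (a := 1%N) isT).
have pl6 : placed st6 c.
  rewrite /placed /c (agree_rvar ag (x := rGA) isT) (agree_rvar ag (x := rGB) isT).
  rewrite (agree_rvar ag (x := rQX) isT) (agree_rvar ag (x := rQY) isT).
  by rewrite (agree_rvar ag (x := rT0) isT) (agree_rvar ag (x := rT1) isT).
have M6 : measured st6 c.
  move=> v; rewrite (agree_rarr ag6 (a := 2%N) isT) (agree_rarr ag5 (a := 2%N) isT).
  by rewrite (agree_rarr ag4 (a := 2%N) isT) (agree_rarr ag3 (a := 2%N) isT) M2.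
have F6 : ivar st6 iF = 0%N by rewrite (agree_ivar ag (x := iF) isT).
have N6 : ivar st6 iN = n by case: rd6.
have pE : passes pos p del P c = (ivar st6 iN <= ivar st6 iX)%N && (ivar st6 iW <= ivar st6 iY)%N.
  by rewrite N6 X6 Y6 W6 hI' hO'.
apply: (@runs_weaken _ _ _ 4); [|lia|by move=> ?; apply].
apply: runs_if => hX; rewrite /= in hX; last first.
  apply: (@runs_weaken _ _ _ 1%N) => //; last by move=> ?; apply.
  apply: (runs_block (l := [::])); split => //.
  by rewrite pE (negbTE hX).
apply: runs_if => hW; rewrite /= in hW; last first.
  apply: (@runs_weaken _ _ _ 1%N) => //; last by move=> ?; apply.
  apply: (runs_block (l := [::])); split => //.
  by rewrite pE (negbTE hW) andbF.
apply: (runs_block (l := [:: _])); split => //.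
split; last by rewrite pE hX hW.
by move=> ps; split => //; exists c => //; rewrite mem_head.
Qed.

Lemma runs_skip_search l st : consts st -> ivar st iF = 1%N ->
  runs (search_prog P l) st (2 * size l + 1) (eq st).
Proof.
move=> [c1 _ _ _] hF; elim: l => [|c l IH].
  exact: (runs_block (l := [::])).
have -> : (2 * size (c :: l) + 1 = 2 + (2 * size l + 1))%N by rewrite [size _]/= mulnS addnA.
apply: (@runs_seq _ _ _ _ _ _ (eq st)); last by move=> _ <-.
apply: runs_if; rewrite /= hF c1 // => _.
exact: (runs_block (l := [::])).
Qed.

Lemma runs_search l st : wf_params P -> ready st -> ivar st iF = 0%N ->
  (exists2 c, c \in l & passes pos p del P c) ->
  runs (search_prog P l) st ((40 * n + 3 * kap P + 60) * size l + 1) (fun st' =>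
    ready st' /\ found st' l).
Proof.
move=> wfP rd hF; elim: l st rd hF => [|c l IH] st rd hF [c' c'l ps] //.
have -> : ((40 * n + 3 * kap P + 60) * size (c :: l) + 1 =
  (40 * n + 3 * kap P + 60) + ((40 * n + 3 * kap P + 60) * size l + 1))%N.
  by rewrite /= mulnS addnA.
apply: (runs_seq (runs_try c wfP rd hF)) => st1 [rd1 [h1 h2]].
case pc : (passes pos p del P c).
  have [F1 [c0 c0l h0]] := h1 pc; have [cc _ _ _ _] := rd1.
  apply: (runs_weaken (runs_skip_search l cc F1)).
    by rewrite leq_add2r leq_mul2r; apply/orP; right; rewrite addnC.
  move=> _ <-; split => //; split => //; exists c0 => //.
  by move: c0l; rewrite !inE => ->.
have F1 := h2 (negbT pc).
have ex : exists2 c, c \in l & passes pos p del P c.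
  exists c' => //; move: c'l; rewrite inE => /orP[/eqP E|//].
  by rewrite -E ps in pc.
apply: (runs_weaken (IH _ rd1 F1 ex)) => // st2 [rd2 [F2 [c0 c0l h0]]].
by split => //; split => //; exists c0 => //; rewrite inE c0l orbT.
Qed.

End SearchProofs.

(** * Bisection and output *)

Notation rLo := 18%N (only parsing).
Notation rHi := 19%N (only parsing).
Notation rMid := 20%N (only parsing).
Notation rLam := 21%N (only parsing).
Notation rSL := 22%N (only parsing).
Notation rSR := 23%N (only parsing).
Notation rTwo := 24%N (only parsing).
Notation rl := 25%N (only parsing).
Notation rh := 26%N (only parsing).
Notation rs := 27%N (only parsing).

Definition edges_prog : prog :=
  Seq (block [:: IConst iJ 0; IAdd iC iM iJ; IAdd iA iM iJ])
   (loop iC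
     (Seq (block [:: ILoad iU 0 iC; ILoad iV 1 iC; RLoad ra 2 iU; RLoad rb 2 iV])
          (If (RLe ra rb) (block [:: RStore 4 iC ra; RStore 5 iC rb])
                          (block [:: RStore 4 iC rb; RStore 5 iC ra])))).

Definition keep_block : prog :=
  block [:: RStore 4 iD ra; RStore 5 iD rb; IAdd iD iD i1].

(** Drops, in place, the pairs that would add equal amounts to both sums of [compare_prog] from now
    on. *)
Definition compact_prog : prog :=
  Seq (block [:: IConst iS 0; IConst iD 0; IAdd iC iA iS])
 (Seq (loop iC
        (Seq (block [:: RLoad ra 4 iS; RLoad rb 5 iS; IAdd iS iS i1])
             (If (RLe ra rLo)
                 (If (RLe rb rLo) (block [::]) (If (RLe rHi rb) (block [::]) keep_block))
                 (If (RLe rHi ra)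
                     (If (RLe rb rLo) (block [::]) (If (RLe rHi rb) (block [::]) keep_block))
                     keep_block))))
      (block [:: ISub iC iC iC; IAdd iA iD iC])).

Definition add_inside (x : nat) : prog :=
  If (RLe x rl) (block [::]) (If (RLe rh x) (block [::]) (block [:: RAdd rs rs rLam])).

(** The overlap is computed for [ra <= rb]; [edges_prog] stores the end levels of each edge in this
    order. *)
Definition potential_prog : prog :=
  Seq (block [:: RAdd rs rZ rZ])
 (Seq (If (RLe ra rl) (block [:: RAdd rc rl rZ]) (block [:: RAdd rc ra rZ]))
 (Seq (If (RLe rb rh) (block [:: RAdd rd rb rZ]) (block [:: RAdd rd rh rZ]))
 (Seq (If (RLe rc rd)
          (block [:: RSub rd rd rc; RSub rc rh rl; RDiv rd rd rc; RAdd rs rs rd])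
          (block [::]))
 (Seq (add_inside ra) (add_inside rb))))).

Definition compare_prog : prog :=
  Seq (block [:: IConst iJ 0; IAdd iC iA iJ; RAdd rSL rZ rZ; RAdd rSR rZ rZ])
   (loop iC
     (Seq (block [:: RLoad ra 4 iC; RLoad rb 5 iC; RAdd rl rLo rZ; RAdd rh rMid rZ])
     (Seq potential_prog
     (Seq (block [:: RAdd rSL rSL rs; RAdd rl rMid rZ; RAdd rh rHi rZ])
     (Seq potential_prog
          (block [:: RAdd rSR rSR rs])))))).

Definition bisect_prog : prog :=
  Seq (block [:: RAdd rMid rLo rHi; RDiv rMid rMid rTwo])
 (Seq compare_prog
 (Seq (If (RLe rSL rSR) (block [:: RAdd rHi rMid rZ]) (block [:: RAdd rLo rMid rZ]))
      compact_prog)).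

(** Goes back to the edge listing and to the levels in real array 2, since no pairs are left after
    the bisection. *)
Definition mark_prog : prog :=
  Seq (block [:: IConst iJ 0; IAdd iC iM iJ])
   (loop iC
     (Seq (block [:: ILoad iU 0 iC; ILoad iV 1 iC; RLoad ra 2 iU; RLoad rb 2 iV])
          (If (RLe ra rLo)
              (If (RLe rb rLo) (block [::]) (block [:: IStore 2 iU i1]))
              (If (RLe rb rLo) (block [:: IStore 2 iV i1]) (block [::]))))).

Section BisectProofs.
Context {R : realType}.
Implicit Types (st : state R).

Definition pairs st (k : nat) : seq (R * R) := arr (fun i => (rarr st 4 i, rarr st 5 i)) k.

Lemma runs_compact (L : seq (R * R)) st : consts st -> pairs st (ivar st iA) = L ->
  runs compact_prog st (14 * size L + 10) (fun st' =>
    pairs st' (ivar st' iA) = seq.filter (active (rvar st rLo) (rvar st rHi)) L /\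
    agree_off (writes compact_prog) st st').
Proof.
move=> cc hL; have [c1 c2 c4 cz] := cc.
have szL : size L = ivar st iA by rewrite -hL size_arr.
pose act := active (rvar st rLo) (rvar st rHi).
pose Inv k st1 := [/\ ivar st1 iC = k /\ ivar st1 i1 = 1%N, (ivar st1 iS + k)%N = size L,
   (ivar st1 iD <= ivar st1 iS)%N /\ pairs st1 (ivar st1 iD) = seq.filter act (take (ivar st1 iS) L),
   forall i, (ivar st1 iS <= i < size L)%N -> (rarr st1 4 i, rarr st1 5 i) = nth (0, 0) L i &
   rvar st1 rLo = rvar st rLo /\ rvar st1 rHi = rvar st rHi].
suff h : runs compact_prog st (14 * size L + 10) (fun st' => 
    pairs st' (ivar st' iA) = seq.filter act L).
  exact: runs_agree h.
have -> : (14 * size L + 10 = 4 + ((size L * 12.+2).+1 + 5))%N by lia.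
apply: (runs_block_seq (l := [:: _; _; _])) => /=.
apply: (@runs_seq _ _ _ _ _ _ (Inv 0%N)).
  apply: (@runs_loop _ _ _ Inv).
  - by move=> k st1 [].
  - move=> k st1 [[h1 h2] h3 [h4 h5] h6 [h7 h8]].
    apply: (@runs_block_seq _ [:: _; _; _] _ _ 8) => /=.
    have Sk : (ivar st1 iS < size L)%N by lia.
    have ab := h6 (ivar st1 iS); rewrite leqnn Sk in ab; have {}ab := ab isT.
    set st2 := set_ivar _ _ _.
    set e := nth (0, 0) L (ivar st1 iS) in ab.
    have tS : take (ivar st1 iS).+1 L = rcons (take (ivar st1 iS) L) e by exact: take_nth.
    have skip : ~~ act e -> Inv k st2.
      move=> na; split => //=; rewrite h2 addn1.
      - by rewrite addSnnS.
      - by rewrite tS filter_rcons (negbTE na); split => //; exact: leqW.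
      - by move=> i /andP[i1' i2']; apply: h6; rewrite i2' ltnW.
    have keep T : act e -> (3 < T)%N -> runs keep_block st2 T (Inv k).
      move=> ae T3; apply: (@runs_weaken _ _ _ 4) => //; last by move=> ?; apply.
      apply: (runs_block (l := [:: _; _; _])); split => //=; rewrite h2 ?addn1.
      - by rewrite addSnnS.
      - split => //; rewrite tS filter_rcons ae /pairs arrS -h5 /= !eqxx.
        rewrite ab; congr rcons; apply: eq_arr => i iD'; case: eqP => // E; by lia.
      - move=> i /andP[i1' i2']; case: eqP => E; first by lia.
        by apply: h6; rewrite i2' ltnW.
    have skip' T : ~~ act e -> (0 < T)%N -> runs (block [::]) st2 T (Inv k).
      move=> na T0; apply: (@runs_weaken _ _ _ 1%N) => //; last by move=> ?; apply.
      by apply: (runs_block (l := [::])); exact: skip.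
    have aE : act e = ((rvar st1 rLo < rarr st1 4 (ivar st1 iS) < rvar st1 rHi) ||
                       (rvar st1 rLo < rarr st1 5 (ivar st1 iS) < rvar st1 rHi)).
      by rewrite h7 h8 /act /active /strictly_inside -ab.
    move: aE skip' keep {skip}; move: (act e) => ae aE skip' keep.
    have second T : ~~ (rvar st1 rLo < rarr st1 4 (ivar st1 iS) < rvar st1 rHi) -> (5 < T)%N ->
      runs (If (RLe rb rLo) (block [::]) (If (RLe rHi rb) (block [::]) keep_block)) st2 T (Inv k).
      move=> n4 T5; rewrite (negbTE n4) /= in aE.
      apply: (@runs_weaken _ _ _ 6) => //; last by move=> ?; apply.
      apply: runs_if => /= hb; first by apply: skip' => //; rewrite aE ltNge hb.
      apply: runs_if => /= hb'; first by apply: skip' => //; rewrite aE [X in _ && X]ltNge hb' andbF.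
      by apply: keep => //; rewrite aE !ltNge hb hb'.
    apply: runs_if => /= ha; first by apply: second => //; rewrite ltNge ha.
    apply: runs_if => /= ha'; first by apply: second => //; rewrite [X in _ && X]ltNge ha' andbF.
    by apply: keep => //; rewrite aE !ltNge ha ha'.
  - split => //=; first by rewrite addn0 szL.
      by rewrite take0 /pairs arr0.
    by move=> i iL'; rewrite -hL /pairs arrE nth_mkseq // -szL.
move=> st1 [[h1 h2] h3 [h4 h5] h6 [h7 h8]].
apply: (@runs_weaken _ _ _ 3) => //; last by move=> ?; apply.
apply: (runs_block (l := [:: _; _])) => /=.
rewrite subnn addn0 /pairs /= -/(pairs _ _) h5; congr (seq.filter _ _).
by rewrite -(addn0 (ivar st1 iS)) h3 take_size.
Qed.

Lemma runs_potential lam st : rvar st rZ = 0 -> rvar st rLam = lam ->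
  rvar st ra <= rvar st rb ->
  runs potential_prog st 22 (fun st' =>
    rvar st' rs = potential lam (rvar st rl) (rvar st rh) (rvar st ra, rvar st rb) /\
    agree_off (writes potential_prog) st st').
Proof.
move=> hz hlam hab.
suff h : runs potential_prog st 22 (fun st' =>
    rvar st' rs = potential lam (rvar st rl) (rvar st rh) (rvar st ra, rvar st rb)).
  exact: runs_agree h.
set a := rvar st ra in hab *; set b := rvar st rb in hab *; set l := rvar st rl; set h := rvar st rh.
pose Pre c d s st1 := [/\ rvar st1 rZ = 0, rvar st1 rLam = lam, rvar st1 ra = a /\ rvar st1 rb = b,
  rvar st1 rl = l /\ rvar st1 rh = h & [/\ rvar st1 rc = c, rvar st1 rd = d & rvar st1 rs = s]].
apply: (@runs_block_seq _ [:: _] _ _ 20) => /=.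
apply: (@runs_seq _ _ _ _ 3 17 (fun st1 => exists d, Pre (Num.max a l) d 0 st1)).
  apply: runs_if => /= hc; apply: (runs_block (l := [:: _])); eexists; split => //=; rewrite hz ?addr0; split=> //.
    by rewrite max_r.
  by rewrite max_l // ltW // ltNge.
move=> st1 [d0 [z1 l1 [a1 b1] [e1 f1] [g1 h1 i1']]].
apply: (@runs_seq _ _ _ _ 3 14 (Pre (Num.max a l) (Num.min b h) 0)).
  apply: runs_if => /=; rewrite b1 f1 => hc; apply: (runs_block (l := [:: _])); split => //=; rewrite z1 ?b1 ?f1 ?addr0; split=> //.
    by rewrite min_l.
  by rewrite min_r // ltW // ltNge.
move=> {z1 l1 a1 b1 e1 f1 g1 h1 i1'} st2 [z1 l1 [a1 b1] [e1 f1] [g1 h1 i1']].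
pose ov := overlap l h a b / (h - l).
have ovE : overlap l h a b = Num.max 0 (Num.min b h - Num.max a l).
  by rewrite /overlap (max_r hab) (min_l hab).
apply: (@runs_seq _ _ _ _ 6 8 (fun st3 => exists c d, Pre c d ov st3)).
  apply: runs_if => /=; rewrite g1 h1 => hc.
    apply: (runs_block (l := [:: _; _; _; _])); do 2 eexists; split => //=; split => //=.
    by rewrite i1' h1 g1 e1 f1 add0r /ov ovE [Num.max 0 _]max_r // subr_ge0.
  apply: (@runs_weaken _ _ _ 1%N) => //; last by move=> ?; apply.
  apply: (runs_block (l := [::])); do 2 eexists; split => //=; split => //=.
  by rewrite i1' /ov ovE [Num.max 0 _]max_l ?mul0r // subr_le0 ltW // ltNge.
move=> {z1 l1 a1 b1 e1 f1 g1 h1 i1'} st3 [c3 [d3 h3]].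
have inside x y s st4 : (x == ra) || (x == rb) -> (exists c d, Pre c d s st4) -> rvar st4 x = y ->
  runs (add_inside x) st4 4 (fun st5 =>
    exists c d, Pre c d (s + lam * (strictly_inside l h y)%:R) st5).
  move=> hx [c [d [z1 l1 [a1 b1] [e1 f1] [g1 h1 i1']]]] hy.
  have skip T : ~~ strictly_inside l h y -> (0 < T)%N ->
    runs (block [::]) st4 T (fun st5 =>
      exists c d, Pre c d (s + lam * (strictly_inside l h y)%:R) st5).
    move=> ni T0; apply: (@runs_weaken _ _ _ 1%N) => //; last by move=> ?; apply.
    by apply: (runs_block (l := [::])); exists c, d; rewrite (negbTE ni) mulr0 addr0.
  apply: runs_if => /=; rewrite hy e1 => hc; first by apply: skip => //; rewrite /strictly_inside ltNge hc.
  apply: runs_if => /=; rewrite hy f1 => hc'.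
    by apply: skip => //; rewrite /strictly_inside [X in _ && X]ltNge hc' andbF.
  apply: (runs_block (l := [:: _])); exists c, d; split => //=; split => //.
  by rewrite i1' l1 /strictly_inside !ltNge hc hc' mulr1.
have [a3 b3] : rvar st3 ra = a /\ rvar st3 rb = b by case: h3.
apply: (runs_seq (T := 4) (T' := 4) (inside ra a ov st3 isT _ a3)); first by exists c3, d3.
move=> st4 h4; have b4 : rvar st4 rb = b by case: h4 => ? [? [_ _ [_ ->]]].
apply: (runs_weaken (inside rb b _ st4 isT h4 b4)) => // st5 [c [d [_ _ _ _ [_ _ ->]]]].
by rewrite /potential /ov /ends_inside /= natrD mulrDr addrA.
Qed.

Lemma runs_compare (L : seq (R * R)) lam st : consts st -> pairs st (ivar st iA) = L ->
  rvar st rLam = lam -> all (fun e => e.1 <= e.2) L ->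
  runs compare_prog st (60 * size L + 10) (fun st' =>
    [/\ rvar st' rSL = \sum_(e <- L) potential lam (rvar st rLo) (rvar st rMid) e,
        rvar st' rSR = \sum_(e <- L) potential lam (rvar st rMid) (rvar st rHi) e &
    agree_off (writes compare_prog) st st']).
Proof.
move=> cc hL hlam srt; have [c1 c2 c4 cz] := cc.
have szL : size L = ivar st iA by rewrite -hL size_arr.
set lo := rvar st rLo; set mid := rvar st rMid; set hi := rvar st rHi.
pose w := [:: (1, ra); (1, rb); (0, iC); (0, iJ); (1, rl); (1, rh); (1, rs); (1, rSL); (1, rSR);
  (1, rc); (1, rd)]%N.
pose Inv k st1 := [/\ ivar st1 iC = k /\ (k <= size L)%N, agree_off w st st1,
   rvar st1 rSL = \sum_(e <- drop k L) potential lam lo mid e &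
   rvar st1 rSR = \sum_(e <- drop k L) potential lam mid hi e].
suff h : runs compare_prog st (60 * size L + 10) (fun st' =>
    rvar st' rSL = \sum_(e <- L) potential lam lo mid e /\
    rvar st' rSR = \sum_(e <- L) potential lam mid hi e).
  by apply: (runs_weaken (runs_agree h)) => // st' [[]].
apply: (@runs_weaken _ _ _ (5 + (size L * 58.+2).+1) _ (Inv 0%N)); [|lia|]; last first.
  by move=> st' [_ _]; rewrite drop0.
apply: (runs_block_seq (l := [:: _; _; _; _])) => /=.
apply: (@runs_loop _ _ _ Inv).
- by move=> k st1 [[h1 _] ag _]; rewrite (agree_ivar ag (x := i1) isT).
- move=> k st1 [[h1 kL] ag h3 h4].
  have dk : drop k L = nth (0, 0) L k :: drop k.+1 L by rewrite -drop_nth.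
  set e := nth (0, 0) L k in dk.
  have eE : (rarr st 4 k, rarr st 5 k) = e.
    by rewrite /e -hL /pairs arrE nth_mkseq // -szL.
  have e12 : e.1 <= e.2 by apply: (allP srt); exact: mem_nth.
  apply: (@runs_block_seq _ [:: _; _; _; _] _ _ 53) => /=.
  set st2 := set_rvar _ _ _.
  have R4 : rarr st1 4 = rarr st 4 by rewrite (agree_rarr ag (a := 4%N) isT).
  have R5 : rarr st1 5 = rarr st 5 by rewrite (agree_rarr ag (a := 5%N) isT).
  have ag2 : agree_off w st st2.
    by do 4 apply: agree_set_rvar => //; exact: agree_set_ivar.
  have z2 : rvar st2 rZ = 0 by rewrite (agree_rvar ag2 (x := rZ) isT).
  have lam2 : rvar st2 rLam = lam by rewrite (agree_rvar ag2 (x := rLam) isT).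
  have z1 : rvar st1 rZ = 0 by rewrite (agree_rvar ag (x := rZ) isT).
  have a2 : rvar st2 ra = e.1 by rewrite /= R4 -eE.
  have b2 : rvar st2 rb = e.2 by rewrite /= R5 -eE.
  have l2 : rvar st2 rl = lo by rewrite /= z1 addr0 (agree_rvar ag (x := rLo) isT).
  have m2 : rvar st2 rh = mid by rewrite /= z1 addr0 (agree_rvar ag (x := rMid) isT).
  have C2 : ivar st2 iC = k by [].
  have SL2 : rvar st2 rSL = rvar st1 rSL by [].
  have SR2 : rvar st2 rSR = rvar st1 rSR by [].
  move: (st2) ag2 z2 lam2 a2 b2 l2 m2 C2 SL2 SR2 => {}st2 ag2 z2 lam2 a2 b2 l2 m2 C2 SL2 SR2.
  have ab2 : rvar st2 ra <= rvar st2 rb by rewrite a2 b2.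
  apply: (runs_seq (T := 22) (T' := 31) (runs_potential z2 lam2 ab2)) => st3 [p3 ag3].
  have ag13 : agree_off w st st3.
    by apply: agree_off_trans ag2 _; apply: agree_off_sub ag3; apply/allP.
  apply: (@runs_block_seq _ [:: _; _; _] _ _ 27) => /=.
  set st4 := set_rvar _ _ _.
  have ag4 : agree_off w st st4.
    by do 3 apply: agree_set_rvar => //.
  have z3 : rvar st3 rZ = 0 by rewrite (agree_rvar ag13 (x := rZ) isT).
  have z4 : rvar st4 rZ = 0 by rewrite (agree_rvar ag4 (x := rZ) isT).
  have lam4 : rvar st4 rLam = lam by rewrite (agree_rvar ag4 (x := rLam) isT).
  have a4 : rvar st4 ra = e.1 by rewrite /= (agree_rvar ag3 (x := ra) isT).
  have b4 : rvar st4 rb = e.2 by rewrite /= (agree_rvar ag3 (x := rb) isT).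
  have l4 : rvar st4 rl = mid by rewrite /= z3 addr0 (agree_rvar ag13 (x := rMid) isT).
  have m4 : rvar st4 rh = hi by rewrite /= z3 addr0 (agree_rvar ag13 (x := rHi) isT).
  have C4 : ivar st4 iC = k by rewrite /= (agree_ivar ag3 (x := iC) isT).
  have SL4 : rvar st4 rSL = rvar st1 rSL + potential lam lo mid e.
    rewrite /= (agree_rvar ag3 (x := rSL) isT) SL2 p3 l2 m2 a2 b2.
    by rewrite -surjective_pairing.
  have SR4 : rvar st4 rSR = rvar st1 rSR by rewrite /= (agree_rvar ag3 (x := rSR) isT).
  move: (st4) ag4 z4 lam4 a4 b4 l4 m4 C4 SL4 SR4 => {}st4 ag4 z4 lam4 a4 b4 l4 m4 C4 SL4 SR4.
  have ab4 : rvar st4 ra <= rvar st4 rb by rewrite a4 b4.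
  apply: (runs_seq (T := 22) (T' := 5) (runs_potential z4 lam4 ab4)) => st5 [p5 ag5].
  have ag15 : agree_off w st st5.
    by apply: agree_off_trans ag4 _; apply: agree_off_sub ag5; apply/allP.
  apply: (@runs_weaken _ _ _ 2) => //; last by move=> ?; apply.
  apply: (runs_block (l := [:: _])); split => /=.
  + by rewrite (agree_ivar ag5 (x := iC) isT) C4; split => //; exact: ltnW.
  + apply: agree_off_trans ag15 _; split=> y yw //=.
    by case: eqP yw => // ->.
  + by rewrite (agree_rvar ag5 (x := rSL) isT) SL4 h3 dk big_cons addrC.
  + rewrite (agree_rvar ag5 (x := rSR) isT) SR4 p5 l4 m4 a4 b4 h4 dk big_cons addrC.
    by rewrite -surjective_pairing.
- split => /=.
  + by rewrite addn0 szL.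
  + by do 2 apply: agree_set_rvar => //; do 2 apply: agree_set_ivar => //.
  + by rewrite drop_size big_nil cz addr0.
  + by rewrite drop_size big_nil cz addr0.
Qed.

End BisectProofs.

(** * The potential argument for the bisection *)

Section BisectLoop.
Context {R : realType}.
Implicit Types (st : state R) (AB : seq (R * R)).

Definition bisecting AB (lam t0 t1 : R) st : Prop :=
  [/\ consts st, rvar st rTwo = 2 /\ rvar st rLam = lam, rvar st rLo < rvar st rHi,
      t0 <= rvar st rLo /\ rvar st rHi <= t1 &
      pairs st (ivar st iA) = seq.filter (active (rvar st rLo) (rvar st rHi)) AB].

Definition total_potential AB lam st : R :=
  \sum_(e <- AB) potential lam (rvar st rLo) (rvar st rHi) e.

Lemma runs_bisect AB lam t0 t1 st : 0 <= lam -> all (fun e => e.1 <= e.2) AB ->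
  bisecting AB lam t0 t1 st ->
  runs bisect_prog st (74 * ivar st iA + 40) (fun st' =>
    bisecting AB lam t0 t1 st' /\
    2 * total_potential AB lam st' <= 2 * total_potential AB lam st - lam * (ivar st iA)%:R).
Proof.
move=> lam0 srt [cc [h2 hlam] lh [lt0 lt1] hp]; have [c1 c2 c4 cz] := cc.
set lo := rvar st rLo in lh lt0 hp *; set hi := rvar st rHi in lh lt1 hp *.
set L := seq.filter _ _ in hp.
have szL : ivar st iA = size L by rewrite -hp size_arr.
rewrite szL.
have srtL : all (fun e => e.1 <= e.2) L by rewrite all_filter; apply: sub_all srt => e /= h; apply/implyP.
pose mid := (lo + hi) / 2.
have lm : lo < mid by rewrite /mid; lra.
have mh : mid < hi by rewrite /mid; lra.
have -> : (74 * size L + 40 = 3 + ((60 * size L + 10) + (3 + (14 * size L + 24))))%N.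
  by move: (size L); clear; lia.
apply: (runs_block_seq (l := [:: _; _])) => /=; rewrite h2 -/lo -/hi -/mid.
set st1 := set_rvar _ _ _.
have cc1 : consts st1 by split.
have hp1 : pairs st1 (ivar st1 iA) = L by [].
have lam1 : rvar st1 rLam = lam by [].
have e1 : [/\ rvar st1 rLo = lo, rvar st1 rMid = mid, rvar st1 rHi = hi & rvar st1 rTwo = 2] by [].
move: (st1) cc1 hp1 lam1 e1 => {}st1 cc1 hp1 lam1 [lo1 mid1 hi1 two1].
apply: (runs_seq (runs_compare cc1 hp1 lam1 srtL)) => st2 [sl sr ag2].
rewrite lo1 mid1 hi1 in sl sr.
have cc2 := agree_consts (w := writes compare_prog) isT ag2 cc1.
have z2 : rvar st2 rZ = 0 by case: cc2.
have hp2 : pairs st2 (ivar st2 iA) = L.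
  rewrite /pairs (agree_ivar ag2 (x := iA) isT) (agree_rarr ag2 (a := 4%N) isT).
  by rewrite (agree_rarr ag2 (a := 5%N) isT).
have lam2 : rvar st2 rLam = lam by rewrite (agree_rvar ag2 (x := rLam) isT).
have two2 : rvar st2 rTwo = 2 by rewrite (agree_rvar ag2 (x := rTwo) isT).
have lo2 : rvar st2 rLo = lo by rewrite (agree_rvar ag2 (x := rLo) isT).
have mid2 : rvar st2 rMid = mid by rewrite (agree_rvar ag2 (x := rMid) isT).
have hi2 : rvar st2 rHi = hi by rewrite (agree_rvar ag2 (x := rHi) isT).
pose SL := \sum_(e <- AB) potential lam lo mid e.
pose SR := \sum_(e <- AB) potential lam mid hi e.
pose S := \sum_(e <- AB) potential lam lo hi e.
have sumE : SL + SR <= 2 * S - lam * (size L)%:R.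
  rewrite /SL /SR /S -big_split /= mulr_sumr.
  have : lam * (size L)%:R <= lam * (\sum_(e <- AB) ends_inside lo hi e)%:R.
    by rewrite ler_wpM2l // ler_nat size_filter active_ends_inside.
  rewrite natr_sum mulr_sumr => h.
  apply: (@le_trans _ _ (\sum_(e <- AB) (2 * potential lam lo hi e - lam * (ends_inside lo hi e)%:R))).
    by apply: ler_sum => e _; exact: potential_halves.
  by rewrite sumrB; lra.
(* The program sums over the active pairs only. Inactive ones contribute equally to both halves, so
   the comparison is that of the full sums, and the better half is at most the average. *)
have diffE : SL - SR = rvar st2 rSL - rvar st2 rSR.
  rewrite sl sr /SL /SR -!sumrB (bigID (active lo hi)) /= [X in _ + X]big1 ?addr0.
    by rewrite big_filter.
  by move=> e na; rewrite (potential_inactive lam lh na (erefl mid)) subrr.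
have keepL lo' hi' : lo <= lo' -> hi' <= hi ->
    seq.filter (active lo' hi') L = seq.filter (active lo' hi') AB.
  move=> h h'; rewrite /L -filter_predI; apply: eq_filter => e /=.
  by case E : (active lo' hi' e) => //=; rewrite (active_sub h h' E).
pose Post st' := [/\ consts st', rvar st' rTwo = 2 /\ rvar st' rLam = lam,
    pairs st' (ivar st' iA) = L &
    exists lo' hi', [/\ rvar st' rLo = lo', rvar st' rHi = hi', lo' < hi', lo <= lo' /\ hi' <= hi &
    2 * (\sum_(e <- AB) potential lam lo' hi' e) <= 2 * S - lam * (size L)%:R]].
apply: (@runs_seq _ _ _ _ 3 _ Post).
  apply: runs_if => /= hle; apply: (runs_block (l := [:: _])) => /=.
    split=> //; exists lo, mid; split=> //=; rewrite ?mid2 ?z2 ?addr0 //.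
      by split=> //; exact: ltW.
    by rewrite -/SL; lra.
  split=> //; exists mid, hi; split=> //=; rewrite ?mid2 ?z2 ?addr0 //.
    by split=> //; exact: ltW.
  by move: hle; rewrite -ltNge -/SR => hle; lra.
move=> st3 [cc3 [two3 lam3] hp3 [lo' [hi' [lo3 hi3 lh' [l' h'] hS]]]].
apply: (runs_weaken (runs_compact cc3 hp3)); first by rewrite leq_add2l.
move=> st4 [hp4 ag4].
have lo4 : rvar st4 rLo = lo' by rewrite (agree_rvar ag4 (x := rLo) isT).
have hi4 : rvar st4 rHi = hi' by rewrite (agree_rvar ag4 (x := rHi) isT).
split; last by rewrite /total_potential lo4 hi4.
split; rewrite ?lo4 ?hi4 //.
- exact: (agree_consts (w := writes compact_prog)) ag4 cc3.
- by rewrite (agree_rvar ag4 (x := rTwo) isT) (agree_rvar ag4 (x := rLam) isT).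
- by split; [exact: le_trans l'|exact: le_trans lt1].
- by rewrite hp4 lo3 hi3 keepL.
Qed.

(* The potential drops by at least [lam / 2] times the number of active pairs,
   while the cost of a round is linear in it. *)
Lemma runs_bisect_loop AB lam t0 t1 (k : nat) st : 0 < lam ->
  all (fun e => e.1 <= e.2) AB -> bisecting AB lam t0 t1 st ->
  2 * total_potential AB lam st <= lam * k%:R ->
  runs (While (ILe i1 iA) bisect_prog) st (120 * k + 1) (fun st' =>
    [/\ bisecting AB lam t0 t1 st', ivar st' iA = 0%N &
        total_potential AB lam st' <= total_potential AB lam st]).
Proof.
move=> lam0 srt; have [m] := ubnP k; elim: m k st => // m IH k st km bs hk.
have [[c1 c2 c4 cz] _ lh _ _] := bs.
have [A0|A1] := posnP (ivar st iA).
  apply: (@runs_weaken _ _ _ 1%N); [|lia|by move=> ?; apply].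
  by apply: runs_while_end => //=; rewrite A0 c1.
set a := ivar st iA in A1.
have pot0 st' : bisecting AB lam t0 t1 st' -> 0 <= total_potential AB lam st'.
  by move=> [_ _ lh' _ _]; apply: sumr_ge0 => e _; apply: potential_ge0 => //; exact: ltW.
(* With more than [k] active pairs, one more round would make the potential negative. *)
case: (leqP a k) => [ak|ka]; last first.
  have := runs_bisect (ltW lam0) srt bs => -[t [st' [_ _ [bs' hS]]]].
  have := pot0 _ bs' => p0; exfalso.
  have : lam * k%:R < lam * a%:R by rewrite ltr_pM2l // ltr_nat.
  rewrite -/a in hS; lra.
apply: (@runs_weaken _ _ _ (74 * a + 40 + (120 * (k - a) + 1)).+1);
  [|lia|by move=> ?; apply].
apply: (runs_while_step _ (runs_bisect (ltW lam0) srt bs)); first by rewrite /= c1.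
move=> st1 [bs1 h1]; rewrite -/a in h1.
have hk1 : 2 * total_potential AB lam st1 <= lam * (k - a)%:R.
  by rewrite natrB // mulrBr; lra.
apply: (runs_weaken (IH _ _ _ bs1 hk1)) => //; first by lia.
move=> st2 [bs2 A2 h2]; split=> //; apply: le_trans h2 _.
have : 0 <= lam * a%:R by rewrite mulr_ge0 // ltW.
by lra.
Qed.

End BisectLoop.

Section EdgeProofs.
Context {R : realType} {n : nat}.
Variables (g : 'I_n -> R) (s : seq ('I_n * 'I_n)).
Implicit Types (st : state R).

Definition edge_input st : Prop :=
  [/\ consts st, ivar st iM = size s,
      forall i, iarr st 0 i = nth 0%N [seq val e.1 | e <- s] i,
      forall i, iarr st 1 i = nth 0%N [seq val e.2 | e <- s] i &
      forall v : 'I_n, rarr st 2 v = g v].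

Definition gauge_pairs : seq (R * R) :=
  [seq (Num.min (g e.1) (g e.2), Num.max (g e.1) (g e.2)) | e <- s].

Lemma gauge_pairs_sorted : all (fun e => e.1 <= e.2) gauge_pairs.
Proof.
rewrite all_map; apply/allP => e _ /=.
by rewrite ge_min !le_max lexx.
Qed.

Lemma runs_edges st : edge_input st ->
  runs edges_prog st (15 * size s + 10) (fun st' =>
    [/\ ivar st' iA = size s, pairs st' (size s) = gauge_pairs &
        agree_off (writes edges_prog) st st']).
Proof.
move=> [cc hM hu hv hg]; have [c1 c2 c4 cz] := cc.
pose w := [:: (0, iC); (0, iJ); (0, iU); (0, iV); (0, iA); (1, ra); (1, rb); (3, 4); (3, 5)]%N.
pose Inv k st1 := [/\ ivar st1 iC = k /\ (k <= size s)%N, agree_off w st st1,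
  ivar st1 iA = size s &
  forall i, (k <= i < size s)%N -> (rarr st1 4 i, rarr st1 5 i) = nth (0, 0) gauge_pairs i].
suff h : runs edges_prog st (15 * size s + 10) (fun st' =>
    ivar st' iA = size s /\ pairs st' (size s) = gauge_pairs).
  by apply: (runs_weaken (runs_agree h)) => // st' [[]].
apply: (@runs_weaken _ _ _ (4 + (size s * 13.+2).+1) _ (Inv 0%N)); [|lia|]; last first.
  move=> st' [_ _ hA h]; split=> //; apply: (@eq_from_nth _ (0, 0)); rewrite size_arr ?size_map //.
  by move=> i im; rewrite /pairs arrE nth_mkseq // h.
apply: (runs_block_seq (l := [:: _; _; _])) => /=.
apply: (@runs_loop _ _ _ Inv).
- by move=> k st1 [[h1 _] ag _ _]; rewrite (agree_ivar ag (x := i1) isT).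
- move=> k st1 [[h1 kL] ag hA h].
  have [e0 _] : exists e0 : 'I_n * 'I_n, True by move: kL; case: (s) => // e0; exists e0.
  set e := nth e0 s k.
  apply: (@runs_block_seq _ [:: _; _; _; _] _ _ 8) => /=.
  have Eu : iarr st1 0 k = val e.1.
    by rewrite (agree_iarr ag (a := 0%N) isT) hu (nth_map e0).
  have Ev : iarr st1 1 k = val e.2.
    by rewrite (agree_iarr ag (a := 1%N) isT) hv (nth_map e0).
  rewrite Eu Ev.
  have gE v : rarr st1 2 (val v) = g v by rewrite (agree_rarr ag (a := 2%N) isT) -hg.
  rewrite !gE; set st2 := set_rvar _ _ _.
  have ag2 : agree_off w st st2.
    by do 2 apply: agree_set_rvar => //; do 3 apply: agree_set_ivar => //.
  have a2 : rvar st2 ra = g e.1 by [].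
  have b2 : rvar st2 rb = g e.2 by [].
  have C2 : ivar st2 iC = k by [].
  have A2 : ivar st2 iA = size s by [].
  have X4 : rarr st2 4 = rarr st1 4 by [].
  have X5 : rarr st2 5 = rarr st1 5 by [].
  move: (st2) ag2 a2 b2 C2 A2 X4 X5 => {}st2 ag2 a2 b2 C2 A2 X4 X5.
  have eE : nth (0, 0) gauge_pairs k = (Num.min (g e.1) (g e.2), Num.max (g e.1) (g e.2)).
    by rewrite (nth_map e0).
  have fin x y : (x, y) = nth (0, 0) gauge_pairs k ->
      Inv k (set_rarr (set_rarr st2 4 k x) 5 k y).
    move=> xy; split=> //=; first by split=> //; exact: ltnW.
      by do 2 apply: agree_set_rarr => //.
    move=> i /andP[ki im]; case: eqP => [->|ik]; first by rewrite xy.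
    by rewrite X4 X5 h //; lia.
  apply: (@runs_weaken _ _ _ 4) => //; last by move=> ?; apply.
  apply: runs_if => /=; rewrite a2 b2 => hle; apply: (runs_block (l := [:: _; _])) => /=;
    rewrite C2 a2 b2; apply: fin; rewrite eE.
    by rewrite (min_l hle) (max_r hle).
  have hlt : g e.2 <= g e.1 by rewrite ltW // ltNge.
  by rewrite (min_r hlt) (max_l hlt).
- split=> //=.
  + by rewrite hM addn0.
  + by do 3 apply: agree_set_ivar => //.
  + by rewrite hM addn0.
  + by move=> i; lia.
Qed.

Lemma runs_mark st : edge_input st -> (forall i, iarr st 2 i = 0%N) ->
  runs mark_prog st (15 * size s + 10) (fun st' =>
    output_set n st' = inner_ends (fun v => g v <= rvar st rLo) s).
Proof.
move=> [cc hM hu hv hg] h0; have [c1 c2 c4 cz] := cc.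
pose I v := g v <= rvar st rLo.
pose w := [:: (0, iC); (0, iJ); (0, iU); (0, iV); (1, ra); (1, rb); (2, 2)]%N.
pose Inv k st1 := [/\ ivar st1 iC = k /\ (k <= size s)%N, agree_off w st st1 &
  forall v : 'I_n, (iarr st1 2 v != 0%N) =
   (v \in [seq (if I e.1 then e.1 else e.2) | e <- drop k s & crossing I e])].
apply: (@runs_weaken _ _ _ (3 + (size s * 13.+2).+1) _ (Inv 0%N)); [|lia|]; last first.
  by move=> st' [_ _]; rewrite drop0 => h; apply/setP => v; rewrite !inE h.
apply: (runs_block_seq (l := [:: _; _])) => /=.
apply: (@runs_loop _ _ _ Inv).
- by move=> k st1 [[h1 _] ag _]; rewrite (agree_ivar ag (x := i1) isT).
- move=> k st1 [[h1 kL] ag h].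
  have [e0 _] : exists e0 : 'I_n * 'I_n, True by move: kL; case: (s) => // e0; exists e0.
  set e := nth e0 s k.
  have dk : drop k s = e :: drop k.+1 s by rewrite -drop_nth.
  apply: (@runs_block_seq _ [:: _; _; _; _] _ _ 8) => /=.
  have Eu : iarr st1 0 k = val e.1.
    by rewrite (agree_iarr ag (a := 0%N) isT) hu (nth_map e0).
  have Ev : iarr st1 1 k = val e.2.
    by rewrite (agree_iarr ag (a := 1%N) isT) hv (nth_map e0).
  rewrite Eu Ev.
  have gE v : rarr st1 2 (val v) = g v by rewrite (agree_rarr ag (a := 2%N) isT) -hg.
  rewrite !gE; set st2 := set_rvar _ _ _.
  have ag2 : agree_off w st st2.
    by do 2 apply: agree_set_rvar => //; do 3 apply: agree_set_ivar => //.
  have a2 : rvar st2 ra = g e.1 by [].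
  have b2 : rvar st2 rb = g e.2 by [].
  have C2 : ivar st2 iC = k by [].
  have U2 : ivar st2 iU = val e.1 by [].
  have V2 : ivar st2 iV = val e.2 by [].
  have X2 : iarr st2 2 = iarr st1 2 by [].
  have o2 : ivar st2 i1 = 1%N by rewrite (agree_ivar ag2 (x := i1) isT).
  have L2 : rvar st2 rLo = rvar st rLo by rewrite (agree_rvar ag2 (x := rLo) isT).
  move: (st2) ag2 a2 b2 C2 U2 V2 X2 o2 L2 => {}st2 ag2 a2 b2 C2 U2 V2 X2 o2 L2.
  have skip : ~~ crossing I e -> runs (block [::]) st2 5 (Inv k).
    move=> nc; apply: (@runs_weaken _ _ _ 1%N) => //; last by move=> ?; apply.
    apply: (runs_block (l := [::])); split=> //=; first by split=> //; exact: ltnW.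
    by move=> v; rewrite X2 h dk /= (negbTE nc).
  have mark x : ivar st2 x = val (if I e.1 then e.1 else e.2) -> crossing I e ->
      runs (block [:: IStore 2 x i1]) st2 5 (Inv k).
    move=> hx cr; apply: (@runs_weaken _ _ _ 2%N) => //; last by move=> ?; apply.
    apply: (runs_block (l := [:: _])); split=> //=; first by split=> //; exact: ltnW.
      apply: agree_off_trans ag2 _; split=> y yw //=.
      by case: eqP yw => // ->.
    move=> v; rewrite hx o2 dk /= cr /= in_cons.
    case: (eqVneq v (if I e.1 then e.1 else e.2)) => [->|ne]; first by rewrite eqxx.
    by rewrite val_eqE (negbTE ne) X2 h.
  apply: (@runs_weaken _ _ _ 7) => //; last by move=> ?; apply.
  apply: runs_if => /=; rewrite a2 L2 -/(I _) => h1'.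
    apply: runs_if => /=; rewrite b2 L2 -/(I _) => h2'.
      by apply: skip; rewrite /crossing h1' h2'.
    by apply: mark; rewrite ?h1' // /crossing h1' (negbTE h2').
  apply: runs_if => /=; rewrite b2 L2 -/(I _) => h2'.
    by apply: mark; rewrite ?(negbTE h1') // /crossing (negbTE h1') h2'.
  by apply: skip; rewrite /crossing (negbTE h1') (negbTE h2').
- split=> //=.
  + by rewrite hM addn0.
  + by do 2 apply: agree_set_ivar => //.
  + by move=> v; rewrite h0 drop_size.
Qed.

End EdgeProofs.

(** * The whole program *)

Definition median_step (fill : prog) (x : nat) : prog :=
  Seq fill (Seq (block [:: IConst iJ 0; IAdd iL iN iJ])
           (Seq median_prog (block [:: RAdd x rV rZ]))).

Definition center_prog : prog :=
  Seq (block [:: IConst i1 1; IConst i2 2; IConst i4 4; ROfInt rTwo i2])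
 (Seq (median_step (copy_prog 0) rPX)
 (Seq (median_step (copy_prog 1) rPY)
 (Seq (block [:: RAdd rQX rPX rZ; RAdd rQY rPY rZ; ROfInt rGA i1; ROfInt rGB i1])
      (median_step gauge_prog rDel)))).

Definition cut_prog (N' : nat) : prog :=
  Seq edges_prog
 (Seq (block [:: RAdd rLo rT0 rZ; RAdd rHi rT1 rZ; IConst iX N'; ROfInt ra iX;
                 IAdd iY iM i1; ROfInt rb iY; RMul ra ra rb; ROfInt rb i1;
                 RDiv rLam rb ra])
 (Seq compact_prog
 (Seq (While (ILe i1 iA) bisect_prog) mark_prog))).

(** If [del] is not positive there is no unit of length; then [n <= 2], and all nodes together form
    the separator. *)
Definition separator_prog (P : params) (N' : nat) : prog :=
  Seq center_prog
   (If (RLe rDel rZ) (fill_prog (block [:: IStore 2 iC i1]))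
     (Seq (block [:: IConst iX (steps P); ROfInt rSig iX; RDiv rSig rDel rSig; IConst iF 0])
     (Seq (search_prog P (candidates P)) (cut_prog N')))).

Section Main.
Context {R : realType} {n : nat}.
Variables (G : geomGraph R n) (s : seq ('I_n * 'I_n)).
Implicit Types (st : state R).

Definition base st : Prop :=
  [/\ consts st, [/\ ivar st iN = n, ivar st iM = size s & rvar st rTwo = 2],
      forall v : 'I_n, (rarr st 0 v, rarr st 1 v) = pos G v,
      (forall i, iarr st 0 i = nth 0%N [seq val e.1 | e <- s] i) /\
      (forall i, iarr st 1 i = nth 0%N [seq val e.2 | e <- s] i) &
      forall i, iarr st 2 i = 0%N].

Definition base_regs : seq (nat * nat) :=
  [:: (0, iN); (0, iM); (0, i1); (0, i2); (0, i4); (1, rZ); (1, rTwo); (3, 0); (3, 1);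
      (2, 0); (2, 1); (2, 2)]%N.

Lemma base_agree w st st' : all (fun z => z \notin w) base_regs ->
  agree_off w st st' -> base st -> base st'.
Proof.
move=> /and5P[hN hM h1 h2 /and5P[h4 hZ hT r0 /and5P[r1 k0 k1 k2 _]]] ag.
move=> [cc [bN bM bT] bp [b0 b1] b2]; split.
- by apply: agree_consts ag cc; rewrite /keeps_consts h1 h2 h4 hZ.
- by rewrite !(agree_ivar ag) // (agree_rvar ag).
- by rewrite !(agree_rarr ag).
- by rewrite !(agree_iarr ag).
- by rewrite !(agree_iarr ag).
Qed.

Definition splits (F : 'I_n -> R) (x : R) : Prop :=
  (2 * n <= 5 * #|[set v | (F v <= x)%R]|)%N /\
  (3 * #|[set v | (F v < x)%R]| <= 2 * n)%N.

Lemma runs_median_step fill x (F : 'I_n -> R) T st : (0 < n)%N -> base st ->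
  all (fun z => z \notin writes fill) base_regs -> x != rZ -> x != rTwo ->
  runs fill st T (fun st' =>
    (forall v : 'I_n, rarr st' 2 v = F v) /\ agree_off (writes fill) st st') ->
  runs (median_step fill x) st (T + (125 * (128 * n)) + 5) (fun st' =>
    [/\ base st', splits F (rvar st' x) & agree_off (writes (median_step fill x)) st st']).
Proof.
move=> n0 bs wf xZ xT hf.
suff h : runs (median_step fill x) st (T + (125 * (128 * n)) + 5) (fun st' =>
    base st' /\ splits F (rvar st' x)).
  by apply: (runs_weaken (runs_agree h)) => // st' [[]].
rewrite -addnA; apply: (runs_seq hf) => st1 [h1 ag1].
have bs1 := base_agree wf ag1 bs.
have [cc1 [bN bM bT] _ _ _] := bs1.
have -> : (125 * (128 * n) + 5 = 3 + (125 * (128 * n) + 2))%N.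
  by move: (125 * (128 * n))%N; clear; lia.
apply: (runs_block_seq (l := [:: _; _])) => /=.
set st2 := set_ivar _ _ _.
have cc2 : consts st2 by case: cc1 => ? ? ? ?; split.
have L2 : ivar st2 iL = n by rewrite /= addn0.
apply: (runs_seq (runs_agree (runs_median cc2 L2 n0))) => st3 [[m1 m2] ag3].
have bs2 : base st2 by case: bs1 => [[? ? ? ?] ? ? ? ?]; split.
have bs3 : base st3 by apply: (base_agree (w := writes median_prog)) ag3 bs2.
apply: (runs_block (l := [:: _])) => /=.
have [[_ _ _ z3] _ _ _ _] := bs3.
split.
  move: bs3 => [[? ? ? ?] [? ? ?] ? ? ?]; split=> //=.
    by split=> //=; rewrite [_ == x]eq_sym (negbTE xZ).
  by split=> //=; rewrite [_ == x]eq_sym (negbTE xT).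
rewrite /splits /= eqxx z3 addr0.
by move: m1 m2; rewrite size_arr !(count_arr_card _ h1).
Qed.

Lemma runs_center st : (0 < n)%N -> ivar st iN = n -> ivar st iM = size s ->
  rvar st rZ = 0 ->
  (forall v : 'I_n, (rarr st 0 v, rarr st 1 v) = pos G v) ->
  (forall i, iarr st 0 i = nth 0%N [seq val e.1 | e <- s] i) ->
  (forall i, iarr st 1 i = nth 0%N [seq val e.2 | e <- s] i) ->
  (forall i, iarr st 2 i = 0%N) ->
  runs center_prog st (3 * (125 * (128 * n)) + 35 * n + 50) (fun st' =>
    [/\ base st', splits (fun v => (pos G v).1) (rvar st' rPX),
        splits (fun v => (pos G v).2) (rvar st' rPY) &
        splits (fun v => gauge 1 1 (rvar st' rPX, rvar st' rPY) (pos G v)) (rvar st' rDel)]).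
Proof.
move=> n0 hN hM hZ hp h0 h1 h2.
set T := (125 * (128 * n))%N.
have -> : (3 * T + 35 * n + 50 = 5 + ((n * 5 + 4 + T + 5) + ((n * 5 + 4 + T + 5) +
   (5 + (n * 25 + 4 + T + 5 + 13)))))%N by move: (T); clear; lia.
apply: (runs_block_seq (l := [:: _; _; _; _])) => /=.
set st1 := set_rvar _ _ _.
have bs1 : base st1 by [].
have cp a st2 (F : 'I_n -> R) : a != 2%N -> base st2 -> (forall v : 'I_n, rarr st2 a v = F v) ->
    runs (copy_prog a) st2 (n * 5 + 4) (fun st' =>
      (forall v : 'I_n, rarr st' 2 v = F v) /\ agree_off (writes (copy_prog a)) st2 st').
  move=> a2 [cc [bN _ _] _ _ _] hF.
  apply: (runs_weaken (runs_copy cc bN a2)) => // st' [hE ag]; split=> // v.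
  rewrite -hF; have := congr1 (fun l => nth 0 l v) hE.
  by rewrite !arrE !nth_mkseq.
have px st2 : base st2 -> forall v : 'I_n, rarr st2 0 v = (pos G v).1.
  by move=> [_ _ h _ _] v; rewrite -h.
have py st2 : base st2 -> forall v : 'I_n, rarr st2 1 v = (pos G v).2.
  by move=> [_ _ h _ _] v; rewrite -h.
apply: (runs_seq (runs_median_step (fill := copy_prog 0) (x := rPX) n0 bs1 isT isT isT (cp 0%N _ _ isT bs1 (px _ bs1)))).
move=> st2 [bs2 sx2 _].
apply: (runs_seq (runs_median_step (fill := copy_prog 1) (x := rPY) n0 bs2 isT isT isT (cp 1%N _ _ isT bs2 (py _ bs2)))).
move=> st3 [bs3 sy3 ag3].
have px3 : rvar st3 rPX = rvar st2 rPX by rewrite (agree_rvar ag3 (x := rPX) isT).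
apply: (runs_block_seq (l := [:: _; _; _; _])) => /=.
set st4 := set_rvar _ _ _.
have [[c1 c2 c4 z3] _ _ _ _] := bs3.
have bs4 : base st4 by case: bs3 => [[? ? ? ?] ? ? ? ?]; split.
have [cc4 [bN4 _ _] hp4 _ _] := bs4.
have ga4 : rvar st4 rGA = 1 by rewrite /= c1.
have gb4 : rvar st4 rGB = 1 by rewrite /= c1.
have qx4 : rvar st4 rQX = rvar st2 rPX by rewrite /= z3 addr0 px3.
have qy4 : rvar st4 rQY = rvar st3 rPY by rewrite /= z3 addr0.
have PX4 : rvar st4 rPX = rvar st2 rPX by rewrite /= px3.
have PY4 : rvar st4 rPY = rvar st3 rPY by [].
move: (st4) bs4 cc4 bN4 hp4 ga4 gb4 qx4 qy4 PX4 PY4 => {}st4 bs4 cc4 bN4 hp4 ga4 gb4 qx4 qy4 PX4 PY4.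
have ga0 : 0 < rvar st4 rGA by rewrite ga4.
have gb0 : 0 < rvar st4 rGB by rewrite gb4.
have fl : runs gauge_prog st4 (n * 25 + 4) (fun st' =>
    (forall v : 'I_n, rarr st' 2 v = gauge 1 1 (rvar st4 rPX, rvar st4 rPY) (pos G v)) /\
    agree_off (writes gauge_prog) st4 st').
  apply: (runs_weaken (runs_gauge cc4 bN4 ga0 gb0)) => // st' [hE ag]; split=> // v.
  by rewrite hE // ga4 gb4 qx4 qy4 PX4 PY4 hp4.
apply: (runs_weaken (runs_median_step (fill := gauge_prog) (x := rDel) n0 bs4 isT isT isT fl)); first by rewrite leq_addr.
move=> st5 [bs5 sd5 ag5].
have PX5 : rvar st5 rPX = rvar st4 rPX by rewrite (agree_rvar ag5 (x := rPX) isT).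
have PY5 : rvar st5 rPY = rvar st4 rPY by rewrite (agree_rvar ag5 (x := rPY) isT).
by rewrite PX5 PY5; split=> //; rewrite ?PX4 ?PY4.
Qed.

(** Two fifths of the nodes would sit at [p] itself, but positions are distinct. *)
Lemma splits_nonpos p del : (0 < n)%N -> splits (fun v => gauge 1 1 p (pos G v)) del ->
  del <= 0 -> (n <= 2)%N.
Proof.
move=> n0 [h _] d0.
have : (#|[set v | (gauge 1 1 p (pos G v) <= del)%R]| <= 1)%N.
  have at_p v : v \in [set v | (gauge 1 1 p (pos G v) <= del)%R] -> pos G v = p.
    rewrite inE => hv; have := le_trans hv d0; rewrite gauge_le // !mul0r !normr_le0 !subr_eq0.
    by move=> /andP[/eqP e1 /eqP e2]; rewrite [LHS]surjective_pairing [RHS]surjective_pairing e1 e2.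
  apply/card_le1_eqP => u v hu hv; apply: (@pos_inj _ _ G).
  by rewrite (at_p _ hu) (at_p _ hv).
lia.
Qed.

Lemma runs_mark_all st : base st ->
  runs (fill_prog (block [:: IStore 2 iC i1])) st (n * 4 + 4) (fun st' =>
    output_set n st' = [set: 'I_n]).
Proof.
move=> [[c1 c2 c4 z] [bN _ _] _ _ b2].
pose Inv k st1 := [/\ ivar st1 iC = k, ivar st1 i1 = 1%N &
  forall i, (k <= i < n)%N -> iarr st1 2 i = 1%N].
apply: (runs_weaken (runs_fill (T := 2) (Inv := Inv) bN _ _ _)) => //.
- by move=> k st1 [].
- move=> k st1 kn [h1 h2 h3]; apply: (runs_block (l := [:: _])); split=> //= i /andP[ki im].
  by case: eqP => [_|ik]; [rewrite h2|apply: h3; lia].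
- by split=> //= i; lia.
- by move=> st' [_ _ h]; apply/setP => v; rewrite !inE h //= ltn_ord.
Qed.

Lemma writes_multiple x k y : {subset writes (multiple_prog x k y) <= [:: (0%N, x)]}.
Proof.
have h : {subset writes (block (nseq k (IAdd x x y))) <= [:: (0%N, x)]}.
  by elim: k => [|k IH] // z; rewrite inE => /orP[|/IH //]; rewrite inE.
have -> : writes (multiple_prog x k y) = (0%N, x) :: writes (block (nseq k (IAdd x x y))) by [].
by move=> z; rewrite in_cons => /orP[/eqP ->|/h //]; rewrite mem_head.
Qed.

Definition search_regs : seq (nat * nat) :=
  writes gauge_prog ++ writes count_prog ++
  [:: (0, iX); (0, iY); (0, iW); (0, iF); (1, rGA); (1, rGB); (1, ra); (1, rb);
      (1, rQX); (1, rQY); (1, rT0); (1, rT1)]%N.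

Lemma writes_search Q l : {subset writes (search_prog Q l) <= search_regs}.
Proof.
elim: l => [|c l IH] // z; rewrite /search_prog /= mem_cat => /orP[|/IH //].
suff /allP h : all (mem search_regs) (writes (try_prog Q c)) by move/h.
have -> : writes (try_prog Q c) = writes (block (place Q c)) ++ writes gauge_prog ++
  writes count_prog ++ writes (multiple_prog iX (kap Q) iI) ++
  writes (multiple_prog iY (kap Q).-1 iN) ++ writes (multiple_prog iW (kap Q) iO) ++
  [:: (0, iF)]%N by [].
have M x k y : (0%N, x) \in search_regs -> all (mem search_regs) (writes (multiple_prog x k y)).
  by move=> hx; apply/allP => w /writes_multiple; rewrite inE => /eqP ->.
have cat2 a (w w' : seq (nat * nat)) : all a w -> all a w' -> all a (w ++ w').
  by rewrite all_cat => -> ->.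
apply: (cat2); first by case: c => o [[i j] u].
apply: (cat2) => //; apply: (cat2) => //.
apply: (cat2); first exact: M.
apply: (cat2); first exact: M.
by apply: (cat2); first exact: M.
Qed.

End Main.

(** * From a range of levels to a separator *)

Section Cut.
Context {R : realType} {n : nat}.
Variables (G : geomGraph R n) (s : seq ('I_n * 'I_n)) (g : 'I_n -> R).
Implicit Types (st : state R).

(** The penalty [lam]. With two end values per edge it adds at most [2 / N'] to the start potential,
    little against [c >= 1]; yet it is large enough that the active pairs of all rounds together
    number at most twice the start potential divided by [lam], which is [N' * (size s).+1] times as
    much. The successor avoids a division by 0 when there are no edges. *)
Definition bisection_weight (N' : nat) : R := 1 / (N'%:R * (size s).+1%:R).

Definition start_potential (N' : nat) (t0 t1 : R) : R :=
  \sum_(e <- gauge_pairs g s) potential (bisection_weight N') t0 t1 e.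

Lemma bisection_weight_gt0 N' : (0 < N')%N -> 0 < bisection_weight N'.
Proof. by move=> N0; rewrite divr_gt0 // mulr_gt0 // ltr0n. Qed.

Lemma count_crossing_potential lam lo hi : 0 <= lam -> lo < hi ->
  all (fun e => ~~ active lo hi e) (gauge_pairs g s) ->
  (count (crossing (fun v => g v <= lo)) s)%:R <=
    \sum_(e <- gauge_pairs g s) potential lam lo hi e.
Proof.
move=> l0 lh /allP na.
rewrite -sum1_count natr_sum big_mkcond /= /gauge_pairs big_map.
rewrite big_seq [leRHS]big_seq; apply: ler_sum => e es.
have := crossing_potential l0 lh (na _ (map_f _ es)).
apply: le_trans; rewrite /crossing /= ge_min ge_max.
by case: (g e.1 <= lo); case: (g e.2 <= lo).
Qed.

Lemma runs_cut (N' K : nat) t0 t1 st : (0 < N')%N -> base G s st ->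
  (forall v : 'I_n, rarr st 2 v = g v) ->
  rvar st rT0 = t0 -> rvar st rT1 = t1 -> t0 < t1 ->
  2 * start_potential N' t0 t1 <= bisection_weight N' * K%:R ->
  runs (cut_prog N') st (50 * size s + 120 * K + 60) (fun st' =>
    exists lo, [/\ t0 <= lo < t1, output_set n st' = inner_ends (fun v => g v <= lo) s &
      #|output_set n st'|%:R <= start_potential N' t0 t1]).
Proof.
move=> N0 bs hg hT0 hT1 t01 hK.
set lam := bisection_weight N' in hK *.
have lam0 : 0 < lam by exact: bisection_weight_gt0.
have ei : edge_input g s st by case: bs => [cc [_ bM _] _ [b0 b1] _]; split.
have -> : (50 * size s + 120 * K + 60 = (15 * size s + 10) + (10 + ((14 * size s + 10) +
  ((120 * K + 1) + (21 * size s + 29)))))%N by move: (size s); clear; lia.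
apply: (runs_seq (runs_edges ei)) => st1 [A1 hp1 ag1].
have bs1 : base G s st1 by apply: base_agree ag1 bs.
have T01 : rvar st1 rT0 = t0 by rewrite (agree_rvar ag1 (x := rT0) isT).
have T11 : rvar st1 rT1 = t1 by rewrite (agree_rvar ag1 (x := rT1) isT).
have hg1 : forall v : 'I_n, rarr st1 2 v = g v.
  by move=> v; rewrite (agree_rarr ag1 (a := 2%N) isT).
apply: (runs_block_seq (l := [:: _; _; _; _; _; _; _; _; _])) => /=.
have [[c1 c2 c4 z1] [bN1 bM1 bT1] _ _ _] := bs1.
set st2 := set_rvar _ _ _.
have bs2 : base G s st2 by case: bs1 => [[? ? ? ?] [? ? ?] ? ? ?]; split.
have hg2 : forall v : 'I_n, rarr st2 2 v = g v by [].
have Lo2 : rvar st2 rLo = t0 by rewrite /= z1 addr0.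
have Hi2 : rvar st2 rHi = t1 by rewrite /= z1 addr0.
have Lam2 : rvar st2 rLam = lam by rewrite /= c1 bM1 addn1.
have hp2 : pairs st2 (ivar st2 iA) = gauge_pairs g s by rewrite /= A1.
have cc2 : consts st2 by case: bs2.
have T2 : rvar st2 rTwo = 2 by case: bs2 => _ [].
move: (st2) bs2 hg2 Lo2 Hi2 Lam2 hp2 cc2 T2 => {}st2 bs2 hg2 Lo2 Hi2 Lam2 hp2 cc2 T2.
have szp : size (gauge_pairs g s) = size s by rewrite size_map.
have hcomp := runs_compact cc2 hp2; rewrite szp in hcomp.
apply: (runs_seq hcomp) => st3 [hp3 ag3].
have bs3 : base G s st3 by apply: base_agree ag3 bs2.
have Lo3 : rvar st3 rLo = t0 by rewrite (agree_rvar ag3 (x := rLo) isT).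
have Hi3 : rvar st3 rHi = t1 by rewrite (agree_rvar ag3 (x := rHi) isT).
have Lam3 : rvar st3 rLam = lam by rewrite (agree_rvar ag3 (x := rLam) isT).
have hg3 : forall v : 'I_n, rarr st3 2 v = g v.
  by move=> v; rewrite (agree_rarr ag3 (a := 2%N) isT).
have bi3 : bisecting (gauge_pairs g s) lam t0 t1 st3.
  case: (bs3) => [cc3 [_ _ T3] _ _ _]; split; rewrite ?Lo3 ?Hi3 //.
  by rewrite hp3 Lo2 Hi2.
have pot3 : total_potential (gauge_pairs g s) lam st3 = start_potential N' t0 t1.
  by rewrite /total_potential Lo3 Hi3.
have hK3 : 2 * total_potential (gauge_pairs g s) lam st3 <= lam * K%:R by rewrite pot3.
apply: (runs_seq (runs_agree (runs_bisect_loop lam0 (gauge_pairs_sorted g s) bi3 hK3))).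
move=> st4 [[bi4 A4 pot4] ag4].
have bs4 : base G s st4 by apply: base_agree ag4 bs3.
have hg4 : forall v : 'I_n, rarr st4 2 v = g v.
  by move=> v; rewrite (agree_rarr ag4 (a := 2%N) isT).
have ei4 : edge_input g s st4 by case: bs4 => [cc [_ bM _] _ [b0 b1] _]; split.
have b24 : forall i, iarr st4 2 i = 0%N by case: bs4.
apply: (runs_weaken (runs_mark ei4 b24)).
  by move: (size s); clear; lia.
move=> st5 out5; have [_ _ lh4 [l4 h4] hp4] := bi4.
exists (rvar st4 rLo); split => //; first by rewrite l4 (lt_le_trans lh4).
rewrite out5; apply: (@le_trans _ _ (total_potential (gauge_pairs g s) lam st4)); last first.
  by apply: le_trans pot4 _; rewrite pot3.
apply: (@le_trans _ _ (count (crossing (fun v => g v <= rvar st4 rLo)) s)%:R).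
  by rewrite ler_nat card_inner_ends.
apply: (count_crossing_potential (ltW lam0) lh4).
rewrite A4 /pairs arr0 in hp4.
apply/allP => e es; apply/negP => ae.
by have : e \in ([::] : seq (R * R)) by rewrite hp4 mem_filter ae.
Qed.

End Cut.

Section Size.
Context {R : realType} {n : nat}.
Variables (G : geomGraph R n) (s : seq ('I_n * 'I_n)).

(** The first term is [packed_overlap] averaged over the range of levels, the second the whole
    penalty. *)
Lemma start_potential_le c A B mu q (t0 t1 : R) N' : packed c G -> edge_listing G s ->
  0 < mu -> mu <= A -> mu <= B -> 0 < t1 -> t0 < t1 -> (0 < N')%N ->
  start_potential s (fun v => gauge A B q (pos G v)) N' t0 t1 <=
  c * (t1 * Num.sqrt (A ^+ 2 + B ^+ 2)) / (mu * (t1 - t0)) + 2 / N'%:R.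
Proof.
move=> pk el mu0 muA muB t10 t01 N0.
set g := fun v => _.
rewrite /start_potential /potential big_split /=; apply: lerD.
  rewrite -mulr_suml invfM [leRHS]mulrA ler_pM2r ?invr_gt0 ?subr_gt0 //.
  rewrite ler_pdivlMr // mulrC.
  apply: le_trans (packed_overlap q t0 pk el mu0 muA muB t10).
  rewrite ler_pM2l // /gauge_pairs big_map; apply: ler_sum => e _ /=.
  rewrite /overlap /g.
  set x := gauge _ _ _ _; set y := gauge _ _ _ _.
  have minmax (a b : R) : Num.min a b <= Num.max a b by rewrite ge_min !le_max lexx.
  by rewrite (max_r (minmax x y)) (min_l (minmax x y)).
rewrite -mulr_sumr -natr_sum.
have hs : (\sum_(e <- gauge_pairs g s) ends_inside t0 t1 e <= 2 * size s)%N.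
  rewrite /gauge_pairs big_map; elim: (s) => [|e l IH]; first by rewrite big_nil.
  rewrite big_cons [size _]/= mulnS leq_add // /ends_inside.
  by do 2 case: strictly_inside.
have w0 := bisection_weight_gt0 s N0 (R := R).
apply: (@le_trans _ _ (bisection_weight s N' * (2 * size s)%:R)).
  by rewrite ler_pM2l // ler_nat.
rewrite /bisection_weight div1r invfM natrM.
have N0' : 0 < N'%:R :> R by rewrite ltr0n.
have m0 : 0 < (size s).+1%:R :> R by rewrite ltr0n.
have hm : (size s).+1%:R^-1 * (size s)%:R <= 1 :> R.
  by rewrite mulrC ler_pdivrMr // mul1r ler_nat leqnSn.
have -> : N'%:R^-1 * (size s).+1%:R^-1 * (2 * (size s)%:R) =
    2 / N'%:R * ((size s).+1%:R^-1 * (size s)%:R) :> R by ring.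
by rewrite ler_piMr // divr_ge0 // ltW.
Qed.

End Size.

Lemma candidates_ge P c : c \in candidates P -> (u0 P <= c.2.2)%N.
Proof.
case/allpairsP => -[ o x] [_ hx ->]; case/allpairsP: hx => -[ij u] [_ hu ->].
by move: hu; rewrite mem_iota => /andP[].
Qed.

(** * Size and running time for arbitrary parameters *)

Section Generic.
Context {R : realType}.
Variables (P : params) (N' : nat) (alpha Kb : R) (bound : R -> R).

(** What [start_potential_le] leaves to check once the unit of length has cancelled. One condition
    serves both orientations, which only exchange the two sides under the root. *)
Definition size_hyp : Prop := forall (u : nat) (c : R), (u0 P <= u)%N -> 1 <= c ->
  c * ((sck P * u.-1)%:R * Num.sqrt ((sideA P)%:R ^+ 2 + (sideB P)%:R ^+ 2)) /
    ((sideB P)%:R * ((sck P * u.-1)%:R - (scm P * u)%:R)) + 2 / N'%:R <= bound c.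

Hypothesis Pwf : wf_params P.
Hypothesis Pcov : coverable R P.
Hypothesis N0 : (0 < N')%N.
Hypothesis alphaE : alpha * (kap P)%:R = (kap P).-1%:R.
Hypothesis bound2 : forall c : R, 1 <= c -> 2 <= bound c.
Hypothesis boundK : forall c : R, 1 <= c -> bound c <= Kb * c.
Hypothesis levels : forall u : nat, (u0 P <= u)%N -> (scm P * u < sck P * u.-1)%N.
Hypothesis sizes : size_hyp.

Section Run.
Variables (n : nat) (G : geomGraph R n) (s : seq ('I_n * 'I_n)) (c : R) (K : nat).
Hypothesis n0 : (0 < n)%N.
Hypothesis c1 : 1 <= c.
Hypothesis pk : packed c G.
Hypothesis el : edge_listing G s.
Hypothesis hK : 2 * bound c <= bisection_weight s N' * K%:R.

Let good (st : state R) : Prop := balanced_separator alpha G (output_set n st) /\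
  #|output_set n st|%:R <= bound c.

(** The nodes up to the level [lo] include the inner rectangle and are included in the outer one:
    the outer count bounds the inside of the cut, the inner count its outside. *)
Lemma cut_balanced p del z lo : z \in candidates P -> 0 < del ->
  passes (pos G) p del P z ->
  let: (o, ((i, j), u)) := z in
  let g := fun v => gauge (halfA P o)%:R (halfB P o)%:R (grid_center p del P i j) (pos G v) in
  unit_length del P * (scm P * u)%:R <= lo < unit_length del P * (sck P * u.-1)%:R ->
  balanced_separator alpha G (inner_ends (fun v => g v <= lo) s).
Proof.
case: z => o [[i j] u] hz d0; rewrite /passes /= => /andP[p1 p2] /andP[h1 h2].
pose g v := gauge (halfA P o)%:R (halfB P o)%:R (grid_center p del P i j) (pos G v).
have kN : (0 < kap P)%N by case: Pwf => _ _ _ _ [k3 _]; exact: ltn_trans k3.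
have k0 : 0 < (kap P)%:R :> R by rewrite ltr0n.
have cut (m : nat) : (kap P * m <= (kap P).-1 * n)%N -> m%:R <= alpha * n%:R.
  rewrite -(ler_nat R) !natrM -alphaE => h.
  by rewrite -(ler_pM2l k0) mulrA [_ * alpha]mulrC.
apply: inner_ends_balanced el _ _; apply: cut.
  apply: leq_trans p2; rewrite leq_mul2l; apply/orP; right.
  apply: subset_leq_card; apply/fintype.subsetP => v; rewrite !inE => hv.
  exact: le_trans hv (ltW h2).
have hc := cardsC [set v | g v <= lo]; rewrite card_ord in hc.
have cE : #|[set v | ~~ (g v <= lo)]| = #|~: [set v | g v <= lo]|.
  by congr #|pred_of_set _|; apply/setP => v; rewrite !inE.
have sub : (#|nodes_within (pos G) P o (grid_center p del P i j)
      (unit_length del P * (scm P * u)%:R)| <= #|[set v | (g v <= lo)%R]|)%N.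
  apply: subset_leq_card; apply/fintype.subsetP => v; rewrite !inE => hv.
  exact: le_trans hv h1.
have h3 : (n <= kap P * #|[set v | (g v <= lo)%R]|)%N.
  by apply: leq_trans p1 _; rewrite leq_mul2l sub orbT.
rewrite cE; move: h3 hc; set x := #|_|; set y := #|_|.
have [k kP] : exists k, kap P = k.+1 by exists (kap P).-1; rewrite prednK.
rewrite kP /= => h3 hc; rewrite -(leq_add2l (k.+1 * x)) -mulnDr hc mulSn leq_add2r.
by [].
Qed.

Lemma start_potential_bound (del : R) o u q : 0 < del -> (u0 P <= u)%N ->
  start_potential s (fun v => gauge (halfA P o)%:R (halfB P o)%:R q (pos G v)) N'
    (unit_length del P * (scm P * u)%:R) (unit_length del P * (sck P * u.-1)%:R) <= bound c.
Proof.
move=> d0 hu; set sg := unit_length del P.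
have s0 : 0 < sg := unit_length_gt0 Pwf d0.
have lv := levels hu.
have lvR : (scm P * u)%:R < (sck P * u.-1)%:R :> R by rewrite ltr_nat.
have k0 : 0 < (sck P * u.-1)%:R :> R by rewrite ltr0n (leq_ltn_trans _ lv).
case: Pwf => B0 AB _ _ _.
have B0' : 0 < (sideB P)%:R :> R by rewrite ltr0n.
have BA : (sideB P)%:R <= (halfA P o)%:R :> R by rewrite ler_nat /halfA; case: (o).
have BB : (sideB P)%:R <= (halfB P o)%:R :> R by rewrite ler_nat /halfB; case: (o).
have t1 : 0 < sg * (sck P * u.-1)%:R by rewrite mulr_gt0.
have t01 : sg * (scm P * u)%:R < sg * (sck P * u.-1)%:R by rewrite ltr_pM2l.
apply: le_trans (start_potential_le q pk el B0' BA BB t1 t01 N0) _.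
apply: le_trans (sizes hu c1); rewrite lerD2r le_eqVlt; apply/orP; left; apply/eqP.
have -> : (halfA P o)%:R ^+ 2 + (halfB P o)%:R ^+ 2 =
    (sideA P)%:R ^+ 2 + (sideB P)%:R ^+ 2 :> R.
  by rewrite /halfA /halfB; case: (o) => //; rewrite addrC.
field; rewrite -!natrM -mulrBr mulf_neq0 ?(gt_eqF s0) ?gt_eqF ?subr_gt0 //.
Qed.

Lemma runs_separator : runs (separator_prog P N') (input_state G s)
  (3 * (125 * (128 * n)) + 35 * n + 50 + (4 * n + (4 + (5 +
    ((40 * n + 3 * kap P + 60) * size (candidates P) + 1 +
     (50 * size s + 120 * K + 60))))).+1) good.
Proof.
have hp v : (rarr (input_state G s) 0 (nat_of_ord v), rarr (input_state G s) 1 (nat_of_ord v)) = pos G v.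
  by rewrite /= valK -surjective_pairing.
apply: (runs_seq (runs_center (st := input_state G s) n0 erefl erefl erefl hp (fun=> erefl) (fun=> erefl) (fun=> erefl))).
move=> st1 [bs1 sx sy sd].
apply: runs_if => hdel.
  apply: (runs_weaken (runs_mark_all bs1)); first by lia.
  move=> st2 hout; have [[_ _ _ z1] _ _ _ _] := bs1.
  rewrite /= z1 in hdel; have n2 := splits_nonpos n0 sd hdel.
  rewrite /good hout; split; first by move=> v; rewrite inE.
  by rewrite cardsT card_ord; apply: le_trans (bound2 c1); rewrite ler_nat.
have [cc1 [bN1 bM1 bT1] hp1 _ _] := bs1; have [_ _ _ z1] := cc1.
rewrite /= z1 -ltNge in hdel.
set p := (rvar st1 rPX, rvar st1 rPY) in sd; set del := rvar st1 rDel in sd hdel.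
apply: (@runs_weaken _ _ _ (5 + ((40 * n + 3 * kap P + 60) * size (candidates P) + 1 +
     (50 * size s + 120 * K + 60)))); [|exact: leq_trans (leq_addl 4 _) (leq_addl _ _)|by move=> ?; apply].
apply: (runs_block_seq (l := [:: _; _; _; _])) => /=.
set st2 := set_ivar _ _ _.
have bs2 : base G s st2 by case: bs1 => [[? ? ? ?] [? ? ?] ? ? ?]; split.
have rd2 : ready (pos G) p del P st2.
  by case: bs2 => [cc2 [bN2 _ _] hp2 _ _]; split.
have F2 : ivar st2 iF = 0%N by [].
have [sx1 sx2] := sx; have [sy1 sy2] := sy; have [sd1 sd2] := sd.
have ex := @exists_passing R n (pos G) p del P Pwf Pcov hdel sx1 sx2 sy1 sy2 sd1 sd2.
apply: (runs_seq (runs_agree (runs_search Pwf rd2 F2 ex))).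
move=> st3 [[rd3 [_ [z hz [ps pl ms]]]] ag3].
have bs3 : base G s st3.
  apply: (base_agree (w := search_regs)) bs2 => //.
  by apply: agree_off_sub ag3; exact: writes_search.
have cb lo := @cut_balanced p del z lo hz hdel ps.
have uz := candidates_ge hz.
case: z hz ps pl ms cb uz => o [[i j] u] hz ps [_ _ _ h0 h1] ms cb uz.
have s0 : 0 < unit_length del P := unit_length_gt0 Pwf hdel.
have t01 : unit_length del P * (scm P * u)%:R < unit_length del P * (sck P * u.-1)%:R.
  by rewrite ltr_pM2l // ltr_nat levels.
have pb := start_potential_bound o (grid_center p del P i j) hdel uz.
have hK' := le_trans (ler_wpM2l (ler0n R 2) pb) hK.
apply: (runs_weaken (runs_cut N0 bs3 ms h0 h1 t01 hK')) => // st4 [lo [hlo hout hcard]].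
split; last exact: le_trans hcard pb.
by rewrite hout; exact: cb.
Qed.

End Run.

(** Only [K] is quadratic in [c]: it is [2 * bound c * N' * (size s).+1] up to rounding, where
    [bound c] is O(c) and the edges are O(c * n) in number. The other costs are linear in [n] and
    the number of edges. *)
Lemma separator_of_params :
  separator_computable alpha bound (fun c n => c ^+ 2 * n%:R).
Proof.
have [q qE] : exists q, q = (3 * (125 * 128))%N by eexists.
pose C := (q + 39 + 171 + (100 + 3 * kap P) * size (candidates P))%N.
exists (separator_prog P N'), (C%:R + 120 * (4 * `|Kb| * N'%:R + 1)).
move=> n G s c n0 c1 pk el.
have nR : 1 <= n%:R :> R by rewrite ler1n.
have N0R : 0 < N'%:R :> R by rewrite ltr0n.
set X := c ^+ 2 * n%:R.
have cX : c * n%:R <= X by rewrite /X expr2 ler_wpM2r // ler_peMl //; lra.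
have nc : n%:R <= c * n%:R by rewrite ler_peMl.
have mc : (size s)%:R <= c * n%:R by apply: packed_size pk el _; lra.
have w0 : 0 < bisection_weight s N' :> R by exact: bisection_weight_gt0.
pose y := 2 * bound c / bisection_weight s N'.
have y0 : 0 <= y.
  by rewrite divr_ge0 ?(ltW w0) // mulr_ge0 // (le_trans _ (bound2 c1)).
pose K := (Num.truncn y).+1.
have [Ky1 Ky2] : K%:R <= y + 1 /\ y <= K%:R.
  have /andP[h1 h2] := truncn_itv y0.
  by rewrite /K -natr1 lerD2r h1 natr1 ltW.
have hK : 2 * bound c <= bisection_weight s N' * K%:R.
  by rewrite [leRHS]mulrC -ler_pdivrMr.
have [t [st [ex tT [g1 g2]]]] := runs_separator n0 c1 pk el hK.
exists t, st; split => //.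
have yX : y <= 4 * `|Kb| * N'%:R * X.
  have -> : y = 2 * bound c * (N'%:R * (size s).+1%:R).
    by rewrite /y /bisection_weight div1r invrK.
  have b1 : bound c <= `|Kb| * c.
    apply: le_trans (boundK c1) _; rewrite ler_wpM2r //; [lra|exact: ler_norm].
  have b2 : (size s).+1%:R <= 2 * (c * n%:R) by rewrite -natr1; lra.
  have -> : 4 * `|Kb| * N'%:R * X = 2 * (`|Kb| * c) * (N'%:R * (2 * (c * n%:R))).
    by rewrite /X; ring.
  apply: ler_pM.
  - by rewrite mulr_ge0 // (le_trans _ (bound2 c1)).
  - by rewrite mulr_ge0.
  - by rewrite ler_pM2l.
  - by rewrite ler_pM2l.
have K1 : K%:R <= (4 * `|Kb| * N'%:R + 1) * X by rewrite mulrDl mul1r; lra.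
apply: (@le_trans _ _ (C%:R * X + 120 * K%:R)); last first.
  by rewrite -/X [leRHS]mulrDl lerD2l -[leRHS]mulrA ler_pM2l.
have tN : (t <= (q + 39 + 121 + (100 + 3 * kap P) * size (candidates P)) * n +
    50 * size s + 120 * K)%N.
  apply: leq_trans tT _.
  have -> : (3 * (125 * (128 * n)) = q * n)%N by rewrite qE !mulnA.
  have hZ : ((40 * n + 3 * kap P + 60) * size (candidates P) <=
     (100 + 3 * kap P) * size (candidates P) * n)%N.
    rewrite mulnAC leq_mul2r; apply/orP; right.
    have : (3 * kap P <= 3 * kap P * n)%N by rewrite leq_pmulr.
    by rewrite mulnDl; move: n0 (3 * kap P)%N; clear; lia.
  move: hZ n0.
  rewrite [((q + 39 + 121 + _) * n)%N]mulnDl [((q + 39 + 121) * n)%N]mulnDl [((q + 39) * n)%N]mulnDl.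
  set z1 := ((_ + _ + _) * size _)%N; set z2 := (_ * size _ * n)%N.
  move: z1 z2 (q * n)%N (size s); clear; lia.
have : t%:R <= ((q + 39 + 121 + (100 + 3 * kap P) * size (candidates P))%:R * n%:R +
    50 * (size s)%:R + 120 * K%:R) :> R.
  by rewrite -!natrM -!natrD ler_nat.
set a := (q + 39 + 121 + _)%N => ht.
have CE : C%:R = a%:R + 50 :> R by rewrite -natrD; congr _%:R; rewrite /C /a; move: (_ * size _)%N; clear; lia.
have aX : a%:R * n%:R <= a%:R * X by rewrite ler_wpM2l //; lra.
rewrite CE mulrDl; lra.
Qed.

End Generic.

(** * The two separators *)

Definition square_params (u : nat) : params := Params 1 1 1 2 5 u.

(* Two 12 x 17 rectangles cover a 24 x 17 rectangle; 17 / 12 approximates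
   [sqrt 2], for which the smaller and the larger rectangle would be similar. *)
Definition rectangle_params (u : nat) : params := Params 17 12 17 24 3 u.

Section Instances.
Context {R : realType}.

Lemma square_coverable u : coverable R (square_params u).
Proof.
move=> o; exists [:: (false, (1, 1)); (false, (1, -1)); (false, (-1, 1)); (false, (-1, -1))]%R.
have hA : forall b, halfA (square_params u) b = 1%N by case.
have hB : forall b, halfB (square_params u) b = 1%N by case.
split => //.
  move=> z; rewrite !inE => /or4P[] /eqP -> /=;
    by rewrite ?rmorphN1 ?normrN ?normr1 // muln1.
move=> x y; rewrite hA hB /= !muln1 => hx hy.
have side (t : R) : `|t| <= 2%:R -> `|t - 1| <= 1 \/ `|t + 1| <= 1.
  rewrite !ler_norml => /andP[h1 h2]; case: (leP 0 t) => t0; [left|right]; lra.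
case: (side _ hx) => h1; case: (side _ hy) => h2.
- by exists (false, (1, 1)) => //=; rewrite ?hA ?hB.
- by exists (false, (1, -1)) => //=; rewrite ?hA ?hB rmorphN1 opprK.
- by exists (false, (-1, 1)) => //=; rewrite ?hA ?hB rmorphN1 opprK.
- by exists (false, (-1, -1)) => //=; rewrite ?hA ?hB !rmorphN1 !opprK.
Qed.

(** The long outer half-side [24 * 17 = 408] is twice the short inner one, [17 * 12 = 204], whence
    the offsets; the short outer half-side [24 * 12 = 288] just fits into the long inner one,
    [17 * 17 = 289]. *)
Lemma rectangle_coverable u : coverable R (rectangle_params u).
Proof.
have side (t : R) : `|t| <= (24 * 17)%:R ->
    `|t - 204%:Z%:~R| <= (17 * 12)%:R \/ `|t - (- 204%:Z)%:~R| <= (17 * 12)%:R.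
  rewrite rmorphN /= -!pmulrn !ler_norml => /andP[h1 h2].
  by case: (leP 0 t) => t0; [left|right]; lra.
have other (t : R) : `|t| <= (24 * 12)%:R -> `|t - 0%:~R| <= (17 * 17)%:R.
  by rewrite subr0 !ler_norml => /andP[h1 h2]; lra.
have b0 : `|0%:~R| <= (17 * 17)%:R :> R by rewrite normr0 ler0n.
have b1 : `|204%:Z%:~R| <= (17 * 17)%:R :> R by rewrite -pmulrn normr_nat ler_nat.
have b2 : `|(- 204%:Z)%:~R| <= (17 * 17)%:R :> R by rewrite rmorphN normrN.
case.
  exists [:: (false, (0, 204%:Z)); (false, (0, - 204%:Z))].
  split => //; first by move=> z; rewrite !inE => /orP[] /eqP ->.
  move=> x y hx hy; case: (side _ hy) => h.
    by exists (false, (0, 204%:Z)); [rewrite !inE eqxx|split => //; exact: other].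
  by exists (false, (0, - 204%:Z)); [rewrite !inE eqxx orbT|split => //; exact: other].
exists [:: (true, (204%:Z, 0)); (true, (- 204%:Z, 0))].
split => //; first by move=> z; rewrite !inE => /orP[] /eqP ->.
move=> x y hx hy; case: (side _ hx) => h.
  by exists (true, (204%:Z, 0)); [rewrite !inE eqxx|split => //; exact: other].
by exists (true, (- 204%:Z, 0)); [rewrite !inE eqxx orbT|split => //; exact: other].
Qed.

Lemma sqrt2_ge1 : 1 <= Num.sqrt 2 :> R.
Proof. by rewrite -[leLHS]sqrtr1 ler_sqrt // ler1n. Qed.

(** One number [w >= 2 / eps] serves twice: sizes [u >= w + 2] keep the factor
    [2 * (u - 1) / (u - 2) = 2 + 2 / (u - 2)] below [2 + eps], and the penalty is [2 / w <= eps]. As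
    [c * sqrt 2 >= 1], both losses fit into [2 * sqrt 2 * (1 + eps) * c], and
    [1 + eps <= 1 / (1 - eps)]. *)
Lemma square_separator (eps : R) : 0 < eps < 1 ->
  separator_computable (4 / 5 : R) (fun c => 2 * Num.sqrt 2 / (1 - eps) * c)
    (fun c n => c ^+ 2 * n%:R).
Proof.
move=> /andP[e0 e1]; have s1 := sqrt2_ge1.
pose w := (Num.truncn (2 / eps)).+1.
have w0 : 0 < w%:R :> R by rewrite ltr0n.
have hw : 2 / eps <= w%:R.
  have /andP[_ h] : (Num.truncn (2 / eps))%:R <= 2 / eps < w%:R.
    by apply: truncn_itv; rewrite divr_ge0 // ltW.
  exact: ltW.
have hwe : 2 / w%:R <= eps by rewrite ler_pdivrMr // mulrC -ler_pdivrMr.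
have e1' : 0 < 1 - eps by lra.
have q0 : 0 <= 2 * Num.sqrt 2 :> R by lra.
have b0 : 2 * Num.sqrt 2 * (1 + eps) <= 2 * Num.sqrt 2 / (1 - eps).
  rewrite ler_pdivlMr // -[leLHS]mulrA ler_piMr //.
  by have := sqr_ge0 eps; lra.
apply: (@separator_of_params _ (square_params w.+2) w _ (2 * Num.sqrt 2 / (1 - eps))).
- by split.
- exact: square_coverable.
- by [].
- by rewrite divfK // pnatr_eq0.
- move=> c c1; apply: (@le_trans _ _ (2 * Num.sqrt 2 * (1 + eps) * c)).
    have : 1 * 1 <= Num.sqrt 2 * c by apply: ler_pM.
    have : 0 <= Num.sqrt 2 * c * eps by rewrite !mulr_ge0 //; lra.
    nra.
  by rewrite ler_wpM2r //; lra.
- by [].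
- by move=> u; rewrite /=; lia.
- move=> u c /= hu c1.
  have uR : u.-1%:R = u%:R - 1 :> R by rewrite -subn1 natrB //; lia.
  have hu' : w%:R <= u%:R - 2 :> R by rewrite -natrB ?ler_nat //; lia.
  rewrite !natrM uR !mul1r expr1n.
  have -> : (1 + 1 : R) = 2 by [].
  set q := Num.sqrt 2 in s1 b0 *.
  have hq : 2 * (u%:R - 1) / (2 * (u%:R - 1) - u%:R) <= 2 + eps.
    have d0 : 0 < 2 * (u%:R - 1) - u%:R :> R by lra.
    rewrite ler_pdivrMr //.
    have : 2 <= eps * w%:R by rewrite mulrC -ler_pdivrMr.
    have : eps * w%:R <= eps * (u%:R - 2) by rewrite ler_pM2l.
    lra.
  apply: (@le_trans _ _ (2 * q * (1 + eps) * c)); last by rewrite ler_wpM2r //; lra.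
  have -> : c * (2 * (u%:R - 1) * q) / (2 * (u%:R - 1) - u%:R) =
     c * q * (2 * (u%:R - 1) / (2 * (u%:R - 1) - u%:R)) by ring.
  have cq : 1 * 1 <= c * q by apply: ler_pM.
  have : c * q * (2 * (u%:R - 1) / (2 * (u%:R - 1) - u%:R)) <= c * q * (2 + eps).
    by rewrite ler_wpM2l //; lra.
  have : eps <= c * q * eps by rewrite ler_peMl //; lra.
  lra.
Qed.

(** For large sizes the factor of [c] tends to [24 / 7 * sqrt 433 / 12 < 5.946]. From [u = 500] on
    it is below [5.976], and the penalty [2 / 100] fits into the remaining [0.024]. *)
Lemma rectangle_separator :
  separator_computable (2 / 3 : R) (fun c => 6 * c) (fun c n => c ^+ 2 * n%:R).
Proof.
apply: (@separator_of_params _ (rectangle_params 500) 100 _ 6).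
- by split.
- exact: rectangle_coverable.
- by [].
- by rewrite divfK // pnatr_eq0.
- by move=> c c1; lra.
- by [].
- by move=> u; rewrite /=; lia.
- move=> u c /= hu c1.
  have uR : u.-1%:R = u%:R - 1 :> R by rewrite -subn1 natrB //; lia.
  have hu' : 500%:R <= u%:R :> R by rewrite ler_nat.
  rewrite !natrM uR.
  set q := Num.sqrt _.
  have hq : q <= 2081 / 100.
    rewrite /q -[leRHS]ger0_norm; last by lra.
    by rewrite -sqrtr_sqr ler_sqrt ?sqr_ge0 //; lra.
  have q0 : 0 <= q by exact: sqrtr_ge0.
  have d0 : 0 < 24%:R * (u%:R - 1) - 17%:R * u%:R :> R by lra.
  pose r : R := 24%:R * (u%:R - 1) / (24%:R * (u%:R - 1) - 17%:R * u%:R).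
  have hr : r <= 3446 / 1000 by rewrite /r ler_pdivrMr //; lra.
  have a0 : 0 <= 24%:R * (u%:R - 1) :> R by lra.
  have r0 : 0 <= r := divr_ge0 a0 (ltW d0).
  have assoc (a d x : R) : c * (a * q) / (x * d) = c * (a / d * q / x).
    by rewrite invfM; ring.
  rewrite assoc -/r.
  have hrq : r * q <= 3446 / 1000 * (2081 / 100) := ler_pM r0 q0 hr hq.
  have c0 : 0 <= c by lra.
  have hrq' : r * q / 12%:R <= 5976 / 1000.
    by move: (r * q) hrq => x; clear; lra.
  have := ler_wpM2l c0 hrq'; move: (c * (_ / _)) c1 => x; clear; lra.
Qed.

End Instances.

Theorem mainTheorem4 (R : realType) :
  (forall eps : R, 0 < eps < 1 ->
     separator_computable (4 / 5 : R)
       (fun c => 2 * Num.sqrt 2 / (1 - eps) * c)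
       (fun c n => c ^+ 2 * n%:R)) /\
  separator_computable (2 / 3 : R)
    (fun c => 6 * c)
    (fun c n => c ^+ 2 * n%:R).
Proof. by split; [exact: square_separator | exact: rectangle_separator]. Qed.
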